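(* Let $L_t$ be a Lévy process on $\mathbb R^d$ with Lévy measure $\nu$, and let $A$ be a $d\times d$ real matrix. Let $\rho_0$ be a non-negative differentiable function on $\mathbb R^d$ such that $\nu(\mathrm dz)\ge\rho_0(z)\,\mathrm dz=:\nu_0(\mathrm dz)$, $\lambda_0:=\int_{\mathbb R^d}\rho_0(z)\,\mathrm dz\in(0,\infty)$, and $$\int_{\mathbb R^d}\Big\{\sup_{x:|x-z|\le\varepsilon}|\nabla\rho_0|(x)\Big\}\mathrm dz<\infty$$ for some $\varepsilon>0$. Realize $L_t=L_t^1+L_t^0$, where $L_t^0=\sum_{i=1}^{N_t}\xi_i$ (with $\sum_{i=1}^0\xi_i=0$) is a compound Poisson process with Lévy measure $\nu_0$: $N_t$ is a Poisson process with rate $\lambda_0$ and jump times $\tau_1<\tau_2<\cdots$, and $\{\xi_i\}$ are i.i.d. with common distribution $\nu_0/\lambda_0$, independent of $(N_t)$; and $L_t^1$ is a Lévy process with Lévy measure $\nu-\nu_0$, independent of $L^0$, such that $L^1+L^0$ has the law of $L$. Let $X_t^x=e^{tA}x+\int_0^te^{(t-s)A}\,\mathrm dL_s$ be the solution of $\mathrm dX_t=AX_t\,\mathrm dt+\mathrm dL_t$, $X_0=x$, and define $$P_t^1f(x)=\mathbb E\big\{f(X_t^x)1_{\{N_t\ge1\}}\big\},\quad f\in\mathscr B_b(\mathbb R^d),\ t>0.$$ Then for any $t>0$ and $f\in\mathscr B_b(\mathbb R^d)$, $P_t^1f$ is differentiable and $$\nabla P_t^1f(x)=-\mathbb E\Big\{f(X_t^x)1_{\{N_t\ge1\}}\frac1{N_t}\sum_{i=1}^{N_t}e^{A^*\tau_i}\nabla\log\rho_0(\xi_i)\Big\},$$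 where $A^*$ is the transpose of $A$. Consequently, if $A\le-\theta I$ for some $\theta\in\mathbb R$, then $$\|\nabla P_t^1f\|_\infty\le\|f\|_\infty\frac{e^{\theta^-t}(1-e^{-\lambda_0t})}{\lambda_0}\int_{\mathbb R^d}|\nabla\rho_0|(z)\,\mathrm dz,\quad t>0,\ f\in\mathscr B_b(\mathbb R^d).$$
   Context: $\mathscr B_b(\mathbb R^d)$ is the set of bounded measurable functions with sup norm $\|\cdot\|_\infty$; $\|\nabla g\|_\infty=\sup_x|\nabla g(x)|$. $\theta^-=\max(-\theta,0)$. $A\le-\theta I$ means $\langle Ax,x\rangle\le-\theta|x|^2$ for all $x$. *)

(* Defs.v *)
From HB Require Import structures.
From mathcomp Require Import all_boot all_order all_algebra.
From mathcomp Require Import all_classical all_reals all_analysis.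

Set Implicit Arguments.
Unset Strict Implicit.
Unset Printing Implicit Defensive.

Import Order.TTheory GRing.Theory Num.Theory.
Import numFieldNormedType.Exports.

Local Open Scope classical_set_scope.
Local Open Scope ring_scope.

Definition eucl (R : realType) (d : nat) (v : 'cV[R]_d) : R :=
  Num.sqrt (\sum_(i < d) v i ord0 ^+ 2).

Definition inner (R : realType) (d : nat) (x y : 'cV[R]_d) : R :=
  \sum_(i < d) x i ord0 * y i ord0.

Definition grad (R : realType) (d : nat) (g : 'cV[R]_d -> R) (x : 'cV[R]_d)
  : 'cV[R]_d :=
  \col_(i < d) ('D_(delta_mx i ord0) g x).

Definition supnorm (R : realType) (d : nat) (f : 'cV[R]_d -> R) : R :=
  sup [set `|f x| | x in [set: 'cV[R]_d]].

Definition mxpow (R : realType) (d : nat) (M : 'M[R]_d) (k : nat) : 'M[R]_d :=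
  iter k (mulmx M) 1%:M.

Definition expm (R : realType) (d : nat) (M : 'M[R]_d) : 'M[R]_d :=
  limn (fun n : nat => \sum_(k < n) (k`!%:R)^-1 *: mxpow M k).

Definition borelRd (R : realType) (d : nat) : set (set 'cV[R]_d) :=
  <<s [set U : set 'cV[R]_d | open U] >>.

Definition borel_fun (R : realType) (d : nat) (f : 'cV[R]_d -> R) : Prop :=
  forall B : set R, measurable B -> borelRd (f @^-1` B).

Definition bounded_measurable (R : realType) (d : nat) (f : 'cV[R]_d -> R) : Prop :=
  borel_fun f /\ exists M : R, forall x, `|f x| <= M.

(* ---------- Lebesgue integral on R^d (iterated, nonnegative integrands) ---------- *)

Fixpoint intRd (R : realType) (d : nat) : ('cV[R]_d -> \bar R) -> \bar R :=
  match d with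
  | 0 => fun f => f 0
  | d'.+1 => fun f =>
      (\int[@lebesgue_measure R]_(x in [set: R])
          intRd (fun y : 'cV[R]_d' =>
                   f (\col_(i < d'.+1)
                        match unlift ord0 i with
                        | None => x
                        | Some j => y j ord0
                        end)))%E
  end.

Definition nu0 (R : realType) (d : nat) (rho0 : 'cV[R]_d -> R) (B : set 'cV[R]_d)
  : \bar R :=
  intRd (fun z => (\1_B z * rho0 z)%:E).

Definition vint (R : realType) (d : nat) (a b : R) (g : R -> 'cV[R]_d) : 'cV[R]_d :=
  \col_(i < d) Rintegral (@lebesgue_measure R) `[a, b] (fun s => g s i ord0).

Section Prob.
Context (R : realType) (d0 : measure_display) (Omega : measurableType d0).

Definition rvec_meas (d : nat) (X : Omega -> 'cV[R]_d) : Prop :=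
  forall B, borelRd B -> measurable (X @^-1` B).

Definition sig_rv (d : nat) (X : Omega -> 'cV[R]_d) : set (set Omega) :=
  [set X @^-1` B | B in borelRd (R := R) (d := d)].

Definition sig_rvR (Y : Omega -> R) : set (set Omega) :=
  [set Y @^-1` B | B in [set B : set R | measurable B]].

Definition sig_nat (Y : Omega -> nat) : set (set Omega) :=
  [set Y @^-1` B | B in [set: set nat]].

Definition indep_fam (P : probability Omega R) (I : eqType)
    (F : I -> set (set Omega)) : Prop :=
  forall (J : seq I) (E : I -> set Omega), uniq J ->
    (forall i, i \in J -> F i (E i)) ->
    fine (P (\bigcap_(i in [set i | i \in J]) E i)) = \prod_(i <- J) fine (P (E i)).

Definition indep2 (P : probability Omega R) (G H : set (set Omega)) : Prop :=
  forall A B, G A -> H B -> fine (P (A `&` B)) = fine (P A) * fine (P B).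

Definition sig_proc (d : nat) (X : R -> Omega -> 'cV[R]_d) : set (set Omega) :=
  <<s \bigcup_(t in [set t : R | 0 <= t]) sig_rv (X t) >>.

Definition levy_process (P : probability Omega R) (d : nat)
    (L : R -> Omega -> 'cV[R]_d) : Prop :=
  [/\ (forall w, L 0 w = 0) /\
      (forall t, 0 <= t -> rvec_meas (L t)),
      (forall w t, 0 <= t -> (fun s => L s w) @ at_right t --> L t w),
      (forall w t, 0 < t -> cvg ((fun s => L s w) @ at_left t)),
      (forall (n : nat) (ts : nat -> R), 0 <= ts 0 ->
          (forall k, (k < n)%N -> ts k < ts k.+1) ->
          indep_fam P (fun k : 'I_n =>
                         sig_rv (fun w => L (ts k.+1) w - L (ts k) w))) &
      (forall s t B, 0 <= s -> s <= t -> borelRd B ->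
          P ((fun w => L t w - L s w) @^-1` B) = P (L (t - s) @^-1` B))].

Definition jump (d : nat) (L : R -> Omega -> 'cV[R]_d) (s : R) (w : Omega)
  : 'cV[R]_d :=
  L s w - lim ((fun u => L u w) @ at_left s).

Definition levy_measure (P : probability Omega R) (d : nat)
    (L : R -> Omega -> 'cV[R]_d) (B : set 'cV[R]_d) : \bar R :=
  (\int[P]_w (\esum_(s in [set s : R | (0 < s <= 1)%R /\ (jump L s w != 0)%R
                                        /\ B (jump L s w)]) 1))%E.

(* inter-arrival times: tau_1 - 0, tau_2 - tau_1, ... (tau_k meaningful for k >= 1) *)
Definition gap (tau : nat -> Omega -> R) (k : nat) (w : Omega) : R :=
  tau k.+1 w - (if k is 0 then 0 else tau k w).

Definition poisson_jumps (P : probability Omega R) (lam : R)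
    (N : R -> Omega -> nat) (tau : nat -> Omega -> R) : Prop :=
  [/\ (forall k, measurable_fun [set: Omega] (tau k.+1)) /\
      (forall w, 0 < tau 1%N w),
      (forall w k, (0 < k)%N -> tau k w < tau k.+1 w),
      (* N_t = #{ k >= 1 : tau_k <= t } *)
      (forall t w k, (0 < k)%N -> ((k <= N t w)%N <-> tau k w <= t)),
      indep_fam P (fun k : nat => sig_rvR (gap tau k)) &
      (forall k s, P [set w | gap tau k w <= s] =
                   (if 0 <= s then 1 - expR (- (lam * s)) else 0)%:E)].

Definition cpoisson (d : nat) (N : R -> Omega -> nat) (xi : nat -> Omega -> 'cV[R]_d)
    (t : R) (w : Omega) : 'cV[R]_d :=
  \sum_(1 <= i < (N t w).+1) xi i w.

(* X_t^x = e^{tA} x + int_0^t e^{(t-s)A} dL_s, the stochastic integral with the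
   deterministic C^1 integrand being computed pathwise by integration by parts:
   int_0^t e^{(t-s)A} dL_s = L_t + int_0^t A e^{(t-s)A} L_s ds   (L_0 = 0). *)
Definition OU (d : nat) (A : 'M[R]_d) (L : R -> Omega -> 'cV[R]_d)
    (t : R) (x : 'cV[R]_d) (w : Omega) : 'cV[R]_d :=
  expm (t *: A) *m x + L t w
  + vint 0 t (fun s => A *m expm ((t - s) *: A) *m L s w).

Definition Evec (P : probability Omega R) (d : nat) (V : Omega -> 'cV[R]_d)
  : 'cV[R]_d :=
  \col_(i < d) Rintegral P [set: Omega] (fun w => V w i ord0).

End Prob.

(* Main.v *)
(**
  On [{N_t = n}] and for each [i <= n],
    X_t^x = Y_i + e^{(t - tau_i) A} (xi_i + e^{tau_i A} x),
  where [Y_i], [tau_i] and [{N_t = n}] depend only on [L^1], [N] and the other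
  jumps, hence are independent of [xi_i].  Moving [x] by [h] therefore amounts
  to translating [xi_i] by [e^{tau_i A} h]; since the law of [xi_i] has density
  [rho0 / lam0], this is a translation of the density, whose first-order Taylor
  remainder is [o(|h|)] in [L^1] by dominated convergence, the supremum
  condition on [grad rho0] providing the dominating function.  The remainder is
  uniform in [n] and [i], so averaging over [i <= n] and summing over [n] gives
  the derivative.  The bound follows from [|e^{s A^*} v| <= e^{- theta s} |v|]
  and [E |grad log rho0 (xi_i)| = lam0^-1 \int |grad rho0|].
*)
Require Import Defs.
From HB Require Import structures.
From mathcomp Require Import all_boot all_order all_algebra.
From mathcomp Require Import all_classical all_reals all_analysis.
From mathcomp Require Import measurable_realfun matrix_normedtype ring.

Set Implicit Arguments.
Unset Strict Implicit.
Unset Printing Implicit Defensive.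

Import Order.TTheory GRing.Theory Num.Theory.
Import numFieldNormedType.Exports.

Local Open Scope classical_set_scope.
Local Open Scope ring_scope.

(** * Borel sets and Lebesgue measure on R^d *)

(** The delicate point is the independence of [xi_i] from [L1], [N] and the other jumps taken
    together. The assumptions only separate [L1] from the process [L0], the jumps from [N], and the
    jumps from one another; joint independence follows once [N] and the [xi_i] are seen to be
    functions of the path of [L0]. A jump of size zero leaves no trace on that path, so this holds
    only almost surely, and only because a law with a density on R^d, d >= 1, has no atom at the
    origin. In dimension zero the path carries no information and the claims are checked directly.

    Since [f] is merely bounded and Borel, no derivative may fall on it: the translation has to be
    moved onto [rho0]. The gradient of [rho0] need not be continuous, so the remainder is controlled
    by the mean value theorem. A zero of [rho0] is a minimum, hence a critical point; this is why
    the logarithmic gradient times [rho0] gives back the gradient everywhere, and why the zeros of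
    [rho0] cost nothing. *)

Notation Bd R d := (g_sigma_algebraType [set U : set 'cV[R]_d | open U]).

Lemma measurable_coord (R : realType) (d : nat) (i : 'I_d) :
  measurable_fun [set: Bd R d] (fun v : Bd R d => (v : 'cV[R]_d) i ord0).
Proof.
apply: (measurability _ (RGenOInfty.measurableE R)) => //.
move=> _ [_ [a ->] <-]; rewrite setTI.
apply: sub_sigma_algebra.
have : continuous (fun v : 'cV[R]_d => v i ord0) by exact: coord_continuous.
by move/continuousP; apply; exact: interval_open.
Qed.

(** A countable base, needed to reduce measurability for the sigma-algebra generated by all open
    sets to countably many balls. *)
Lemma open_bigcup_ballQ (R : realType) (d : nat) (U : set 'cV[R]_d) : open U ->
  U = \bigcup_(qk in [set qk : 'cV[rat]_d * nat |
         ball (map_mx ratr qk.1 : 'cV[R]_d) qk.2.+1%:R^-1 `<=` U])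
       ball (map_mx ratr qk.1 : 'cV[R]_d) qk.2.+1%:R^-1.
Proof.
move=> oU; apply/seteqP; split => [x Ux|x [qk /= qkU] ]; last exact: qkU.
have /nbhs_ballP[e /= e0 eU] := open_nbhs_nbhs (conj oU Ux).
(* A radius below [e / 2] makes any such ball that contains [x] lie inside the ball of radius [e]
   around [x]. *)
have [k ke] : exists k : nat, k.+1%:R^-1 < e / 2.
  exists (Num.truncn (e / 2)^-1).
  rewrite -[ltRHS]invrK ltf_pV2 ?posrE ?invr_gt0 ?divr_gt0 ?ltr0n//.
  exact: truncnS_gt.
pose k0 : R := k.+1%:R^-1.
have k00 : 0 < k0 by rewrite invr_gt0 ltr0n.
have Hq i : exists q : rat, `|x i ord0 - ratr q| < k0.
  have : x i ord0 - k0 < x i ord0 + k0 by rewrite ltrBlDr -addrA ltrDl addr_gt0.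
  move=> /rat_in_itvoo[q]; rewrite in_itv/= => /andP[q1 q2].
  exists q; rewrite ltr_norml; apply/andP; split.
    by rewrite ltrBrDr addrC ltrBlDr.
  by rewrite ltrBlDr -ltrBlDl.
pose q := \col_i projT1 (cid (Hq i)).
have bq : ball (map_mx ratr q : 'cV[R]_d) k0 x.
  split=> // i j; rewrite !mxE /ball /= (ord1 j) distrC.
  by case: cid.
exists (q, k) => //= y yq; apply: eU.
apply: (@ball_split _ _ (map_mx ratr q : 'cV[R]_d)).
  by apply/ball_sym; apply: le_ball bq; exact: ltW.
by apply: le_ball yq; exact: ltW.
Qed.

(** Balls are those of the sup norm, so the preimage of a rational ball is a finite intersection of
    conditions on single coordinates. *)
Lemma measurable_fun_coordP {d1} (T : measurableType d1) (R : realType) (d : nat)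
    (f : T -> 'cV[R]_d) :
  (forall i, measurable_fun [set: T] (fun t => f t i ord0)) ->
  measurable_fun [set: T] (f : T -> Bd R d).
Proof.
move=> mf.
apply: (@measurability _ _ T (Bd R d) setT f _ erefl).
move=> _ [U /= oU <-]; rewrite setTI.
rewrite (open_bigcup_ballQ oU) preimage_bigcup bigcup_mkcond.
apply: countable_bigcupT_measurable => // -[q k].
case: ifP => _ //.
rewrite (_ : _ @^-1` _ = \bigcap_(i in [set: 'I_d])
    (fun t => f t i ord0) @^-1` (ball (ratr (q i ord0) : R) k.+1%:R^-1)).
  apply: fin_bigcap_measurable => // i _; rewrite -[X in measurable X]setTI.
  by apply: mf => //; exact: measurable_ball.
apply/seteqP; split=> [t [_ bt] i _|t bt].
  by have := bt i ord0; rewrite !mxE.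
by split=> // i j; rewrite !mxE (ord1 j); exact: bt.
Qed.

(** A pushforward can lose sigma-finiteness; a measurable left inverse [g] pulls the exhausting sets
    back to sets of the same measure. *)
Lemma sigma_finite_pushforward d1 d2 (T1 : measurableType d1)
    (T2 : measurableType d2) (R : realType)
    (m : {measure set T1 -> \bar R}) (f : T1 -> T2) (g : T2 -> T1) :
  sigma_finite setT m ->
  measurable_fun [set: T1] f -> measurable_fun [set: T2] g -> cancel f g ->
  exists mu : {sigma_finite_measure set T2 -> \bar R},
    forall A, mu A = m (f @^-1` A).
Proof.
move=> [F UF Ffin] mf mg fK.
pose p : {measure set T2 -> \bar R} := measure_function_pushforward__canonical__measure_function_Measure m mf.
have sp : sigma_finite setT (pushforward m f).
  exists (fun i => g @^-1` F i) => [|i].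
    by rewrite -preimage_bigcup -UF preimage_setT.
  have [mFi mFioo] := Ffin i; split.
    by rewrite -[X in measurable X]setTI; exact: mg.
  by rewrite /pushforward -comp_preimage (_ : g \o f = id)//; apply/funext.
pose q : {sigma_finite_measure set T2 -> \bar R} :=
  HB.pack (pushforward m f) (Measure.class p) (Measure_isSigmaFinite.Build _ _ _ (pushforward m f) sp).
by exists (q mf mf mf).
Qed.

Lemma product_sigma_finite d1 d2 (T1 : measurableType d1)
    (T2 : measurableType d2) (R : realType)
    (m1 : {sigma_finite_measure set T1 -> \bar R})
    (m2 : {sigma_finite_measure set T2 -> \bar R}) :
  sigma_finite setT (m1 \x m2)%E.
Proof.
have /sigma_finiteP[F [TF ndF Foo]] := sigma_finiteT m1.
have /sigma_finiteP[G [TG ndG Goo]] := sigma_finiteT m2.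
exists (fun n => F n `*` G n) => [|k].
  rewrite -setXTT TF TG; apply/seteqP; split=> [[x y] [/= [n _ Fx] [k _ Gy]]|].
    exists (maxn n k) => //; split => /=.
      by move: x Fx; exact/subsetPset/ndF/leq_maxl.
    by move: y Gy; exact/subsetPset/ndG/leq_maxr.
  by move=> [x y] [n _ []/= ? ?]; split; exists n.
have [mF Fk] := Foo k; have [mG Gk] := Goo k; split; first exact: measurableX.
by rewrite product_measure1E// lte_mul_pinfty// ge0_fin_numE.
Qed.

Definition consv (R : realType) (d : nat) (x : R) (y : 'cV[R]_d) : 'cV[R]_d.+1 :=
  \col_(i < d.+1) match unlift ord0 i with
                  | None => x
                  | Some j => y j ord0
                  end.

Lemma measurable_consv (R : realType) (d : nat) :
  measurable_fun [set: (measurableTypeR R * Bd R d)%type]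
    (fun p => consv p.1 p.2 : Bd R d.+1).
Proof.
apply: measurable_fun_coordP => i.
rewrite (_ : (fun t => _) = fun p => match unlift ord0 i with
    | None => p.1 | Some j => (p.2 : 'cV[R]_d) j ord0 end); last first.
  by apply/funext => p; rewrite mxE.
case: unliftP => [j _|_].
  apply: (measurableT_comp (@measurable_coord R d j)); exact: measurable_snd.
exact: measurable_fst.
Qed.

(** [intRd] is an iterated integral, not an integral against a measure. Representing it by one,
    through products and Tonelli, opens the way to dominated convergence and to signed
    integrands. *)
Lemma lebesgue_Rd (R : realType) (d : nat) :
  exists mu : {sigma_finite_measure set (Bd R d) -> \bar R},
    forall f : Bd R d -> \bar R, measurable_fun [set: Bd R d] f ->
      (forall x, (0 <= f x)%E) -> (\int[mu]_x f x = intRd f)%E.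
Proof.
elim: d => [|d [mu muE]].
  exists (@dirac _ (Bd R 0) (0 : 'cV[R]_0) R) => f mf f0 /=.
  by rewrite integral_dirac// diracT mul1e.
have mc := @measurable_consv R d.
have [q qE] : exists q : {sigma_finite_measure set (Bd R d.+1) -> \bar R},
    forall A, q A = (@lebesgue_measure R \x mu)%E ((fun p => consv p.1 p.2 : Bd R d.+1) @^-1` A).
  pose g (v : Bd R d.+1) : measurableTypeR R * Bd R d :=
    ((v : 'cV[R]_d.+1) ord0 ord0, \col_(i < d) (v : 'cV[R]_d.+1) (lift ord0 i) ord0).
  apply: (sigma_finite_pushforward (g := g) (product_sigma_finite _ _) mc).
    apply/measurable_fun_pair => /=; first exact: measurable_coord.
    apply: measurable_fun_coordP => i.
    rewrite (_ : (fun t => _) = fun t : 'cV[R]_d.+1 => t (lift ord0 i) ord0).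
      exact: measurable_coord.
    by apply/funext => t; rewrite mxE.
  move=> [x y]; rewrite /g /=; congr pair; first by rewrite mxE unlift_none.
  by apply/colP => i; rewrite !mxE liftK.
exists q => f mf f0 /=.
transitivity (\int[@lebesgue_measure R \x mu]_p f (consv p.1 p.2))%E.
  rewrite -[RHS](@ge0_integral_pushforward _ _ _ _ _ _ mc _ setT f)//.
  by apply: eq_measure_integral => A mA _; exact: qE.
rewrite fubini_tonelli1//; last exact: (measurableT_comp mf mc).
apply: eq_integral => x _; rewrite /fubini_F/= muE//.
apply: (measurableT_comp mf).
exact: (measurableT_comp mc (@pair1_measurable _ _ _ _ x)).
Qed.

(** No measurability is asked for, because the integral of a non-negative function is a supremum
    over the simple functions below it. This matters for the supremum over closed balls in the
    hypothesis on [rho0]. *)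
Lemma ge0_le_integralT d1 (T : measurableType d1) (R : realType)
    (mu : {measure set T -> \bar R}) (f g : T -> \bar R) :
  (forall x, (0 <= f x)%E) -> (forall x, (f x <= g x)%E) ->
  (\int[mu]_x f x <= \int[mu]_x g x)%E.
Proof.
move=> f0 fg.
have g0 x : (0 <= g x)%E := le_trans (f0 x) (fg x).
rewrite !ge0_integralTE//; apply: le_ereal_sup => _ /= [h hf <-].
by exists h => // x; exact: le_trans (hf x) (fg x).
Qed.

Lemma intRd_ge0 (R : realType) (d : nat) (f : 'cV[R]_d -> \bar R) :
  (forall x, (0 <= f x)%E) -> (0 <= intRd f)%E.
Proof.
elim: d f => [|d IH] f f0 /=; first exact: f0.
by apply: integral_ge0 => x _; exact: IH.
Qed.

Lemma le_intRd (R : realType) (d : nat) (f g : 'cV[R]_d -> \bar R) :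
  (forall x, (0 <= f x)%E) -> (forall x, (f x <= g x)%E) ->
  (intRd f <= intRd g)%E.
Proof.
elim: d f g => [|d IH] f g f0 fg /=; first exact: fg.
apply: ge0_le_integralT => x; first exact: intRd_ge0.
exact: IH.
Qed.

Lemma eq_intRd (R : realType) (d : nat) (f g : 'cV[R]_d -> \bar R) :
  f =1 g -> intRd f = intRd g.
Proof. by move=> /funext ->. Qed.

Definition leb (R : realType) (d : nat) :
  {sigma_finite_measure set (Bd R d) -> \bar R} := projT1 (cid (lebesgue_Rd R d)).

Lemma integral_leb (R : realType) (d : nat) (f : Bd R d -> \bar R) :
  measurable_fun [set: Bd R d] f -> (forall x, (0 <= f x)%E) ->
  (\int[leb R d]_x f x = intRd f)%E.
Proof. by move=> mf f0; rewrite /leb; case: cid => mu /= muE; exact: muE. Qed.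

Lemma lebesgue_measure_shift (R : realType) (a : R) (A : set R) : measurable A ->
  pushforward lebesgue_measure (fun x : measurableTypeR R => x + a : measurableTypeR R) A =
  lebesgue_measure A.
Proof.
have mshift : measurable_fun [set: measurableTypeR R]
    (fun x : measurableTypeR R => x + a : measurableTypeR R).
  exact: measurable_funD.
move=> mA; apply/esym.
pose m : {measure set (measurableTypeR R) -> \bar R} :=
  measure_function_pushforward__canonical__measure_function_Measure lebesgue_measure mshift.
apply: (@lebesgue_measure_unique R m) => // _ [[b c]] _ <- /=.
rewrite /pushforward (_ : _ @^-1` _ = `]b - a, c - a]%classic); last first.
  by apply/seteqP; split=> x /=; rewrite !in_itv/= ltrBlDr lerBrDr.
rewrite !lebesgue_measure_itv/= !lte_fin ltrD2r; case: ifP => // _.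
by rewrite -!EFinB opprB addrA addrNK.
Qed.

Lemma ge0_integral_shift (R : realType) (a : R) (f : R -> \bar R) :
  measurable_fun [set: R] f -> (forall x, (0 <= f x)%E) ->
  (\int[lebesgue_measure]_x f (x + a)%R = \int[lebesgue_measure]_x f x)%E.
Proof.
move=> mf f0.
have mshift : measurable_fun [set: measurableTypeR R]
    (fun x : measurableTypeR R => x + a : measurableTypeR R).
  exact: measurable_funD.
rewrite -[LHS](@ge0_integral_pushforward _ _ _ _ _ _ mshift _ setT f)//.
apply: eq_measure_integral => A mA _; exact: lebesgue_measure_shift.
Qed.

Lemma measurable_intRd (d1 : measure_display) (T : measurableType d1)
    (R : realType) (d : nat) (f : T * Bd R d -> \bar R) :
  measurable_fun [set: (T * Bd R d)%type] f -> (forall x, (0 <= f x)%E) ->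
  measurable_fun [set: T] (fun t => intRd (fun z => f (t, z))).
Proof.
move=> mf f0.
rewrite (_ : (fun t => _) = fubini_F (leb R d) f); last first.
  apply/funext => t; rewrite /fubini_F integral_leb//.
  exact: (measurableT_comp mf (@pair1_measurable _ _ _ _ t)).
exact: measurable_fun_fubini_tonelli_F.
Qed.

(** Induction on the dimension: the tail of [k] is absorbed by the inner integral, its first
    coordinate by translation invariance on the line. *)
Lemma intRd_shift (R : realType) (d : nat) (k : 'cV[R]_d) (f : Bd R d -> \bar R) :
  measurable_fun [set: Bd R d] f -> (forall x, (0 <= f x)%E) ->
  intRd (fun z : 'cV[R]_d => f (z + k)) = intRd f.
Proof.
elim: d k f => [|d IH] k f mf f0 /=; first by rewrite (flatmx0 (0 + k)).
have mfx x : measurable_fun [set: Bd R d] (fun y : Bd R d => f (consv x y)).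
  apply: (measurableT_comp mf).
  exact: (measurableT_comp (@measurable_consv R d) (@pair1_measurable _ _ _ _ x)).
transitivity (\int[lebesgue_measure]_x
    intRd (fun y : 'cV[R]_d => f (consv (x + k ord0 ord0)%R y)))%E; last first.
  rewrite (@ge0_integral_shift R (k ord0 ord0)
    (fun x => intRd (fun y : 'cV[R]_d => f (consv x y))))//.
    apply: (@measurable_intRd _ (measurableTypeR R) R d (fun p => f (consv p.1 p.2))) => //.
    exact: (measurableT_comp mf (@measurable_consv R d)).
  by move=> x; exact: intRd_ge0.
apply: eq_integral => x _.
rewrite -(IH (\col_i k (lift ord0 i) ord0) (fun y => f (consv (x + k ord0 ord0) y)))//.
apply: eq_intRd => y; congr f; apply/colP => i; rewrite !mxE.
by case: unliftP => [j ->|->]; rewrite ?mxE.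
Qed.

Lemma integral_leb_shift (R : realType) (d : nat) (k : 'cV[R]_d)
    (f : Bd R d -> \bar R) : measurable_fun [set: Bd R d] f ->
  (\int[leb R d]_z f ((z : 'cV[R]_d) + k)%R = \int[leb R d]_z f z)%E.
Proof.
have mk : measurable_fun [set: Bd R d] (fun z : Bd R d => (z : 'cV[R]_d) + k : Bd R d).
  apply: measurable_fun_coordP => i.
  rewrite (_ : (fun t => _) = fun t : 'cV[R]_d => t i ord0 + k i ord0).
    by apply: measurable_funD => //; exact: measurable_coord.
  by apply/funext => t; rewrite mxE.
have H g : measurable_fun [set: Bd R d] g -> (forall x, (0 <= g x)%E) ->
    (\int[leb R d]_z g ((z : 'cV[R]_d) + k)%R = \int[leb R d]_z g z)%E.
  by move=> mg g0; rewrite !integral_leb ?intRd_shift//; exact: (measurableT_comp mg mk).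
move=> mf; rewrite [LHS]integralE [RHS]integralE.
congr (_ - _)%E.
  rewrite -(H f^\+%E (measurable_funepos mf))//.
  by apply: eq_integral => z _; rewrite !funeposE.
rewrite -(H f^\-%E (measurable_funeneg mf))//.
by apply: eq_integral => z _; rewrite !funenegE.
Qed.

(** * Euclidean norm and gradients *)

Section euclidean.
Variables (R : realType) (d : nat).
Implicit Types (x y v h : 'cV[R]_d) (g : 'cV[R]_d -> R).

Lemma inner_is_linear v : linear (inner v : 'cV[R]_d -> R).
Proof.
move=> a x y; rewrite /inner scaler_sumr -big_split; apply: eq_bigr => i _ /=.
by rewrite !mxE mulrDr mulrCA.
Qed.

HB.instance Definition _ v := GRing.isLinear.Build R 'cV[R]_d R _ (inner v)
  (inner_is_linear v).

Lemma innerC x y : inner x y = inner y x.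
Proof. by apply: eq_bigr => i _; rewrite mulrC. Qed.

Lemma sqr_eucl x : eucl x ^+ 2 = inner x x.
Proof.
rewrite sqr_sqrtr; first by apply: eq_bigr => i _; rewrite expr2.
by apply: sumr_ge0 => i _; exact: sqr_ge0.
Qed.

Lemma eucl_ge0 x : 0 <= eucl x. Proof. exact: sqrtr_ge0. Qed.

Lemma eucl0 : eucl (0 : 'cV[R]_d) = 0.
Proof. by rewrite /eucl big1 ?sqrtr0// => i _; rewrite mxE expr0n. Qed.

Lemma euclZ (a : R) x : eucl (a *: x) = `|a| * eucl x.
Proof.
rewrite /eucl -sqrtr_sqr -sqrtrM ?sqr_ge0// mulr_sumr; congr Num.sqrt.
by apply: eq_bigr => i _; rewrite mxE exprMn.
Qed.

Lemma euclN x : eucl (- x) = eucl x.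
Proof. by rewrite -scaleN1r euclZ normrN1 mul1r. Qed.

Lemma eucl_eq0 x : eucl x = 0 -> x = 0.
Proof.
move=> /(congr1 (fun a => a ^+ 2)); rewrite sqr_eucl expr0n/= => /eqP.
rewrite psumr_eq0 => [/allP x0|i _]; last by rewrite -expr2 sqr_ge0.
apply/colP => i; rewrite mxE; apply/eqP.
by have := x0 i; rewrite mem_index_enum mulf_eq0 orbb => /(_ isT).
Qed.

Lemma innerDr v x y : inner v (x + y) = inner v x + inner v y.
Proof. exact: (linearD (inner v)). Qed.

Lemma innerBr v x y : inner v (x - y) = inner v x - inner v y.
Proof. exact: (linearB (inner v)). Qed.

Lemma inner0r v : inner v 0 = 0.
Proof. exact: (linear0 (inner v)). Qed.

Lemma innerNr v x : inner v (- x) = - inner v x.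
Proof. exact: (linearN (inner v)). Qed.

Lemma innerZr v a x : inner v (a *: x) = a * inner v x.
Proof. exact: (linearZ_LR (inner v)). Qed.

Lemma innerDl v x y : inner (x + y) v = inner x v + inner y v.
Proof. by rewrite innerC innerDr !(innerC v). Qed.

Lemma innerBl v x y : inner (x - y) v = inner x v - inner y v.
Proof. by rewrite innerC innerBr !(innerC v). Qed.

Lemma innerZl v a x : inner (a *: x) v = a * inner x v.
Proof. by rewrite innerC innerZr innerC. Qed.

Lemma inner_le x y : `|inner x y| <= eucl x * eucl y.
Proof.
have [/eucl_eq0 ->|y0] := eqVneq (eucl y) 0.
  by rewrite linear0 normr0 mulr_ge0 ?eucl_ge0.
have ygt0 : 0 < eucl y ^+ 2 by rewrite exprn_gt0// lt_def y0 eucl_ge0.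
rewrite -(@ler_pXn2r _ 2)// ?nnegrE ?mulr_ge0 ?eucl_ge0// -normrX ger0_norm ?sqr_ge0//.
(* The coefficient of the orthogonal projection of [x] on [y]; the squared residual being
   non-negative is the inequality. *)
pose t := inner x y / eucl y ^+ 2.
have : 0 <= inner (x - t *: y) (x - t *: y) by rewrite -sqr_eucl sqr_ge0.
rewrite innerBr !innerBl !innerZr !innerZl (innerC y x) -!sqr_eucl.
have -> : t * eucl y ^+ 2 = inner x y by rewrite /t divfK// gt_eqF.
rewrite subrr subr0 subr_ge0 /t => H.
rewrite exprMn -ler_pdivrMr//.
by move: H; rewrite expr2 mulrAC.
Qed.

Lemma eucl_triangle x y : eucl (x + y) <= eucl x + eucl y.
Proof.
rewrite -(@ler_pXn2r _ 2)// ?nnegrE ?addr_ge0 ?eucl_ge0// sqr_eucl.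
rewrite innerDr !innerDl (innerC y x) -!sqr_eucl sqrrD addrA mulr2n.
have := le_trans (ler_norm _) (inner_le x y).
by move=> ?; rewrite lerD2r -!addrA lerD2l lerD.
Qed.

Lemma coord_le_norm x i : `|x i ord0| <= `|x|.
Proof.
rewrite /Num.Def.normr/= mx_normrE.
by apply: (le_trans _ (le_bigmax _ _ (i, ord0))).
Qed.

Lemma coord_le_eucl x i : `|x i ord0| <= eucl x.
Proof.
rewrite -sqrtr_sqr ler_wsqrtr// (bigD1 i)//= lerDl.
by apply: sumr_ge0 => j _; exact: sqr_ge0.
Qed.

Lemma norm_le_eucl x : `|x| <= eucl x.
Proof.
rewrite /Num.Def.normr/= mx_normrE; apply: bigmax_le; first exact: eucl_ge0.
by move=> [i j] _ /=; rewrite (ord1 j) coord_le_eucl.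
Qed.

Lemma eucl_le_sum x : eucl x <= \sum_(i < d) `|x i ord0|.
Proof.
rewrite -(@ler_pXn2r _ 2)// ?nnegrE ?eucl_ge0 ?sumr_ge0// sqr_eucl expr2.
rewrite mulr_suml; apply: ler_sum => i _.
apply: le_trans (ler_norm _) _; rewrite normrM ler_wpM2l//.
by rewrite (bigD1 i)//= lerDl sumr_ge0.
Qed.

Lemma eucl_le_norm x : eucl x <= d%:R * `|x|.
Proof.
apply: le_trans (eucl_le_sum x) _.
rewrite mulr_natl -[X in _ *+ X]card_ord -sumr_const.
by apply: ler_sum => i _; exact: coord_le_norm.
Qed.

Lemma near_dist_le x e : 0 < e -> \forall y \near x, `|x - y| <= e.
Proof. by move=> e0; apply/(@nbhs_normP R 'cV[R]_d); exists e => // y /ltW. Qed.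

Lemma continuous_eucl : continuous (@eucl R d).
Proof.
move=> x; apply/(@cvgrPdist_le R R 'cV[R]_d (nbhs x) _) => e e0.
(* [d.+1] instead of [d] keeps the quotient positive in dimension zero. *)
have e1 : 0 < e / d.+1%:R by rewrite divr_gt0.
apply: filterS (near_dist_le x e1) => y xy.
have H : eucl (x - y) <= e.
  apply: le_trans (eucl_le_norm _) _.
  apply: (@le_trans _ _ (d.+1%:R * (e / d.+1%:R))); last by rewrite mulrC divfK.
  by apply: ler_pM => //; rewrite ler_nat.
have h1 : eucl x <= eucl y + eucl (x - y).
  by rewrite -[X in eucl X <= _](subrKC y); exact: eucl_triangle.
have h2 : eucl y <= eucl x + eucl (x - y).
  rewrite -[eucl (x - y)]euclN opprB -[X in eucl X <= _](subrKC x).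
  exact: eucl_triangle.
rewrite ler_distl; apply/andP; split.
  by rewrite lerBlDr (le_trans h2)// lerD2l.
by rewrite (le_trans h1)// lerD2l.
Qed.

Lemma continuous_measurable_Bd g : continuous g -> measurable_fun [set: Bd R d] g.
Proof.
move=> cg; apply: (measurability _ (RGenOInfty.measurableE R)) => //.
move=> _ [_ [a ->] <-]; rewrite setTI; apply: sub_sigma_algebra.
by move/continuousP : cg; apply; exact: interval_open.
Qed.

Lemma diff_grad g x h : differentiable g x -> 'd g x h = inner (grad g x) h.
Proof.
move=> dg; have {1}-> : h = \sum_(i < d) h i ord0 *: delta_mx i ord0.
  rewrite {1}[h]matrix_sum_delta; apply: eq_bigr => i _.
  by rewrite big_ord1.
rewrite linear_sum; apply: eq_bigr => i _.
by rewrite linearZ /= mxE deriveE// mulrC.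
Qed.

Lemma grad_inner g x v : differentiable g x -> (forall h, 'd g x h = inner v h) ->
  grad g x = v.
Proof.
move=> dg gv; apply/colP => i; rewrite mxE deriveE// gv /inner (bigD1 i)//= mxE.
rewrite !eqxx mulr1 big1 ?addr0// => j ji.
by rewrite mxE (negbTE ji) mulr0.
Qed.

(** Bridges the Euclidean estimates produced by the analysis and differentiability in the sup norm
    of the matrix space; the two norms are equivalent, and a continuous linear map with a little-o
    remainder is the differential. *)
Lemma differentiable_inner g x v :
  (forall e, 0 < e -> exists2 del, 0 < del & forall h, eucl h < del ->
     `|g (x + h) - g x - inner v h| <= e * eucl h) ->
  differentiable g x /\ grad g x = v.
Proof.
move=> H.
have ci : continuous (inner v : 'cV[R]_d -> R).
  move=> y; apply/(@cvgrPdist_le R R 'cV[R]_d (nbhs y) _) => e e0.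
  have e1 : 0 < e / ((eucl v + 1) * d.+1%:R) by rewrite divr_gt0// mulr_gt0// ltr_wpDl// eucl_ge0.
  apply: filterS (near_dist_le y e1) => z yz.
  rewrite -innerBr (le_trans (inner_le _ _))//.
  apply: (@le_trans _ _ ((eucl v + 1) * (d.+1%:R * (e / ((eucl v + 1) * d.+1%:R))))).
    apply: ler_pM; rewrite ?eucl_ge0 ?lerDl//.
    by rewrite (le_trans (eucl_le_norm _))// ler_pM// ler_nat.
  have c0 : (eucl v + 1) * d.+1%:R != 0.
    by rewrite mulf_neq0// gt_eqF// ltr_wpDl// eucl_ge0.
  by rewrite (mulrA (eucl v + 1)) [leLHS]mulrC divfK.
have E : (g : 'cV[R]_d -> R^o) \o shift x = cst (g x) + (inner v : 'cV[R]_d -> R^o) +o_ (0 : 'cV[R]_d) id.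
  apply/eqaddoP => _/posnumP[e].
  have e1 : 0 < e%:num / d.+1%:R by rewrite divr_gt0.
  have [del del0 Hdel] := H _ e1.
  have del1 : 0 < del / 2 / d.+1%:R by rewrite !divr_gt0.
  apply: filterS (near_dist_le 0 del1) => h; rewrite sub0r normrN => hdel.
  have hd : eucl h < del.
    apply: (@le_lt_trans _ _ (d.+1%:R * `|h|)).
      by rewrite (le_trans (eucl_le_norm _))// ler_wpM2r// ler_nat.
    rewrite (@le_lt_trans _ _ (del / 2))//; last by rewrite ltr_pdivrMr// ltr_pMr// ltr1n.
    by rewrite mulrC -ler_pdivlMr.
  rewrite (_ : (_ - _) h = g (x + h) - g x - inner v h); last first.
    by rewrite [x + h]addrC -addrA -opprD.
  apply: (le_trans (Hdel _ hd)).
  rewrite (le_trans (ler_wpM2l (ltW e1) (eucl_le_norm h)))//.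
  rewrite mulrA ler_wpM2r// mulrAC ler_pdivrMr// ler_wpM2l// ler_nat.
  by [].
have dE := diff_unique ci E.
have dg : differentiable g x.
  apply/diff_locallyP; rewrite dE; split => //.
split => //; apply: grad_inner => // h.
by rewrite dE.
Qed.

End euclidean.

(** * First-order Taylor remainder in L^1 *)

Section density_remainder.
Variables (R : realType) (d : nat) (rho : 'cV[R]_d -> R).
Hypothesis drho : forall z, differentiable rho z.
Implicit Types (x z k v : 'cV[R]_d).

Lemma differentiable_estimate z (e : R) : 0 < e ->
  exists2 del, 0 < del & forall h, eucl h < del ->
     `|rho (z + h) - rho z - inner (grad rho z) h| <= e * eucl h.
Proof.
move=> e0; have /diff_locally/eqaddoP/(_ _ e0) := drho z.
move=> /nbhs_ballP[del /= del0 H]; exists del => // h hdel.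
have /H : ball (0 : 'cV[R]_d) del h.
  by rewrite mx_norm_ball /ball_/= sub0r normrN (le_lt_trans (norm_le_eucl _)).
rewrite (_ : (_ - _) h = rho (z + h) - rho z - inner (grad rho z) h); last first.
  by rewrite -diff_grad// [z + h]addrC -addrA -opprD.
by move=> /le_trans; apply; rewrite ler_wpM2l ?norm_le_eucl// ltW.
Qed.

Lemma differentiable_continuousT : continuous rho.
Proof. by move=> z; apply: differentiable_continuous (drho z). Qed.

Lemma measurable_differentiable : measurable_fun [set: Bd R d] rho.
Proof. exact: (continuous_measurable_Bd differentiable_continuousT). Qed.

Lemma measurable_addv v :
  measurable_fun [set: Bd R d] (fun z : Bd R d => (z : 'cV[R]_d) + v : Bd R d).
Proof.
apply: measurable_fun_coordP => i.
rewrite (_ : (fun t => _) = fun t : 'cV[R]_d => t i ord0 + v i ord0).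
  by apply: measurable_funD => //; exact: measurable_coord.
by apply/funext => t; rewrite mxE.
Qed.

(** The gradient is not assumed continuous, but each partial derivative is a pointwise limit of
    difference quotients with steps [1/(n+1)], which are Borel because [rho] is continuous. *)
Lemma measurable_grad (i : 'I_d) :
  measurable_fun [set: Bd R d] (fun z : Bd R d => grad rho z i ord0).
Proof.
pose e : 'cV[R]_d := delta_mx i ord0.
have ee : eucl e = 1.
  rewrite /eucl (bigD1 i)//= mxE !eqxx expr1n big1 ?addr0 ?sqrtr1// => j ji.
  by rewrite mxE (negbTE ji) expr0n.
have ine (w : 'cV[R]_d) : inner w e = w i ord0.
  rewrite /inner (bigD1 i)//= mxE !eqxx mulr1 big1 ?addr0// => j ji.
  by rewrite mxE (negbTE ji) mulr0.
apply: (@measurable_fun_cvg _ _ _ _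
  (fun n (z : Bd R d) => n.+1%:R * (rho ((z : 'cV[R]_d) + n.+1%:R^-1 *: e) - rho z))).
  move=> n; apply: measurable_funM => //; apply: measurable_funB.
    apply: (measurableT_comp measurable_differentiable); exact: measurable_addv.
  exact: measurable_differentiable.
move=> z _; apply/cvgrPdist_le => eps eps0.
have [del del0 H] := @differentiable_estimate z eps eps0.
have : \forall n \near \oo, (n.+1%:R^-1 : R) < del.
  by have /cvgrPdist_lt/(_ _ del0) := @cvg_harmonic R; apply: filterS => n;
    rewrite /= sub0r normrN ger0_norm.
apply: filterS => n ndel.
have := H (n.+1%:R^-1 *: e); rewrite euclZ ee mulr1 ger0_norm// => /(_ ndel).
rewrite innerZr ine => H1; rewrite distrC.
rewrite -(@ler_pM2l _ n.+1%:R^-1)//; rewrite [n.+1%:R^-1 * eps]mulrC.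
apply: le_trans H1; rewrite -[X in X * _ <= _]ger0_norm// -normrM.
by rewrite mulrBr mulKf.
Qed.

Lemma measurable_inner_grad v :
  measurable_fun [set: Bd R d] (fun z : Bd R d => inner (grad rho z) v).
Proof.
apply: measurable_sum => i; apply: measurable_funM => //.
exact: measurable_grad.
Qed.

Lemma measurable_eucl_grad :
  measurable_fun [set: Bd R d] (fun z : Bd R d => eucl (grad rho z)).
Proof.
apply: (measurableT_comp (continuous_measurable_Bd (@continuous_eucl R d))).
exact: (measurable_fun_coordP measurable_grad).
Qed.

Lemma is_derive_line z v (s : R) :
  is_derive s 1 (fun s : R => rho (z + s *: v)) (inner (grad rho (z + s *: v)) v).
Proof.
suff H : h^-1 *: (((fun s : R => rho (z + s *: v)) \o shift s) (h *: 1) -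
    rho (z + s *: v)) @[h --> 0^'] --> inner (grad rho (z + s *: v)) v.
  by apply: DeriveDef; [exact: (cvgP _ H)|exact: (cvg_lim _ H)].
apply/cvgrPdist_le => e e0.
have e1 : 0 < e / (eucl v + 1) by rewrite divr_gt0// ltr_wpDl// eucl_ge0.
have [del del0 H] := @differentiable_estimate (z + s *: v) _ e1.
have d1 : 0 < del / (eucl v + 1) by rewrite divr_gt0// ltr_wpDl// eucl_ge0.
have v1 : 0 < eucl v + 1 by rewrite ltr_wpDl// eucl_ge0.
near=> h.
have h0 : h != 0 by near: h; exact: nbhs_dnbhs_neq.
have hd : `|h| < del / (eucl v + 1) by near: h; exact: dnbhs0_lt.
have := H (h *: v); rewrite euclZ => /(_ _)/wrap[].
  apply: (@le_lt_trans _ _ (`|h| * (eucl v + 1))); first by rewrite ler_wpM2l// lerDl.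
  by rewrite -ltr_pdivlMr.
rewrite innerZr => H1.
rewrite distrC /= -[X in rho X - _]/(z + (h *: 1 + s) *: v).
rewrite scaler1 -(@ler_pM2l _ `|h|) ?normr_gt0// -normrM mulrBr.
rewrite /GRing.scale /= mulVKf//.
have -> : z + (h + s) *: v = z + s *: v + h *: v by rewrite scalerDl addrA addrAC.
apply: (le_trans H1); rewrite mulrCA ler_wpM2l// mulrAC ler_pdivrMr//.
by rewrite ler_wpM2l ?lerDl// ltW.
Unshelve. all: by end_near. Qed.

(** With no regularity of the gradient along the segment, the mean value theorem replaces the
    integral form of the increment. *)
Lemma mean_value_line z v : exists2 s : R, 0 <= s <= 1 &
  rho (z + v) - rho z = inner (grad rho (z + s *: v)) v.
Proof.
pose g (s : R) := rho (z + s *: v).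
have dg (s : R) : is_derive s 1 g (inner (grad rho (z + s *: v)) v).
  exact: is_derive_line.
have cg : {within `[0, 1], continuous g}.
  apply: continuous_subspaceT => s.
  apply: differentiable_continuous; apply/derivable1_diffP.
  by case: (dg s).
have [s s01 E] := @MVT_segment R g _ 0 1 ler01 (fun s _ => dg s) cg.
exists s; first by move: s01; rewrite in_itv.
by move: E; rewrite /g scale1r scale0r addr0 subr0 mulr1.
Qed.

(** The sign of [k] is that of densities: translating a jump by [k] turns its density into
    [rho (z - k)]. *)
Definition taylor_rem k z := `|rho (z - k) - rho z + inner (grad rho z) k|.

Lemma measurable_taylor_rem k : measurable_fun [set: Bd R d] (taylor_rem k).
Proof.
apply: measurableT_comp => //; apply: measurable_funD.
  apply: measurable_funB; last exact: measurable_differentiable.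
  apply: (measurableT_comp measurable_differentiable); exact: measurable_addv.
exact: measurable_inner_grad.
Qed.

(* The supremum over open balls is lower semicontinuous, hence Borel, which the
   supremum over closed balls need not be. *)
Definition gradsup (eps : R) z : \bar R :=
  ereal_sup [set (eucl (grad rho x))%:E | x in [set x | eucl (x - z) < eps]].

Lemma gradsup_ge0 eps z : 0 < eps -> (0 <= gradsup eps z)%E.
Proof.
move=> e0; apply: (@le_trans _ _ (eucl (grad rho z))%:E).
  by rewrite lee_fin eucl_ge0.
by apply: ereal_sup_ubound; exists z => //=; rewrite subrr eucl0.
Qed.

Lemma open_eucl_ball x (e : R) : open [set z | eucl (x - z) < e].
Proof.
rewrite openE => z /= ze; pose r := (e - eucl (x - z)) / 2 / d.+1%:R.
have r0 : 0 < r by rewrite !divr_gt0// subr_gt0.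
apply: filterS (near_dist_le z r0) => y zy /=.
rewrite -(subrKA z) (le_lt_trans (eucl_triangle _ _))// -ltrBrDl.
apply: (le_lt_trans (eucl_le_norm _)); apply: (@le_lt_trans _ _ (d.+1%:R * r)).
  by apply: ler_pM => //; rewrite ler_nat.
by rewrite mulrC divfK// ltr_pdivrMr// ltr_pMr ?subr_gt0// ltr1n.
Qed.

Lemma measurable_gradsup eps : measurable_fun [set: Bd R d] (gradsup eps).
Proof.
apply: (measurability _ (ErealGenOInfty.measurableE R)) => //.
move=> _ [_ [a ->] <-]; rewrite setTI; apply: sub_sigma_algebra => /=.
rewrite (_ : _ @^-1` _ = \bigcup_(x in [set x | a < eucl (grad rho x)])
    [set z | eucl (x - z) < eps]).
  by apply: bigcup_open => x _; exact: open_eucl_ball.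
apply/seteqP; split => [z /=|z [x /= ax xz]].
  rewrite in_itv/= andbT => /ereal_sup_gt[_ /= [x xz <-]].
  by rewrite lte_fin => ax; exists x.
rewrite in_itv/= andbT; apply: (@lt_le_trans _ _ (eucl (grad rho x))%:E).
  by rewrite lte_fin.
by apply: ereal_sup_ubound; exists x.
Qed.

(** One copy of the supremum pays for the increment, whose mean value point is within [eps] of [z],
    the other for the linear term at [z] itself. *)
Lemma taylor_rem_le eps k z : 0 < eps -> eucl k < eps -> 0 < eucl k ->
  ((taylor_rem k z / eucl k)%:E <= gradsup eps z + gradsup eps z)%E.
Proof.
move=> e0 ke k0; have [s /andP[s0 s1] E] := mean_value_line z (- k).
apply: (@le_trans _ _ ((eucl (grad rho (z + s *: - k)))%:E + (eucl (grad rho z))%:E)).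
  rewrite -EFinD lee_fin ler_pdivrMr// mulrDl /taylor_rem E.
  rewrite (le_trans (ler_normD _ _))// lerD// (le_trans (inner_le _ _))//.
  by rewrite euclN.
apply: leeD; apply: ereal_sup_ubound.
  exists (z + s *: - k) => //=; rewrite addrAC subrr add0r euclZ euclN ger0_norm//.
  by rewrite (le_lt_trans _ ke)// ler_piMl// eucl_ge0.
by exists z => //=; rewrite subrr eucl0.
Qed.

(** Dominated convergence speaks of sequences, so a failure is turned into a sequence [k n] tending
    to 0 along which the remainder divided by [eucl (k n)] would keep an integral above [e]. *)
Lemma taylor_rem_little_o eps : 0 < eps -> (\int[leb R d]_z gradsup eps z < +oo)%E ->
  forall e : R, 0 < e -> exists2 del : R, 0 < del &
    forall k, eucl k < del -> (\int[leb R d]_z (taylor_rem k z)%:E <= (e * eucl k)%:E)%E.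
Proof.
move=> eps0 foo e e0; apply: contrapT => /forall2NP H.
have Hn n : exists k : 'cV[R]_d, [/\ eucl k < Order.min eps n.+1%:R^-1 &
    ((e * eucl k)%:E < \int[leb R d]_z (taylor_rem k z)%:E)%E].
  have [|/existsNP[k /not_implyP[kn /negP]]] := H (Order.min eps n.+1%:R^-1).
    by move=> /negP; rewrite lt_min eps0/= invr_gt0 ltr0n.
  by rewrite -ltNge => hk; exists k.
pose k n := projT1 (cid (Hn n)).
have kE n : [/\ eucl (k n) < eps, eucl (k n) < n.+1%:R^-1 &
    ((e * eucl (k n))%:E < \int[leb R d]_z (taylor_rem (k n) z)%:E)%E].
  by rewrite /k; case: cid => /= y []; rewrite lt_min => /andP[].
(* At [k n = 0] the remainder vanishes identically, which contradicts the strict inequality that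
   [k n] satisfies. *)
have k0 n : 0 < eucl (k n).
  rewrite lt_def eucl_ge0 andbT; apply/eqP => /[dup] ke0 /eucl_eq0 kn0.
  have [_ _] := kE n; rewrite ke0 mulr0 (_ : \int[_]_z _ = 0)%E ?ltxx//.
  apply: integral0_eq => z _.
  by rewrite kn0 /taylor_rem subr0 subrr add0r inner0r normr0.
pose F n z : \bar R := (taylor_rem (k n) z / eucl (k n))%:E.
have mF n : measurable_fun [set: Bd R d] (F n).
  apply/measurable_EFinP; apply: measurable_funM => //; exact: measurable_taylor_rem.
have mh : measurable_fun [set: Bd R d] (gradsup eps \+ gradsup eps)%E.
  by apply: emeasurable_funD; exact: measurable_gradsup.
have ih : (leb R d).-integrable setT (gradsup eps \+ gradsup eps)%E.
  apply/integrableP; split => //.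
  under eq_integral do rewrite gee0_abs ?adde_ge0 ?gradsup_ge0//.
  rewrite ge0_integralD//; [|by move=> *; exact: gradsup_ge0|exact: measurable_gradsup
    |by move=> *; exact: gradsup_ge0|exact: measurable_gradsup].
  by rewrite lte_add_pinfty.
have Fcvg z : F ^~ z @ \oo --> 0%E.
  apply/cvg_EFin; first by near=> n.
  apply/cvgrPdist_le => eta eta0.
  have [del del0 Hdel] := @differentiable_estimate z eta eta0.
  have : \forall n \near \oo, (n.+1%:R^-1 : R) < del.
    by have /cvgrPdist_lt/(_ _ del0) := @cvg_harmonic R; apply: filterS => n;
      rewrite /= sub0r normrN ger0_norm.
  apply: filterS => n ndel.
  rewrite /= sub0r normrN ger0_norm ?divr_ge0 ?eucl_ge0 /taylor_rem ?normr_ge0//.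
  rewrite ler_pdivrMr//.
  have [_ kn _] := kE n; have := Hdel (- k n).
  rewrite euclN => /(_ (lt_trans kn ndel)).
  by rewrite innerNr opprK.
have ae1 : {ae leb R d, forall z, setT z -> F ^~ z @ \oo --> (cst 0%E : Bd R d -> \bar R) z}.
  by apply: aeW => z _; exact: Fcvg.
have ae2 : {ae leb R d, forall z n, setT z ->
    (`|F n z| <= (gradsup eps \+ gradsup eps) z)%E}.
  apply: aeW => z n _; have [ke _ _] := kE n.
  rewrite gee0_abs; first exact: taylor_rem_le.
  by rewrite lee_fin divr_ge0 ?eucl_ge0 /taylor_rem ?normr_ge0.
have [_ _] := dominated_convergence measurableT mF (measurable_cst 0%E) ae1 ih ae2.
rewrite integral0 => cvgF.
have /fine_cvgP[Ffin /cvgrPdist_lt/(_ _ e0) Fe] := cvgF.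
have [n _ /(_ n (leqnn n))[/= Fnfin]] := filterI Ffin Fe.
rewrite /= sub0r normrN => Fn.
have [_ _] := kE n; apply/negP; rewrite -leNgt.
have mrem : measurable_fun [set: Bd R d] (fun z => (taylor_rem (k n) z)%:E).
  by apply/measurable_EFinP; exact: measurable_taylor_rem.
have E : (\int[leb R d]_z F n z = (eucl (k n))^-1%:E * \int[leb R d]_z (taylor_rem (k n) z)%:E)%E.
  rewrite -ge0_integralZl_EFin//.
  - by apply: eq_integral => z _; rewrite /F mulrC EFinM.
  - by move=> z _; rewrite lee_fin normr_ge0.
  - by rewrite invr_ge0 ltW.
move: Fnfin Fn; rewrite E.
have : (0 <= \int[leb R d]_z (taylor_rem (k n) z)%:E)%E.
  by apply: integral_ge0 => z _; rewrite lee_fin normr_ge0.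
case: (\int[_]_z _)%E => [r|_|//].
- rewrite lee_fin => r0 _; rewrite -EFinM/= ger0_norm ?mulr_ge0 ?invr_ge0 ?eucl_ge0//.
  by rewrite mulrC ltr_pdivrMr// => /ltW; rewrite lee_fin.
- by rewrite gt0_muley ?lte_fin ?invr_gt0 ?k0// => /fin_numP[_ /eqP].
Unshelve. all: by end_near. Qed.

End density_remainder.

(** * Matrix exponential *)

Lemma cvg_mxP (T : Type) (F : set_system T) (FF : Filter F) (R : realType) m n
    (f : T -> 'M[R]_(m, n)) (M : 'M[R]_(m, n)) :
  (forall i j, f t i j @[t --> F] --> M i j) -> f t @[t --> F] --> M.
Proof.
move=> fM; apply/(@cvgrPdist_le R 'M[R]_(m, n) T F FF) => e e0.
have H : \forall t \near F, forall ij : 'I_m * 'I_n, `|M ij.1 ij.2 - f t ij.1 ij.2| <= e.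
  apply: filter_forall => -[i j] /=.
  by have /cvgrPdist_le/(_ _ e0) := fM i j.
apply: filterS H => t H; rewrite /Num.Def.normr/= mx_normrE.
by apply: bigmax_le => [|ij _]; [exact: ltW|rewrite !mxE].
Qed.

Lemma cvg_sumr (T : Type) (F : set_system T) (FF : Filter F) (R : realType)
    (I : Type) (r : seq I) (f : I -> T -> R) (l : I -> R) :
  (forall i, f i t @[t --> F] --> l i) ->
  (\sum_(i <- r) f i t) @[t --> F] --> \sum_(i <- r) l i.
Proof.
move=> fl; elim: r => [|i r IH].
  rewrite big_nil; under eq_fun do rewrite big_nil; exact: cvg_cst.
rewrite big_cons; under eq_fun do rewrite big_cons.
by apply: cvgD => //; exact: fl.
Qed.

(** Comparison with the exponential series. The constant [C] allows for the powers of [mxsum M] that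
    appear when the series of the exponential is differentiated once or twice. *)
Lemma cvg_pseries_fact (R : realType) (a : R ^nat) (C K : R) (s : R) :
  (forall k, `|a k| <= C * K ^+ k) -> 0 <= K ->
  cvgn (pseries (fun k => (k`!%:R)^-1 * a k) s).
Proof.
move=> aK K0; apply: normed_cvg.
apply: (@series_le_cvg _ _ (fun k => C * exp_coeff (K * `|s|) k)).
- by move=> k; exact: normr_ge0.
- move=> k; rewrite mulr_ge0//; last by rewrite exp_coeff_ge0// mulr_ge0.
  by have := aK 0; rewrite expr0 mulr1; exact: le_trans.
- move=> k; rewrite /= !normrM normfV (ger0_norm (ler0n _ k`!)) normrX.
  rewrite /exp_coeff /= -mulrA mulrC [leRHS]mulrA ler_wpM2r ?invr_ge0//.
  by rewrite exprMn mulrA ler_wpM2r// exprn_ge0.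
- rewrite (_ : series _ = (fun n => C * series (exp_coeff (K * `|s|)) n)).
    by apply: is_cvgMr; exact: is_cvg_series_exp_coeff.
  by apply/funext => n; rewrite /series/= mulr_sumr.
Qed.

#[local] Arguments mxpow : simpl never.

Section expm.
Variables (R : realType) (d : nat).
Implicit Types (A M : 'M[R]_d) (s t : R) (v : 'cV[R]_d).

Lemma mxpowS M k : mxpow M k.+1 = M *m mxpow M k. Proof. by []. Qed.

Lemma mxpow_comm M k : M *m mxpow M k = mxpow M k *m M.
Proof.
elim: k => [|k IH]; first by rewrite /mxpow/= mulmx1 mul1mx.
by rewrite {1}mxpowS {1}IH mulmxA -mxpowS.
Qed.

Lemma mxpowZ s M k : mxpow (s *: M) k = s ^+ k *: mxpow M k.
Proof.
elim: k => [|k IH]; first by rewrite expr0 scale1r.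
by rewrite !mxpowS IH -scalemxAl -scalemxAr scalerA -exprS.
Qed.

Lemma mxpow_tr M k : mxpow M^T k = (mxpow M k)^T.
Proof.
elim: k => [|k IH]; first by rewrite /mxpow/= trmx1.
by rewrite !mxpowS IH mxpow_comm trmx_mul.
Qed.

(** The entrywise l^1 norm, a crude bound both for the entries of powers and for the Euclidean
    operator norm. *)
Definition mxsum M : R := \sum_i \sum_j `|M i j|.

Lemma mxsum_ge0 M : 0 <= mxsum M.
Proof. by apply: sumr_ge0 => i _; apply: sumr_ge0. Qed.

Lemma mxpow_le M k i j : `|mxpow M k i j| <= mxsum M ^+ k.
Proof.
elim: k i j => [|k IH] i j.
  by rewrite expr0 mxE; case: (_ == _); rewrite ?normr1 ?normr0.
rewrite mxpowS mxE (le_trans (ler_norm_sum _ _ _))// exprS.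
apply: (@le_trans _ _ (\sum_l `|M i l| * mxsum M ^+ k)).
  by apply: ler_sum => l _; rewrite normrM ler_wpM2l.
rewrite -mulr_suml ler_wpM2r ?exprn_ge0 ?mxsum_ge0//.
by rewrite /mxsum [leRHS](bigD1 i)//= lerDl; apply: sumr_ge0 => ? _; apply: sumr_ge0.
Qed.

(** Taken entry by entry, [expm (s *: M)] is a scalar power series in [s], to which term-by-term
    differentiation applies. *)
Definition expc M i j (k : nat) : R := (k`!%:R)^-1 * mxpow M k i j.

Lemma cvg_expc M i j s : cvgn (pseries (expc M i j) s).
Proof.
apply: (@cvg_pseries_fact _ _ 1 (mxsum M)); last exact: mxsum_ge0.
by move=> k; rewrite mul1r mxpow_le.
Qed.

Lemma expm_entry M s i j : expm (s *: M) i j = limn (pseries (expc M i j) s).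
Proof.
pose L : 'M[R]_d := \matrix_(i, j) limn (pseries (expc M i j) s).
suff -> : expm (s *: M) = L by rewrite mxE.
apply: cvg_lim => //; apply: cvg_mxP => k l; rewrite mxE.
rewrite (_ : (fun n => _) = pseries (expc M k l) s); first exact: cvg_expc.
apply/funext => n; rewrite summxE /pseries /series/= big_mkord.
by apply: eq_bigr => p _; rewrite mxpowZ !mxE /expc mulrCA mulrC.
Qed.

Lemma diffs_expc M i j :
  pseries_diffs (expc M i j) = fun k => (k`!%:R)^-1 * mxpow M k.+1 i j.
Proof.
apply/funext => k; rewrite /pseries_diffs /expc factS natrM invfM !mulrA mulfV ?mul1r//.
Qed.

Lemma cvg_diffs_expc M i j s : cvgn (pseries (pseries_diffs (expc M i j)) s).
Proof.
rewrite diffs_expc; apply: (@cvg_pseries_fact _ (fun k => mxpow M k.+1 i j)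
  (mxsum M) (mxsum M)); last exact: mxsum_ge0.
by move=> k; rewrite -exprS mxpow_le.
Qed.

Lemma cvg_diffs2_expc M i j s :
  cvgn (pseries (pseries_diffs (pseries_diffs (expc M i j))) s).
Proof.
have -> : pseries_diffs (pseries_diffs (expc M i j)) =
    fun k => (k`!%:R)^-1 * mxpow M k.+2 i j.
  apply/funext => k; rewrite diffs_expc /pseries_diffs factS natrM invfM !mulrA.
  by rewrite mulfV ?mul1r.
apply: (@cvg_pseries_fact _ (fun k => mxpow M k.+2 i j)
  (mxsum M ^+ 2) (mxsum M)); last exact: mxsum_ge0.
by move=> k; rewrite -exprD mxpow_le.
Qed.

Lemma lim_diffs_expc M i j s :
  limn (pseries (pseries_diffs (expc M i j)) s) = (M *m expm (s *: M)) i j.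
Proof.
apply: cvg_lim => //.
rewrite mxE (_ : pseries _ _ = fun n => \sum_l M i l * pseries (expc M l j) s n).
  apply: cvg_sumr => l; apply: cvgMr; rewrite expm_entry; exact: cvg_expc.
apply/funext => n; rewrite diffs_expc /pseries /series/=.
under [RHS]eq_bigr do rewrite mulr_sumr.
rewrite exchange_big /=; apply: eq_bigr => k _.
rewrite mxpowS mxE mulr_sumr mulr_suml; apply: eq_bigr => l _.
by rewrite /expc !mulrA [M i l * _]mulrC.
Qed.

(** The same derived series is summed a second time, with one factor [M] pulled out on the right. *)
Lemma expm_comm M s : M *m expm (s *: M) = expm (s *: M) *m M.
Proof.
apply/matrixP => i j; rewrite -lim_diffs_expc; apply: cvg_lim => //.
rewrite mxE (_ : pseries _ _ = fun n => \sum_l pseries (expc M i l) s n * M l j).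
  apply: cvg_sumr => l; apply: cvgMl; rewrite expm_entry; exact: cvg_expc.
apply/funext => n; rewrite diffs_expc /pseries /series/=.
under [RHS]eq_bigr do rewrite mulr_suml.
rewrite exchange_big /=; apply: eq_bigr => k _.
rewrite mxpowS mxpow_comm mxE mulr_sumr mulr_suml; apply: eq_bigr => l _.
by rewrite /expc mulrA mulrAC.
Qed.

Lemma is_derive_expm M i j s :
  is_derive s 1 (fun s => expm (s *: M) i j) ((M *m expm (s *: M)) i j).
Proof.
rewrite -lim_diffs_expc; under eq_fun do rewrite expm_entry.
apply: (@pseries_snd_diffs _ _ (`|s| + 1)).
- exact: cvg_expc.
- exact: cvg_diffs_expc.
- exact: cvg_diffs2_expc.
- by rewrite [ltRHS]ger0_norm ?addr_ge0// ltrDl.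
Qed.

Lemma expm0 M : expm (0 *: M) = 1%:M.
Proof.
apply: cvg_lim => //; apply: cvg_near_cst.
exists 1%N => // -[//|n] _; rewrite big_ord_recl /= fact0 invr1 scale1r big1 ?addr0// => k _.
by rewrite mxpowZ expr0n/= scale0r scaler0.
Qed.

Lemma expm_tr M s : expm (s *: M^T) = (expm (s *: M))^T.
Proof.
apply/matrixP => i j; rewrite mxE !expm_entry; congr (limn (pseries _ _)).
by apply/funext => k; rewrite /expc mxpow_tr mxE.
Qed.

Lemma continuous_expm M i j : continuous (fun s => expm (s *: M) i j).
Proof.
move=> s; apply: differentiable_continuous; apply/derivable1_diffP.
by case: (is_derive_expm M i j s).
Qed.

Lemma is_derive_expmB M i j t s :
  is_derive s 1 (fun s => expm ((t - s) *: M) i j) (- (M *m expm ((t - s) *: M)) i j).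
Proof.
have dg : is_derive s 1 (fun s : R => t - s) (-1).
  by rewrite -[X in is_derive _ _ _ X]sub0r; exact: is_deriveB.
have H := @is_derive1_comp _ (fun u => expm (u *: M) i j) (fun s : R => t - s) s _ _
  (is_derive_expm M i j (t - s)) dg.
by rewrite -mulrN1.
Qed.

Lemma derive0_eq (f : R -> R) a b : (forall s, is_derive s 1 f 0) -> f a = f b.
Proof.
move=> f0; wlog ab : a b / a <= b.
  by move=> H; case: (leP a b) => [/H//|/ltW/H].
have cf : {within `[a, b], continuous f}.
  apply: continuous_subspaceT => s; apply: differentiable_continuous.
  by apply/derivable1_diffP; case: (f0 s).
have [c _ /eqP] := MVT_segment ab (fun s _ => f0 s) cf.
by rewrite mul0r subr_eq0 => /eqP.
Qed.

(** As a function of [s] the left side has derivative zero, by commutation with [M], and at [s = 0]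
    it is [expm (t *: M)]; this avoids Cauchy products of matrix series. *)
Lemma expmBM M t s : expm ((t - s) *: M) *m expm (s *: M) = expm (t *: M).
Proof.
apply/matrixP => i j.
pose f (s : R) := \sum_l expm ((t - s) *: M) i l * expm (s *: M) l j.
have df (r : R) : is_derive r 1 f 0.
  have -> : f = \sum_l (fun s => expm ((t - s) *: M) i l * expm (s *: M) l j).
    by apply/funext => r'; rewrite fct_sumE.
  apply: is_derive_eq.
    apply: is_derive_sum => l.
    exact: (is_deriveM (is_derive_expmB M i l t r) (is_derive_expm M l j r)).
  rewrite big_split /= /GRing.scale/=.
  transitivity ((expm ((t - r) *: M) *m (M *m expm (r *: M))) i j -
      ((M *m expm ((t - r) *: M)) *m expm (r *: M)) i j).
    rewrite !mxE -sumrN; congr (_ + _); apply: eq_bigr => l _.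
    by rewrite mulrN mulrC.
  by rewrite mulmxA expm_comm subrr.
rewrite mxE -[LHS]/(f s) (derive0_eq s 0 df) /f subr0 expm0.
rewrite (bigD1 j)//= mxE eqxx mulr1 big1 ?addr0// => l lj.
by rewrite mxE (negbTE lj) mulr0.
Qed.

Lemma is_derive_expm_mulv A v i s :
  is_derive s 1 (fun s => (expm (s *: A) *m v) i ord0) ((A *m (expm (s *: A) *m v)) i ord0).
Proof.
have -> : (fun s => (expm (s *: A) *m v) i ord0) =
    \sum_l (fun s => v l ord0 *: expm (s *: A) i l).
  by apply/funext => r; rewrite fct_sumE mxE; apply: eq_bigr => l _; rewrite mulrC.
apply: is_derive_eq.
  apply: is_derive_sum => l.
  exact: (is_deriveZ (v l ord0) (is_derive_expm A i l s)).
by rewrite mulmxA [RHS]mxE; apply: eq_bigr => l _; rewrite mulrC.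
Qed.

(** Gronwall in multiplicative form: the derivative of [expR (2 * theta * s)] times the squared norm
    is non-positive. *)
Lemma expm_dissipative A (theta : R) :
  (forall y : 'cV[R]_d, inner y (A *m y) <= - theta * eucl y ^+ 2) ->
  forall s v, 0 <= s -> eucl (expm (s *: A) *m v) <= expR (- theta * s) * eucl v.
Proof.
move=> HA s v s0.
pose y (s : R) := expm (s *: A) *m v.
pose f (s : R) := expR (2 * theta * s) * inner (y s) (y s).
have dy (r : R) : is_derive r 1 (fun r => inner (y r) (y r)) (2 * inner (y r) (A *m y r)).
  have -> : (fun r => inner (y r) (y r)) = \sum_i (fun r => y r i ord0 * y r i ord0).
    by apply/funext => r'; rewrite fct_sumE.
  apply: is_derive_eq.
    apply: is_derive_sum => i.
    exact: (is_deriveM (is_derive_expm_mulv A v i r) (is_derive_expm_mulv A v i r)).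
  rewrite /inner mulr_sumr; apply: eq_bigr => i _.
  by rewrite /GRing.scale/= -mulr2n mulr_natl.
have de (r : R) : is_derive r 1 (fun r => expR (2 * theta * r)) (2 * theta * expR (2 * theta * r)).
  have dg : is_derive r 1 (fun r : R => 2 * theta * r) (2 * theta).
    have := is_deriveZ (2 * theta) (is_derive_id r (1 : R)).
    by rewrite /GRing.scale/= mulr1.
  have := is_derive1_comp (is_derive_expR (2 * theta * r)) dg.
  by rewrite [expR _ * _]mulrC.
have df (r : R) : is_derive r 1 f (expR (2 * theta * r) *
    (2 * (theta * eucl (y r) ^+ 2 + inner (y r) (A *m y r)))).
  have H : is_derive r 1 f _ := is_deriveM (de r) (dy r).
  apply: (is_derive_eq H).
  rewrite /GRing.scale/= sqr_eucl; ring.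
have cf : {within `[0, s], continuous f}.
  apply: continuous_subspaceT => r; apply: differentiable_continuous.
  by apply/derivable1_diffP; case: (df r).
have [c _ E] := MVT_segment s0 (fun r _ => df r) cf.
have : f s <= f 0.
  rewrite -subr_le0 E subr0 mulr_le0_ge0// mulr_ge0_le0 ?expR_ge0//.
  by rewrite mulr_ge0_le0// -lerBrDl sub0r -mulNr.
rewrite /f mulr0 expR0 mul1r /y expm0 mul1mx -!sqr_eucl => H.
rewrite -(@ler_pXn2r _ 2)// ?nnegrE ?mulr_ge0 ?expR_ge0 ?eucl_ge0// exprMn.
rewrite -expRM_natl.
have -> : expR (2%:R * (- theta * s)) = (expR (2 * theta * s))^-1.
  by rewrite -expRN; congr expR; ring.
by rewrite mulrC ler_pdivlMr ?expR_gt0// mulrC.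
Qed.

Lemma mulmx_le A v : eucl (A *m v) <= mxsum A * eucl v.
Proof.
apply: (le_trans (eucl_le_sum _)); rewrite mulr_suml; apply: ler_sum => i _.
rewrite mxE mulr_suml (le_trans (ler_norm_sum _ _ _))//; apply: ler_sum => j _.
by rewrite normrM ler_wpM2l// coord_le_eucl.
Qed.

(** By Cauchy-Schwarz every matrix is dissipative with [theta = - mxsum A]. *)
Lemma expm_le A s v : 0 <= s -> eucl (expm (s *: A) *m v) <= expR (mxsum A * s) * eucl v.
Proof.
move=> s0; rewrite -[X in expR (X * _)]opprK; apply: expm_dissipative => // y.
rewrite opprK (le_trans (ler_norm _))// (le_trans (inner_le _ _))//.
by rewrite mulrC expr2 mulrA ler_wpM2r ?eucl_ge0// mulmx_le.
Qed.

End expm.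

(** * Independence *)

Lemma indep_g_sigma d0 (Omega : measurableType d0) (R : realType)
    (P : probability Omega R) (Pi : set (set Omega)) (D : set Omega) :
  setI_closed Pi -> Pi `<=` measurable -> measurable D ->
  (forall E, Pi E -> P (E `&` D) = (P E * P D)%E) ->
  forall E, <<s Pi >> E -> P (E `&` D) = (P E * P D)%E.
Proof.
move=> PiI mPi mD PiD E sE.
have sm : <<s Pi >> `<=` (@measurable _ Omega).
  by apply: smallest_sub => //; exact: sigma_algebra_measurable.
have PDfin A : measurable A -> P A \is a fin_num by move=> mA; exact: fin_num_measure.
apply: (@dynkin_induction _ (g_sigma_algebraType Pi) Pi
  (fun E => P (E `&` D) = (P E * P D)%E)) => //.
- by rewrite setTI probability_setT mul1e.
- move=> S /sm mS SD.
  have -> : P (~` S `&` D) = (P D - P (D `&` S))%E.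
    by rewrite setIC -setDE; apply: measureD => //; rewrite -ge0_fin_numE ?PDfin.
  rewrite setIC SD probability_setC//.
  by rewrite muleBl ?mul1e ?fin_num_adde_defr// ?PDfin.
- move=> F mF tF FD.
  have mF' n : @measurable _ Omega (F n) by exact: (sm _ (mF n)).
  have -> : P (\bigcup_k F k `&` D) = (\sum_(k <oo) P (F k `&` D))%E.
    rewrite setI_bigcupl; apply: measure_semi_bigcup => //.
    - by move=> n; exact: measurableI.
    - exact: trivIset_setIr.
    - by apply: bigcupT_measurable => n; exact: measurableI.
  have -> : P (\bigcup_k F k) = (\sum_(k <oo) P (F k))%E.
    by apply: measure_semi_bigcup => //; exact: bigcupT_measurable.
  rewrite muleC -(fineK (PDfin _ mD)) -nneseriesZl//.
  by apply: eq_eseriesr => n _; rewrite FD muleC fineK// PDfin.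
Qed.

(** * Fubini for a random variable independent of a sub-sigma-algebra *)

Section indep_fubini.
Context d0 (Omega : measurableType d0) (R : realType) (P : probability Omega R).
Context d1 (T : measurableType d1) (xi : Omega -> T) (mxi : measurable_fun setT xi).
Variable Pi : set (set Omega).
Hypothesis sPi : <<s Pi >> `<=` (@measurable _ Omega).
Hypothesis indep : forall E B, <<s Pi >> E -> measurable B ->
  P (E `&` xi @^-1` B) = (P E * P (xi @^-1` B))%E.

(** [Omega] with the smaller sigma-algebra. The identity becomes a random variable with values in
    [OG], and independence says that the pair [(w, xi w)] has a product law; integrating in [z]
    first then plays the role of conditioning on the sigma-algebra. *)
Let OG := g_sigma_algebraType Pi.

Lemma measurable_id_sub : measurable_fun [set: Omega] (id : Omega -> OG).
Proof. by move=> _ B mB; rewrite setTI; exact: sPi. Qed.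

Let idG : {mfun Omega >-> OG} := mfun_Sub (mem_set measurable_id_sub).
Let X : {mfun Omega >-> T} := mfun_Sub (mem_set mxi).

Let mpair : measurable_fun [set: Omega] (fun w => ((w : OG), xi w)).
Proof. by apply: measurable_fun_pair => //; exact: measurable_id_sub. Qed.

Let pairX : {mfun Omega >-> (OG * T)%type} := mfun_Sub (mem_set mpair).

Lemma indep_prod A : measurable A ->
  (distribution P idG \x distribution P X)%E A = distribution P pairX A.
Proof.
by apply: product_measure_unique => E B mE mB; exact: indep.
Qed.

Lemma indep_tonelli (Phi : OG * T -> \bar R) : measurable_fun setT Phi ->
  (forall p, (0 <= Phi p)%E) ->
  (\int[P]_w Phi (w, xi w) =
   \int[P]_w \int[pushforward P xi]_z Phi (w, z))%E.
Proof.
move=> mPhi Phi0.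
transitivity (\int[distribution P pairX]_p Phi p)%E.
  by rewrite ge0_integral_distribution.
rewrite (eq_measure_integral (distribution P idG \x distribution P X)%E); last first.
  by move=> A mA _; apply/esym/indep_prod.
rewrite fubini_tonelli1// ge0_integral_distribution//.
  exact: measurable_fun_fubini_tonelli_F.
by move=> w; apply: integral_ge0.
Qed.

Section dominated.
Variables (Phi : OG * T -> R) (q : T -> R).
Hypothesis mPhi : measurable_fun setT Phi.
Hypothesis mq : measurable_fun setT q.
Hypothesis Phiq : forall w z, `|Phi (w, z)| <= q z.
Hypothesis qfin : (\int[pushforward P xi]_z (q z)%:E < +oo)%E.

Let mPhixi : measurable_fun [set: Omega] (fun w => Phi (w, xi w)).
Proof. exact: (measurableT_comp mPhi mpair). Qed.

Lemma indep_integrable : P.-integrable setT (fun w => (Phi (w, xi w))%:E).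
Proof.
apply/integrableP; split; first exact/measurable_EFinP.
apply: le_lt_trans qfin; rewrite ge0_integral_pushforward//.
- apply: ge0_le_integral => //=.
  + by do 2 apply: measurableT_comp.
  + by apply/measurable_EFinP; exact: measurableT_comp.
  + by move=> w _; rewrite lee_fin.
- exact/measurable_EFinP.
- by move=> z _; rewrite lee_fin (le_trans (normr_ge0 (Phi (point, z)))).
Qed.

(** The inner integral is the conditional expectation. Cancellation in [z] is kept since the
    absolute value is taken only after the inner integration; [q], free of [w], secures
    integrability for Fubini. *)
Lemma indep_bound (E : set Omega) (c : R) : <<s Pi >> E -> 0 <= c ->
  (forall w, (`|\int[pushforward P xi]_z (Phi (w, z))%:E| <= (c * \1_E w)%:E)%E) ->
  (`|\int[P]_w (Phi (w, xi w))%:E| <= c%:E * P E)%E.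
Proof.
move=> sE c0 H.
have mE : (measurable : set (set OG)) E by [].
have iprod : (distribution P idG \x distribution P X)%E.-integrable setT (EFin \o Phi).
  apply/integrableP; split; first exact/measurable_EFinP.
  rewrite (eq_measure_integral (distribution P pairX)).
    rewrite ge0_integral_distribution//; last first.
      by apply: measurableT_comp => //; exact/measurable_EFinP.
    by have /integrableP[] := indep_integrable.
  by move=> A mA _; exact: indep_prod.
have -> : (\int[P]_w (Phi (w, xi w))%:E =
    \int[distribution P idG]_w \int[distribution P X]_z (Phi (w, z))%:E)%E.
  rewrite (integral12_prod_meas1 iprod).
  rewrite (eq_measure_integral (distribution P pairX)); last first.
    by move=> A mA _; exact: indep_prod.
  rewrite integral_distribution//; first exact/measurable_EFinP.
  exact: indep_integrable.
apply: le_trans (le_abse_integral _ _ _) _ => //.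
  exact: (measurable_fubini_F iprod).
apply: (@le_trans _ _ (\int[distribution P idG]_w (c * \1_E w)%:E)%E).
  apply: ge0_le_integral => //.
    by apply: measurableT_comp => //; exact: (measurable_fubini_F iprod).
  by apply/measurable_EFinP; apply: measurable_funM.
under eq_integral do rewrite EFinM.
rewrite ge0_integralZl_EFin//; last by apply/measurable_EFinP.
have := @integral_indic _ OG R (distribution P idG) setT measurableT E mE.
by rewrite setIT => ->.
Qed.

End dominated.

End indep_fubini.

(** * Recovering the jumps from the path of the compound Poisson process *)

Lemma measurable_natP d1 (T : measurableType d1) (f : T -> nat) :
  (forall k, measurable [set t | (k < f t)%N]) -> measurable_fun setT f.
Proof.
move=> mf _ B _; rewrite setTI.
have m1 n : measurable [set t | f t = n].
  (* The predecessor of 0 is 0, so the second disjunct makes the first set everything when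
     [n = 0]. *)
  rewrite (_ : [set _ | _] = [set t | (n.-1 < f t)%N || (n == 0)%N] `\` [set t | (n < f t)%N]).
    apply: measurableD => //; case: n => [|n] /=.
      by rewrite (_ : [set t | _] = setT)//; apply/seteqP; split => // t _ /=; rewrite orbT.
    by under eq_set do rewrite orbF.
  apply/seteqP; split=> t /=.
    by move=> <-; rewrite ltnn; case: (f t) => // m; rewrite ltnS leqnn.
  by move=> [h /negP]; rewrite -leqNgt => h2; apply/eqP; rewrite eqn_leq h2; case: n h {h2} => //= n; rewrite orbF.
rewrite (_ : _ @^-1` _ = \bigcup_(n in B) [set t | f t = n]).
  by apply: bigcup_measurable => k _; exact: m1.
by apply/seteqP; split=> [t Bt|t [n Bn /= ->//]]; exists (f t).
Qed.

Lemma measurable_fun_nat_index d1 d2 (T : measurableType d1) (U : measurableType d2)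
    (F : nat -> T -> U) (m : T -> nat) : measurable_fun setT m ->
  (forall n, measurable_fun setT (F n)) -> measurable_fun setT (fun t => F (m t) t).
Proof.
move=> mm mF _ B mB; rewrite setTI.
rewrite (_ : _ @^-1` _ = \bigcup_n (m @^-1` [set n] `&` F n @^-1` B)).
  apply: bigcupT_measurable => n; apply: measurableI.
    by rewrite -[X in measurable X]setTI; exact: mm.
  by rewrite -[X in measurable X]setTI; exact: mF.
by apply/seteqP; split=> [t Bt|t [n _ [/= -> //]]]; exists (m t).
Qed.

Lemma measurable_sumv d1 (T : measurableType d1) (R : realType) (d : nat) (I : Type)
    (r : seq I) (f : I -> T -> 'cV[R]_d) :
  (forall i, measurable_fun setT (f i : T -> Bd R d)) ->
  measurable_fun setT (fun t => \sum_(i <- r) f i t : Bd R d).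
Proof.
move=> mf; apply: measurable_fun_coordP => k.
rewrite (_ : (fun t => _) = fun t => \sum_(i <- r) f i t k ord0).
  apply: measurable_sum => i; exact: (measurableT_comp (@measurable_coord R d k) (mf i)).
by apply/funext => t; rewrite summxE.
Qed.

Lemma measurable_subv d1 (T : measurableType d1) (R : realType) (d : nat)
    (f g : T -> 'cV[R]_d) :
  measurable_fun setT (f : T -> Bd R d) -> measurable_fun setT (g : T -> Bd R d) ->
  measurable_fun setT (fun t => f t - g t : Bd R d).
Proof.
move=> mf mg; apply: measurable_fun_coordP => i.
rewrite (_ : (fun t => _) = fun t => f t i ord0 - g t i ord0).
  by apply: measurable_funB; [exact: (measurableT_comp (@measurable_coord R d i) mf)
    |exact: (measurableT_comp (@measurable_coord R d i) mg)].
by apply/funext => t; rewrite !mxE.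
Qed.

Lemma measurable_set0v (R : realType) (d : nat) : borelRd [set (0 : 'cV[R]_d)].
Proof.
rewrite (_ : [set _] = @eucl R d @^-1` [set 0]); last first.
  by apply/seteqP; split => z /=; [move=> ->; rewrite eucl0|move/eucl_eq0].
have := continuous_measurable_Bd (@continuous_eucl R d).
by move=> /(_ measurableT _ (measurable_set1 0)); rewrite setTI.
Qed.

Lemma measurable_sig_proc (R : realType) d0 (Omega : measurableType d0) (d : nat)
    (L : R -> Omega -> 'cV[R]_d) t : 0 <= t ->
  measurable_fun [set: g_sigma_algebraType (\bigcup_(t in [set t : R | 0 <= t]) sig_rv (L t))]
   (L t : _ -> Bd R d).
Proof.
move=> t0 _ B mB; rewrite setTI; apply: sub_sigma_algebra.
by exists t => //; exists B.
Qed.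

Lemma rvec_measP (R : realType) d0 (Omega : measurableType d0) (d : nat)
    (X : Omega -> 'cV[R]_d) : rvec_meas X -> measurable_fun setT (X : _ -> Bd R d).
Proof. by move=> mX _ B mB; rewrite setTI; exact: mX. Qed.

Lemma sig_proc_sub (R : realType) d0 (Omega : measurableType d0) (d : nat)
    (L : R -> Omega -> 'cV[R]_d) : (forall t, 0 <= t -> rvec_meas (L t)) ->
  sig_proc L `<=` measurable.
Proof.
move=> mL; apply: smallest_sub; first exact: sigma_algebra_measurable.
by move=> _ [t t0 [B mB <-]]; exact: mL.
Qed.

Section recovery.
Context (R : realType) (d0 : measure_display) (Omega : measurableType d0).
Context (P : probability Omega R) (d : nat).
Variables (N : R -> Omega -> nat) (tau : nat -> Omega -> R).
Variable xi : nat -> Omega -> 'cV[R]_d.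
Hypothesis tau1 : forall w, 0 < tau 1 w.
Hypothesis tauS : forall w k, (0 < k)%N -> tau k w < tau k.+1 w.
Hypothesis NtauP : forall t w k, (0 < k)%N -> ((k <= N t w)%N <-> tau k w <= t).
Let L0 := cpoisson N xi.

Lemma N_le0 s w : s <= 0 -> N s w = 0%N.
Proof.
move=> s0; case E : (N s w) => [//|n]; have : (1 <= N s w)%N by rewrite E.
by move=> /(NtauP s w (ltn0Sn 0)) /(lt_le_trans (tau1 w))/lt_le_trans/(_ s0); rewrite ltxx.
Qed.

Lemma N_le s t w : s <= t -> (N s w <= N t w)%N.
Proof.
move=> st; case E : (N s w) => [//|n].
apply/(NtauP t w (ltn0Sn n)); apply: le_trans st.
by apply/(NtauP s w (ltn0Sn n)); rewrite E.
Qed.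

Lemma N_lt s w k : (N s w < k.+1)%N = (s < tau k.+1 w).
Proof.
rewrite ltnNge ltNge; congr negb; apply/idP/idP; first by move/(NtauP s w (ltn0Sn k)).
by move=> H; apply/(NtauP s w (ltn0Sn k)).
Qed.

(** [tau 0] is unconstrained by the hypotheses; time zero stands in for it. *)
Definition tau0 k w : R := if k is k'.+1 then tau k w else 0.

Lemma tau0_ge0 k w : 0 <= tau0 k w.
Proof.
case: k => //= k; elim: k => [|k IH]; first exact/ltW/tau1.
exact: (le_trans IH (ltW (tauS w (ltn0Sn k)))).
Qed.

Lemma tau0S k w : tau0 k w < tau k.+1 w.
Proof. by case: k => [|k]; [exact: tau1|exact: tauS]. Qed.

Lemma N_eq s w k : tau0 k w <= s -> s < tau k.+1 w -> N s w = k.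
Proof.
move=> ks sk; apply/eqP; rewrite eqn_leq -ltnS N_lt sk/=.
by case: k ks {sk} => // k ks; apply/(NtauP s w (ltn0Sn k)).
Qed.

Lemma cpoisson_jump u v w k : N u w = k -> N v w = k.+1 ->
  L0 v w - L0 u w = xi k.+1 w.
Proof.
by move=> Nu Nv; rewrite /L0 /cpoisson Nu Nv big_nat_recr//= addrAC subrr add0r.
Qed.

Definition nonzero_jumps : set Omega := [set w | forall i, xi i.+1 w != 0].

(* Off the null set where some jump vanishes this is [{k <= N_s}]: before [s]
   there is a rational interval across which [L0] moves, preceded by [k - 1] jumps. *)
Fixpoint jumpset (k : nat) (s : R) : set Omega :=
  if k is k'.+1 then
    \bigcup_(pq in [set pq : rat * rat | 0 <= (ratr pq.1 : R) /\
        ratr pq.1 < (ratr pq.2 : R) <= 1])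
      (jumpset k' (ratr pq.1 * s) `&`
       ~` [set w | L0 (ratr pq.2 * s) w - L0 (ratr pq.1 * s) w = 0])
  else setT.

(** This inclusion holds even when some jump is zero: the path cannot move across an interval unless
    the count does. *)
Lemma jumpset_sub k s w : 0 <= s -> jumpset k s w -> (k <= N s w)%N.
Proof.
elim: k s => // k IH s s0 [[p q] /= [p0 /andP[pq q1]] [jk /eqP L]].
have ps0 : 0 <= ratr p * s by exact: mulr_ge0.
have pqs : ratr p * s <= ratr q * s by rewrite ler_wpM2r// ltW.
have qs : ratr q * s <= s by rewrite ler_piMl.
apply: (leq_trans _ (N_le w qs)); rewrite (leq_ltn_trans (IH _ ps0 jk))//.
rewrite ltn_neqAle N_le// andbT; apply: contraNneq L => E.
by rewrite /L0 /cpoisson E subrr.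
Qed.

Lemma jumpset_sup k s w : nonzero_jumps w -> (k <= N s w)%N -> jumpset k s w.
Proof.
move=> gw; elim: k s => // k IH s kN.
have tks : tau k.+1 w <= s by apply/(NtauP s w (ltn0Sn k)).
have s0 : 0 < s := lt_le_trans (le_lt_trans (tau0_ge0 k w) (tau0S k w)) tks.
have /rat_in_itvoo[p] : tau0 k w / s < tau k.+1 w / s by rewrite ltr_pM2r ?invr_gt0 ?tau0S.
rewrite in_itv/= ltr_pdivrMr// ltr_pdivlMr// => /andP[tp pt].
(* Times are rational fractions of [s] so that [s] itself is available as [q = 1]: this is needed
   when the jump occurs exactly at [s]. Stopping before the next jump makes the increment equal to a
   single jump, which is nonzero. *)
have [q [q1 tq qt]] : exists q : rat, [/\ (ratr q : R) <= 1, tau k.+1 w <= ratr q * s &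
    ratr q * s < tau k.+2 w].
  move: tks; rewrite le_eqVlt => /predU1P[tks|tks].
    by exists 1%Q; rewrite rmorph1 mul1r -tks; split => //; exact: tauS.
  have /rat_in_itvoo[q] : tau k.+1 w / s < Order.min 1 (tau k.+2 w / s).
    by rewrite lt_min ltr_pM2r ?invr_gt0// tauS// andbT ltr_pdivrMr// mul1r.
  rewrite in_itv/= lt_min ltr_pdivrMr// ltr_pdivlMr// => /and3P[tq q1 qt].
  by exists q; split; rewrite // ltW.
have p0 : 0 <= ratr p * s by rewrite (le_trans (tau0_ge0 k w))// ltW.
have Np : N (ratr p * s) w = k by apply: N_eq => //; exact: ltW.
have Nq : N (ratr q * s) w = k.+1 by exact: N_eq.
exists (p, q) => /=.
  split; first by move: p0; rewrite pmulr_lge0.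
  by rewrite q1 andbT -(ltr_pM2r s0) (lt_le_trans pt).
split; first by apply: IH; rewrite Np.
by apply/eqP; rewrite (cpoisson_jump Np Nq) gw.
Qed.

Hypothesis mtau : forall k, measurable_fun setT (tau k.+1).
Hypothesis mxi : forall i, rvec_meas (xi i.+1).

Lemma measurable_N t : measurable_fun [set: Omega] (N t).
Proof.
apply: measurable_natP => k.
rewrite (_ : [set w | _] = tau k.+1 @^-1` `]-oo, t]).
  by rewrite -[X in measurable X]setTI; exact: mtau.
by apply/seteqP; split => w /=; rewrite in_itv/= => /(NtauP t w (ltn0Sn k)).
Qed.

Lemma measurable_cpoisson t : rvec_meas (L0 t).
Proof.
move=> B mB; have : measurable_fun setT (L0 t : _ -> Bd R d).
  apply: (@measurable_fun_nat_index _ _ _ (Bd R d)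
    (fun n w => \sum_(1 <= i < n.+1) xi i w) (N t)); first exact: measurable_N.
  move=> n; rewrite (_ : (fun w => _) = fun w => \sum_(0 <= i < n) xi i.+1 w).
    by apply: measurable_sumv => i; exact: rvec_measP.
  by apply/funext => w; rewrite big_add1.
by move=> /(_ measurableT B mB); rewrite setTI.
Qed.

Lemma measurable_jumpset k s : 0 <= s -> sig_proc L0 (jumpset k s).
Proof.
pose S := \bigcup_(t in [set t : R | 0 <= t]) sig_rv (L0 t).
elim: k s => [|k IH] s s0 /=.
  exact: (@measurableT _ (g_sigma_algebraType S)).
rewrite bigcup_mkcond.
apply: (@countable_bigcupT_measurable _ (g_sigma_algebraType S)) => // -[p q].
case: ifPn => [|_]; last exact: (@measurable0 _ (g_sigma_algebraType S)).
rewrite inE /= => -[p0 /andP[pq q1]].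
have q0 : (0 : R) <= ratr q by rewrite (le_trans p0)// ltW.
apply: (@measurableI _ (g_sigma_algebraType S)).
  by apply: IH; exact: mulr_ge0.
apply: (@measurableC _ (g_sigma_algebraType S)).
have := measurable_subv (@measurable_sig_proc _ _ _ _ L0 _ (mulr_ge0 q0 s0))
  (@measurable_sig_proc _ _ _ _ L0 _ (mulr_ge0 p0 s0)).
by move=> /(_ measurableT _ (@measurable_set0v R d)); rewrite setTI.
Qed.

(** Events that coincide with an event of the path of [L0] as long as no jump vanishes. They form a
    sigma-algebra, for which [N] and the jumps are measurable though they need not be for
    [sig_proc L0]. *)
Definition recoverable : set (set Omega) := [set E | exists2 E', sig_proc L0 E' &
  E `&` nonzero_jumps = E' `&` nonzero_jumps].

Lemma recoverable_sigma : sigma_algebra setT recoverable.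
Proof.
pose S := \bigcup_(t in [set t : R | 0 <= t]) sig_rv (L0 t).
split.
- by exists set0 => //; exact: (@measurable0 _ (g_sigma_algebraType S)).
- move=> E [E' sE' EE']; exists (~` E').
    exact: (@measurableC _ (g_sigma_algebraType S)).
  apply/seteqP; split => w /= [h gw]; split => //.
    move=> E'w; have : (E' `&` nonzero_jumps) w by [].
    by rewrite -EE' => -[]; case: h.
  split => // Ew; have : (E `&` nonzero_jumps) w by [].
  by rewrite EE' => -[].
- move=> F FE.
  have cF n : exists E', sig_proc L0 E' /\ F n `&` nonzero_jumps = E' `&` nonzero_jumps.
    by have [E' ? ?] := FE n; exists E'.
  exists (\bigcup_n projT1 (cid (cF n))).
    apply: (@bigcupT_measurable _ (g_sigma_algebraType S)) => n.
    by case: cid => ? [].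
  rewrite !setI_bigcupl; apply: eq_bigcupr => n _.
  by case: cid => ? [].
Qed.

Let OR := g_sigma_algebraType recoverable.

Lemma measurable_recoverable (E : set OR) : measurable E <-> recoverable E.
Proof. by rewrite (@measurable_g_measurableTypeE Omega recoverable recoverable_sigma). Qed.

Lemma sub_recoverable E : sig_proc L0 E -> recoverable E.
Proof. by move=> sE; exists E. Qed.

Lemma recoverable_N t : measurable_fun [set: OR] (N t).
Proof.
apply: measurable_natP => k; apply/measurable_recoverable.
have [t0|/ltW t0] := leP 0 t.
  exists (jumpset k.+1 t); first exact: measurable_jumpset.
  apply/seteqP; split => w /= [h gw]; split => //; first exact: (jumpset_sup gw h).
  exact: (@jumpset_sub k.+1 t w t0 h).
rewrite (_ : [set w | _] = set0).
  by exists set0 => //; exact: (@measurable0 _ (g_sigma_algebraType (\bigcup_(t in [set t : R | 0 <= t]) sig_rv (L0 t)))).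
by apply/seteqP; split => // w /=; rewrite N_le0.
Qed.

(** The jump is the increment of [L0] between any two rational times at which the counts are [i] and
    [i.+1]; such times exist because consecutive jump times are distinct. *)
Lemma recoverable_xi i : measurable_fun [set: OR] (xi i.+1 : _ -> Bd R d).
Proof.
move=> _ B mB; rewrite setTI.
rewrite (_ : _ @^-1` _ = \bigcup_(uv in [set uv : rat * rat | 0 <= (ratr uv.1 : R) /\
      0 <= (ratr uv.2 : R)]) (N (ratr uv.1) @^-1` [set i] `&` N (ratr uv.2) @^-1` [set i.+1] `&`
      (fun w => L0 (ratr uv.2) w - L0 (ratr uv.1) w) @^-1` B)).
  rewrite bigcup_mkcond; apply: countable_bigcupT_measurable => // -[u v].
  case: ifPn => // /[!inE] -[/= u0 v0].
  apply: measurableI; first apply: measurableI.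
  - by rewrite -[X in measurable X]setTI; exact: recoverable_N.
  - by rewrite -[X in measurable X]setTI; exact: recoverable_N.
  - apply/measurable_recoverable/sub_recoverable.
    have := measurable_subv (@measurable_sig_proc _ _ _ _ L0 _ v0) (@measurable_sig_proc _ _ _ _ L0 _ u0).
    by move=> /(_ measurableT _ mB); rewrite setTI.
apply/seteqP; split=> [w Bw|w [[u v] /= _ [[Nu Nv]]]]; last first.
  by rewrite /preimage/= (cpoisson_jump Nu Nv).
have /rat_in_itvoo[u] := tau0S i w; rewrite in_itv/= => /andP[u1 u2].
have /rat_in_itvoo[v] := tauS w (ltn0Sn i); rewrite in_itv/= => /andP[v1 v2].
have Nu : N (ratr u) w = i by apply: N_eq => //; exact: ltW.
have Nv : N (ratr v) w = i.+1 by apply: N_eq => //; exact: ltW.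
exists (u, v) => /=.
  have u0 := le_trans (tau0_ge0 i w) (ltW u1).
  by split => //; rewrite (le_trans u0)// ltW// (lt_trans u2).
by rewrite (cpoisson_jump Nu Nv).
Qed.

Hypothesis xi_neq0 : forall i, P (xi i.+1 @^-1` [set 0]) = 0%E.

Lemma measurable_nonzero_jumps : measurable nonzero_jumps /\ P (~` nonzero_jumps) = 0%E.
Proof.
have E : ~` nonzero_jumps = \bigcup_i (xi i.+1 @^-1` [set 0]).
  apply/seteqP; split => [w /= /existsNP[i /negP]|w [i _ /= h] /(_ i)].
    by rewrite negbK => /eqP h; exists i.
  by rewrite h eqxx.
have m i : measurable (xi i.+1 @^-1` [set 0]) by apply: mxi; exact: measurable_set0v.
split.
  rewrite -[X in measurable X]setCK E; apply: measurableC.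
  exact: bigcupT_measurable.
rewrite E; apply/negligibleP; first exact: bigcupT_measurable.
by apply: negligible_bigcup => i; exact/negligibleP/xi_neq0.
Qed.

Variable L1 : R -> Omega -> 'cV[R]_d.
Hypothesis mL1 : forall t, 0 <= t -> rvec_meas (L1 t).
Hypothesis indL : indep2 P (sig_proc L1) (sig_proc L0).

(** [E] and its representative in [sig_proc L0] differ by a null set, so both probabilities may be
    computed with the representative. *)
Lemma recoverable_indep A E : sig_proc L1 A -> recoverable E -> measurable E ->
  fine (P (A `&` E)) = fine (P A) * fine (P E).
Proof.
move=> sA [E' sE' EE'] mE.
have [mg gP] := measurable_nonzero_jumps.
have mA := sig_proc_sub mL1 sA.
have mE' : measurable E' by apply: (@sig_proc_sub _ _ _ _ L0) => // t _; exact: measurable_cpoisson.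
have H B : measurable B -> P B = P (B `&` nonzero_jumps).
  move=> mB; rewrite -[in LHS](setIT B) -(setUv nonzero_jumps) setIUr.
  apply: measureU0; [exact: measurableI| |].
    by apply: measurableI => //; exact: measurableC.
  apply: (@subset_measure0 _ _ _ P _ (~` nonzero_jumps)) => //.
  - by apply: measurableI => //; exact: measurableC.
  - exact: measurableC.
rewrite (H E mE) EE' -(H E' mE') -(indL sA sE').
rewrite (H _ (measurableI _ _ mA mE)) (H _ (measurableI _ _ mA mE')).
by rewrite -!setIA EE'.
Qed.

Let HN := <<s \bigcup_(t in [set t : R | 0 <= t]) sig_nat (N t) >>.
Let HX := <<s \bigcup_(i in [set: nat]) sig_rv (xi i.+1) >>.
Hypothesis indN : indep2 P HX HN.
Hypothesis indxi : indep_fam P (fun i : nat => sig_rv (xi i.+1)).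

Definition other_jumps (n i : nat) (C : nat -> set 'cV[R]_d) : set Omega :=
  [set w | forall j, (j < n)%N -> j != i -> C j (xi j.+1 w)].

(* A pi-system generating the sigma-algebra of [L1], [N] and the jumps of index
   below [n] other than [xi i.+1]. *)
Definition indepPi (n i : nat) : set (set Omega) := [set E | exists A B C,
  [/\ sig_proc L1 A, HN B, (forall j, borelRd (C j)) &
      E = A `&` B `&` other_jumps n i C]].

Lemma HN_sub B : HN B -> recoverable B /\ measurable B.
Proof.
move=> sB; split.
  apply: (@smallest_sub _ _ _ _ recoverable_sigma _ B sB) => _ [t t0 [D _ <-]].
  apply/measurable_recoverable.
  by rewrite -[X in measurable X]setTI; exact: recoverable_N.
apply: (@smallest_sub _ _ _ (@measurable _ Omega) _ _ B sB).
  exact: sigma_algebra_measurable.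
move=> _ [t t0 [D _ <-]].
by rewrite -[X in measurable X]setTI; exact: measurable_N.
Qed.

Lemma other_jumpsE n i C : other_jumps n i C =
  \bigcap_(j in [set j | (j < n)%N /\ j != i]) (xi j.+1 @^-1` C j).
Proof. by apply/seteqP; split => [w h j [jn ji]|w h j jn ji]; exact: h. Qed.

Lemma measurable_other_jumps n i C : (forall j, borelRd (C j)) ->
  [/\ recoverable (other_jumps n i C), measurable (other_jumps n i C) &
      HX (other_jumps n i C)].
Proof.
move=> mC; rewrite other_jumpsE; split.
- apply/measurable_recoverable; apply: bigcap_measurableType => j _.
  by rewrite -[X in measurable X]setTI; apply: recoverable_xi => //; exact: mC.
- by apply: bigcap_measurableType => j _; exact: mxi.
- apply: (@bigcap_measurableType _ (g_sigma_algebraType (\bigcup_(i in [set: nat]) sig_rv (xi i.+1)))).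
  by move=> j _; apply: sub_sigma_algebra; exists j => //; exists (C j).
Qed.

(** The product formula for the family is applied along [i :: J] and along [J], and the two are
    compared. *)
Lemma indep_other_jumps n i C D : (i < n)%N -> (forall j, borelRd (C j)) -> borelRd D ->
  fine (P (other_jumps n i C `&` xi i.+1 @^-1` D)) =
  fine (P (other_jumps n i C)) * fine (P (xi i.+1 @^-1` D)).
Proof.
move=> ilt mC mD.
pose E j := xi j.+1 @^-1` (if j == i then D else C j).
pose J := [seq j <- iota 0 n | j != i].
have EJ : other_jumps n i C = \bigcap_(j in [set j | j \in J]) E j.
  rewrite other_jumpsE; apply/seteqP; split => w h j.
    rewrite /= mem_filter mem_iota add0n => /andP[ji jn].
    by rewrite /E (negbTE ji); apply: h.
  move=> [jn ji]; have := h j; rewrite /E (negbTE ji); apply.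
  by rewrite /= mem_filter ji mem_iota.
have EJi : other_jumps n i C `&` xi i.+1 @^-1` D = \bigcap_(j in [set j | j \in i :: J]) E j.
  rewrite EJ; apply/seteqP; split => [w [h hi] j|w h].
    rewrite /= inE => /predU1P[->|]; last exact: h.
    by rewrite /E eqxx.
  split; last by have := h i; rewrite /E eqxx; apply; rewrite /= mem_head.
  by move=> j jJ; apply: h; rewrite /= inE jJ orbT.
have sE j : sig_rv (xi j.+1) (E j).
  by exists (if j == i then D else C j) => //; case: ifP.
have uJ : uniq J by rewrite filter_uniq// iota_uniq.
rewrite EJi EJ (indxi _ (fun j _ => sE j)); last first.
  by rewrite /= uJ mem_filter eqxx.
by rewrite big_cons (indxi uJ (fun j _ => sE j)) mulrC /E eqxx.
Qed.

Lemma indepPi_sub n i : indepPi n i `<=` measurable.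
Proof.
move=> _ [A [B [C [sA /HN_sub[_ mB] mC ->]]]].
apply: measurableI; last by have [] := measurable_other_jumps n i mC.
by apply: measurableI => //; exact: (sig_proc_sub mL1 sA).
Qed.

Lemma indepPi_setI n i : setI_closed (indepPi n i).
Proof.
move=> _ _ [A [B [C [sA sB mC ->]]]] [A' [B' [C' [sA' sB' mC' ->]]]].
exists (A `&` A'), (B `&` B'), (fun j => C j `&` C' j); split.
- exact: (@measurableI _ (g_sigma_algebraType (\bigcup_(t in [set t : R | 0 <= t]) sig_rv (L1 t)))).
- exact: (@measurableI _ (g_sigma_algebraType (\bigcup_(t in [set t : R | 0 <= t]) sig_nat (N t)))).
- by move=> j; exact: (@measurableI _ (Bd R d) _ _ (mC j) (mC' j)).
- rewrite setIACA (setIACA A B); congr (_ `&` _).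
  apply/seteqP; split => [w [h h'] j jn ji|w h]; first by split; [exact: h|exact: h'].
  by split=> j jn ji; have [] := h j jn ji.
Qed.

(** On the pi-system the three assumptions are used in turn: [L1] splits off because the remaining
    events are recoverable from [L0], then [N] splits off from the jumps, then [xi i.+1] from the
    other jumps. *)
Lemma indepPi_indep n i E D : (i < n)%N -> <<s indepPi n i >> E -> borelRd D ->
  P (E `&` xi i.+1 @^-1` D) = (P E * P (xi i.+1 @^-1` D))%E.
Proof.
move=> ilt sE mD.
have mxD : measurable (xi i.+1 @^-1` D) by exact: mxi.
apply: (indep_g_sigma (@indepPi_setI n i) (@indepPi_sub n i) mxD) sE => {}E.
move=> [A [B [C [sA sB mC ->]]]].
have [rB mB] := HN_sub sB.
have [rC mC' xC] := measurable_other_jumps n i mC.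
have mA := sig_proc_sub mL1 sA.
pose D' := xi i.+1 @^-1` D.
have xD : HX D' by apply: sub_sigma_algebra; exists i => //; exists D.
have rD : recoverable D'.
  apply/measurable_recoverable.
  by rewrite -[X in measurable X]setTI; exact: recoverable_xi.
have rI X Y : recoverable X -> recoverable Y -> recoverable (X `&` Y).
  by move=> /measurable_recoverable rX /measurable_recoverable rY;
    apply/measurable_recoverable; exact: measurableI.
have xCD : HX (other_jumps n i C `&` D').
  exact: (@measurableI _ (g_sigma_algebraType (\bigcup_(i in [set: nat]) sig_rv (xi i.+1)))).
rewrite -[LHS]fineK ?fin_num_measure//; last by do 3 apply: measurableI => //.
rewrite -[X in (X * _)%E]fineK ?fin_num_measure//; last by do 2 apply: measurableI => //.
rewrite -[X in (_ * X)%E]fineK ?fin_num_measure// -EFinM; congr EFin.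
have mO : measurable (other_jumps n i C `&` D') by exact: measurableI.
rewrite -/D' -!setIA.
rewrite (recoverable_indep sA (rI _ _ rB (rI _ _ rC rD)) (measurableI _ _ mB mO)).
rewrite (recoverable_indep sA (rI _ _ rB rC) (measurableI _ _ mB mC')).
rewrite ![B `&` _]setIC (indN xCD sB) (indN xC sB).
by rewrite indep_other_jumps//; rewrite -/D'; ring.
Qed.

End recovery.

(** * The Ornstein-Uhlenbeck path *)

Lemma norm_le_dist1 (R : realType) (a b : R) : `|a - b| <= 1 -> `|b| <= `|a| + 1.
Proof.
move=> ab; have := ler_normD a (b - a).
by rewrite addrC subrK => /le_trans; apply; rewrite lerD2l distrC.
Qed.

(** Near each point the right limit, the left limit and the value at the point give three bounds;
    compactness of the segment makes them uniform. Negative times, where nothing is known, are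
    excluded throughout. *)
Lemma cadlag_bounded (R : realType) (f : R -> R) (t : R) :
  (forall s, 0 <= s -> f @ at_right s --> f s) ->
  (forall s, 0 < s -> cvg (f @ at_left s)) ->
  exists M : R, forall s, 0 <= s <= t -> `|f s| <= M.
Proof.
move=> rf lf.
have K := (@compact_near_coveringP _ _).1 (@segment_compact R 0 t) R +oo
  (fun M s => 0 <= s -> `|f s| <= M) _.
suff Hx x : `[0, t]%classic x ->
    \forall y \near x & M \near +oo, (0 <= y -> `|f y| <= M).
  have [M [_ HM]] := K _ Hx; exists (M + 1) => s /andP[s0 st].
  by apply: (HM (M + 1)); rewrite ?ltrDl//= in_itv/= s0.
rewrite /= in_itv/= => /andP[x0 xt].
have [Mr Hr] : exists M, \forall y \near x, x < y -> `|f y| <= M.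
  exists (`|f x| + 1).
  have /cvgrPdist_le/(_ _ ltr01) := rf _ x0; apply: filterS => y.
  exact: norm_le_dist1.
have [Ml Hl] : exists M, \forall y \near x, y < x -> 0 <= y -> `|f y| <= M.
  move: x0; rewrite le_eqVlt => /predU1P[<-|x0].
    by exists 0; exists 1 => //= y _ /lt_le_trans/[apply]; rewrite ltxx.
  have /cvg_ex[l fl] := lf _ x0; exists (`|l| + 1).
  have /cvgrPdist_le/(_ _ ltr01) := fl; by apply: filterS => y /norm_le_dist1 ? _.
exists ([set y | (x < y -> `|f y| <= Mr) /\ (y < x -> 0 <= y -> `|f y| <= Ml)],
  [set M | Order.max `|f x| (Order.max Mr Ml) <= M]) => /=.
  by split; [exact: filterI|by exists (Order.max `|f x| (Order.max Mr Ml)); split => [|y /ltW]; rewrite ?num_real].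
move=> [y M] /= [[yr yl]]; rewrite !ge_max => /and3P[xM rM lM] y0.
have [xy|yx|<-//] := ltgtP x y; first exact: le_trans (yr xy) rM.
exact: le_trans (yl yx y0) lM.
Qed.

Lemma cvg_coord (T : Type) (F : set_system T) (FF : Filter F) (R : realType) d
    (f : T -> 'cV[R]_d) (v : 'cV[R]_d) i :
  f t @[t --> F] --> v -> f t i ord0 @[t --> F] --> v i ord0.
Proof.
move=> /(@cvgrPdist_le R 'cV[R]_d T F FF) fv; apply/cvgrPdist_le => e /fv.
apply: filterS => t; apply: le_trans.
by have := coord_le_norm (v - f t) i; rewrite !mxE.
Qed.

(** * Joint measurability and integrability of right-continuous paths *)

Section levy_path.
Context (R : realType) (d0 : measure_display) (Omega : measurableType d0) (d : nat).
Variable L : R -> Omega -> 'cV[R]_d.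
Hypothesis Lr : forall w t, 0 <= t -> (fun s => L s w) @ at_right t --> L t w.
Hypothesis Ll : forall w t, 0 < t -> cvg ((fun s => L s w) @ at_left t).

Let OL := g_sigma_algebraType (\bigcup_(t in [set t : R | 0 <= t]) sig_rv (L t)).

Lemma path_right w i t : 0 <= t -> (fun s => L s w i ord0) @ at_right t --> L t w i ord0.
Proof. by move=> t0; apply: cvg_coord; exact: Lr. Qed.

Lemma path_left w i t : 0 < t -> cvg ((fun s => L s w i ord0) @ at_left t).
Proof.
move=> t0; have /cvg_ex[l Hl] := @Ll w t t0; apply/cvg_ex; exists (l i ord0).
exact: cvg_coord.
Qed.

Lemma path_bounded w i t : exists M, forall s, 0 <= s <= t -> `|L s w i ord0| <= M.
Proof.
by apply: cadlag_bounded => s s0; [exact: path_right|exact: path_left].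
Qed.

Lemma measurable_path : measurable_fun [set: (OL * measurableTypeR R)%type]
  (fun p => L (Order.max p.2 0) p.1 : Bd R d).
Proof.
apply: measurable_fun_coordP => i.
(* The next point of the grid of mesh [1/(n+1)] strictly to the right of [s]: it takes countably
   many values, and right continuity gives convergence of the path along it. The maximum with 0
   avoids negative times. *)
pose u n (s : R) : R := (Num.truncn (n.+1%:R * Order.max s 0)).+1%:R / n.+1%:R.
apply: (@measurable_fun_cvg _ _ _ _ (fun n (p : OL * measurableTypeR R) => L (u n p.2) p.1 i ord0)).
  move=> n; apply: (measurableT_comp (@measurable_coord R d i)).
  apply: (@measurable_fun_nat_index _ _ _ (Bd R d)
    (fun k (p : OL * measurableTypeR R) => L (k.+1%:R / n.+1%:R) p.1)
    (fun p => Num.truncn (n.+1%:R * Order.max p.2 0))).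
    apply: measurable_natP => k.
    rewrite (_ : [set _ | _] = (fun p : OL * measurableTypeR R =>
       n.+1%:R * Order.max p.2 0) @^-1` `[k.+1%:R, +oo[).
      rewrite -[X in measurable X]setTI.
      have : measurable_fun setT (fun p : OL * measurableTypeR R =>
         n.+1%:R * Order.max (p.2 : R) 0).
        by apply: measurable_funM => //; apply: measurable_maxr.
      by move=> H; apply: H.
    by apply/seteqP; split => p /=; rewrite in_itv/= andbT truncn_gt_nat.
  move=> k; apply: measurableT_comp measurable_fst.
  by apply: measurable_sig_proc; rewrite divr_ge0.
move=> [w s] _ /=; set s' := Order.max s 0.
have s0 : 0 <= s' by rewrite le_max lexx orbT.
have us n : s' < u n s by rewrite ltr_pdivlMr// mulrC truncnS_gt.
have := (@cvg_at_rightP R (fun s => L s w i ord0) s' (L s' w i ord0)).1 (@path_right w i _ s0).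
apply; split => //.
apply/cvgrPdist_le => e e0.
have : \forall n \near \oo, (n.+1%:R^-1 : R) < e.
  by have /cvgrPdist_lt/(_ _ e0) := @cvg_harmonic R; apply: filterS => n;
    rewrite /= sub0r normrN ger0_norm.
apply: filterS => n ne; rewrite distrC ger0_norm ?subr_ge0 ?(ltW (us n))//.
apply: le_trans (ltW ne); rewrite /u -/s' lerBlDr ler_pdivrMr// mulrDl mulVf//.
by rewrite -natr1 addrC lerD2l mulrC truncn_le// mulr_ge0.
Qed.

Variables (A : 'M[R]_d) (t : R).
Hypothesis t0 : 0 <= t.

Definition OU_integrand (w : Omega) (i : 'I_d) (s : R) : R :=
  (A *m expm ((t - s) *: A) *m L s w) i ord0.

Lemma measurable_expmB i j : measurable_fun [set: R] (fun s : R => (A *m expm ((t - s) *: A)) i j).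
Proof.
rewrite (_ : (fun s => _) = fun s => \sum_l A i l * expm ((t - s) *: A) l j).
  apply: measurable_sum => l; apply: measurable_funM => //.
  apply: continuous_measurable_fun => s; apply: differentiable_continuous.
  by apply/derivable1_diffP; case: (is_derive_expmB A l j t s).
by apply/funext => s; rewrite mxE.
Qed.

Let h i (p : OL * measurableTypeR R) : R :=
  (\sum_l (A *m expm ((t - p.2) *: A)) i l * L (Order.max p.2 0) p.1 l ord0) *
  \1_(`[0, t]%classic : set R) p.2.

Let mh i : measurable_fun setT (h i).
Proof.
apply: measurable_funM; last first.
  by apply: (measurableT_comp (measurable_indic _) measurable_snd).
apply: measurable_sum => l; apply: measurable_funM.
  exact: (measurableT_comp (measurable_expmB i l) measurable_snd).
exact: (measurableT_comp (@measurable_coord R d l) measurable_path).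
Qed.

Let hE w i : (fun s => h i (w, s)) = (OU_integrand w i) \_ `[0, t].
Proof.
apply/funext => s; rewrite /h /OU_integrand patchE indicE mem_setE.
case: ifPn => [|_]; last by rewrite mulr0.
by rewrite in_itv/= => /andP[s0 st]; rewrite mulr1 max_l// mxE.
Qed.

(** Measurability is with respect to the path of [L] alone, which is what independence needs;
    positive and negative parts are handled separately by Tonelli. *)
Lemma measurable_OU_integral i : measurable_fun [set: OL]
  (fun w => Rintegral (@lebesgue_measure R) `[0, t] (OU_integrand w i)).
Proof.
rewrite (_ : (fun w => _) = fun w => fine (\int[lebesgue_measure]_s (h i (w, s))%:E)%E).
  apply: measurableT_comp => //.
  rewrite (_ : (fun w => _) = (fun w => \int[lebesgue_measure]_s (EFin \o h i)^\+ (w, s) -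
     \int[lebesgue_measure]_s (EFin \o h i)^\- (w, s))%E).
    apply: emeasurable_funB.
      apply: (@measurable_fun_fubini_tonelli_F _ _ _ _ _ lebesgue_measure (EFin \o h i)^\+%E) => //.
      by apply: measurable_funepos; exact/measurable_EFinP.
    apply: (@measurable_fun_fubini_tonelli_F _ _ _ _ _ lebesgue_measure (EFin \o h i)^\-%E) => //.
    by apply: measurable_funeneg; exact/measurable_EFinP.
  apply/funext => w; rewrite [LHS]integralE; congr (_ - _)%E; apply: eq_integral => s _.
    by rewrite !funeposE.
  by rewrite !funenegE.
apply/funext => w; rewrite Rintegral_mkcond -hE.
by [].
Qed.

Lemma OU_integrable w i :
  (@lebesgue_measure R).-integrable `[0, t] (EFin \o OU_integrand w i).
Proof.
have [M HM] : exists M : 'I_d -> R, forall l s, 0 <= s <= t -> `|L s w l ord0| <= M l.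
  have /choice[M HM] : forall l, exists M, forall s, 0 <= s <= t -> `|L s w l ord0| <= M.
    by move=> l; exact: path_bounded.
  by exists M.
apply: (@measurable_bounded_integrable _ _ _ lebesgue_measure).
- exact: measurable_itv.
- by rewrite /= lebesgue_measure_itv/=; case: ifP => _; rewrite ?ltry// -EFinB ltry.
- have : measurable_fun [set: measurableTypeR R] ((OU_integrand w i) \_ `[0, t]).
    rewrite -hE.
    exact: (measurableT_comp (mh i) (@pair1_measurable _ _ OL (measurableTypeR R) w)).
  by move=> H; apply/(measurable_restrictT _ (measurable_itv _)).
- exists (mxsum A * (expR (mxsum A * t) * \sum_l M l)); split; first exact: num_real.
  move=> K /ltW HK s /=; rewrite in_itv/= => s0t; have /andP[s0 st] := s0t.
  apply: le_trans HK; rewrite /OU_integrand -mulmxA.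
  apply: (le_trans (coord_le_eucl _ _)); apply: (le_trans (mulmx_le _ _)).
  rewrite ler_wpM2l ?mxsum_ge0//; apply: (le_trans (expm_le _ _ _)).
    by rewrite subr_ge0.
  apply: ler_pM; rewrite ?expR_ge0 ?eucl_ge0//.
    by rewrite ler_expR ler_wpM2l ?mxsum_ge0// lerBlDr lerDl.
  by apply: (le_trans (eucl_le_sum _)); apply: ler_sum => l _; exact: HM.
Qed.

End levy_path.

Lemma Rintegral_sum d0 (T : measurableType d0) (R : realType)
    (mu : {measure set T -> \bar R}) (D : set T) (I : Type) (r : seq I) (f : I -> T -> R) :
  measurable D -> (forall i, mu.-integrable D (EFin \o f i)) ->
  mu.-integrable D (EFin \o (fun x => \sum_(i <- r) f i x)) /\
  Rintegral mu D (fun x => \sum_(i <- r) f i x) = \sum_(i <- r) Rintegral mu D (f i).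
Proof.
move=> mD fi; elim: r => [|i r [IH1 IH2]].
  split; last by rewrite big_nil; under eq_Rintegral do rewrite big_nil; rewrite Rintegral_cst// mul0r.
  by under eq_fun do rewrite big_nil; exact: integrable0.
split.
  under eq_fun do rewrite big_cons.
  exact: (integrableD mD (fi i) IH1).
by rewrite big_cons -IH2 -RintegralD//; apply: eq_Rintegral => x _; rewrite big_cons.
Qed.

(** * Contribution of a single jump to the integral *)

Section step_path.
Variables (R : realType) (d : nat) (A : 'M[R]_d) (t : R).
Hypothesis t0 : 0 <= t.

Let g (v : 'cV[R]_d) i s : R := (A *m expm ((t - s) *: A) *m v) i ord0.

Let dF v i (s : R) : is_derive s 1 (fun s => - (expm ((t - s) *: A) *m v) i ord0) (g v i s).
Proof.
have -> : (fun s => - (expm ((t - s) *: A) *m v) i ord0) =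
    - \sum_l (fun s => v l ord0 *: expm ((t - s) *: A) i l).
  apply/funext => r; rewrite /GRing.opp/= fct_sumE mxE; congr (- _).
  by apply: eq_bigr => l _; rewrite mulrC.
apply: is_derive_eq.
  apply: is_deriveN; apply: is_derive_sum => l.
  exact: (is_deriveZ (v l ord0) (is_derive_expmB A i l t s)).
rewrite -sumrN /g mxE; apply: eq_bigr => l _.
by rewrite /GRing.scale/= mulrN opprK mulrC.
Qed.

Let cg v i : continuous (g v i).
Proof.
rewrite (_ : g v i = fun s => \sum_l (\sum_k A i k * expm ((t - s) *: A) k l) * v l ord0).
  move=> s; apply: cvg_sumr => l; apply: cvgMl; apply: cvg_sumr => k; apply: cvgMr.
  apply: differentiable_continuous.
  by apply/derivable1_diffP; case: (is_derive_expmB A k l t s).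
by apply/funext => s; rewrite /g mxE; apply: eq_bigr => l _; rewrite mxE.
Qed.

Lemma integral_expm v i u : u <= t ->
  Rintegral (@lebesgue_measure R) `[u, t] (g v i) =
  (expm ((t - u) *: A) *m v - v) i ord0.
Proof.
(* The fundamental theorem of calculus is applied on a nondegenerate interval; for [u = t] both
   sides vanish. *)
rewrite le_eqVlt => /predU1P[->|ut].
  by rewrite set_itv1 Rintegral_set1 subrr expm0 mul1mx subrr mxE.
rewrite /Rintegral (@continuous_FTC2 _ (g v i)
  (fun s => - (expm ((t - s) *: A) *m v) i ord0) u t ut).
- by rewrite /= subrr expm0 mul1mx opprK addrC !mxE.
- exact/continuous_subspaceT/cg.
- have cF (s : R) : {for s, continuous (fun s => - (expm ((t - s) *: A) *m v) i ord0)}.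
    by apply: differentiable_continuous; apply/derivable1_diffP; case: (dF v i s).
  split; first by move=> s _; case: (dF v i s).
    exact/cvg_at_right_filter/cF.
  exact/cvg_at_left_filter/cF.
- by move=> s _; rewrite derive1E; case: (dF v i s).
Qed.

Definition step_integrand (v : 'cV[R]_d) (u : R) i s : R :=
  (A *m expm ((t - s) *: A) *m (if u <= s then v else 0)) i ord0.

Let step_patch v u i : 0 <= u -> (step_integrand v u i) \_ `[0, t] = (g v i) \_ `[u, t].
Proof.
move=> u0; apply/funext => s; rewrite !patchE !mem_setE !in_itv/= /step_integrand.
case: (leP u s) => us /=; first by rewrite (le_trans u0 us).
by case: ifP => // _; rewrite mulmx0 mxE.
Qed.

Lemma step_integrable v u i : 0 <= u ->
  (@lebesgue_measure R).-integrable `[0, t] (EFin \o step_integrand v u i).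
Proof.
move=> u0; have m0 : measurable (`[0, t]%classic : set (measurableTypeR R)) by exact: measurable_itv.
have mu : measurable (`[u, t]%classic : set (measurableTypeR R)) by exact: measurable_itv.
apply/(integrable_mkcond _ m0).
rewrite (_ : _ \_ _ = (EFin \o g v i) \_ `[u, t]); last first.
  by rewrite !restrict_EFin step_patch.
apply/(integrable_mkcond _ mu).
by apply: continuous_compact_integrable; [exact: segment_compact|exact/continuous_subspaceT/cg].
Qed.

Lemma integral_step v u i : 0 <= u <= t ->
  Rintegral (@lebesgue_measure R) `[0, t] (step_integrand v u i) =
  (expm ((t - u) *: A) *m v - v) i ord0.
Proof.
move=> /andP[u0 ut]; rewrite -integral_expm// Rintegral_mkcond step_patch//.
by rewrite -Rintegral_mkcond.
Qed.

End step_path.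

(** * Splitting the solution into the part of [L1] and the jumps *)

Section OU_decomposition.
Context (R : realType) (d0 : measure_display) (Omega : measurableType d0) (d : nat).
Variables (N : R -> Omega -> nat) (tau : nat -> Omega -> R).
Variable xi : nat -> Omega -> 'cV[R]_d.
Hypothesis tau1 : forall w, 0 < tau 1 w.
Hypothesis tauS : forall w k, (0 < k)%N -> tau k w < tau k.+1 w.
Hypothesis NtauP : forall t w k, (0 < k)%N -> ((k <= N t w)%N <-> tau k w <= t).
Variable L1 : R -> Omega -> 'cV[R]_d.
Hypothesis Lr : forall w t, 0 <= t -> (fun s => L1 s w) @ at_right t --> L1 t w.
Hypothesis Ll : forall w t, 0 < t -> cvg ((fun s => L1 s w) @ at_left t).
Variables (A : 'M[R]_d) (t : R).
Hypothesis t0 : 0 <= t.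

(** The range of summation no longer depends on [s], so the sum can be exchanged with the integral
    over [[0, t]]. *)
Lemma cpoisson_step s w : s <= t -> cpoisson N xi s w =
  \sum_(0 <= k < N t w) (if tau k.+1 w <= s then xi k.+1 w else 0).
Proof.
move=> st; rewrite /cpoisson big_add1 /=.
rewrite (big_nat_widen _ _ _ _ _ (N_le NtauP w st)) big_mkcond.
apply: eq_bigr => k _ /=; congr (if _ then _ else _).
by apply/idP/idP => /(NtauP s w (ltn0Sn k)).
Qed.

Definition levy_part (w : Omega) : 'cV[R]_d :=
  L1 t w + vint 0 t (fun s => A *m expm ((t - s) *: A) *m L1 s w).

Lemma measurable_levy_part :
  measurable_fun [set: g_sigma_algebraType (\bigcup_(t in [set t : R | 0 <= t]) sig_rv (L1 t))]
    (levy_part : _ -> Bd R d).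
Proof.
apply: measurable_fun_coordP => i.
rewrite (_ : (fun w => _) = fun w => L1 t w i ord0 +
    Rintegral (@lebesgue_measure R) `[0, t] (OU_integrand L1 A t w i)).
  apply: measurable_funD; last exact: measurable_OU_integral.
  exact: (measurableT_comp (@measurable_coord R d i) (@measurable_sig_proc _ _ _ _ L1 _ t0)).
by apply/funext => w; rewrite !mxE.
Qed.

(** A jump [v] at time [u] contributes [v] to [L_t] and [e^{(t-u)A} v - v] to the integral by
    parts. *)
Lemma OU_decomp x w :
  OU A (fun t w => L1 t w + cpoisson N xi t w) t x w =
  expm (t *: A) *m x + levy_part w +
  \sum_(0 <= k < N t w) expm ((t - tau k.+1 w) *: A) *m xi k.+1 w.
Proof.
rewrite /OU /levy_part -!addrA; congr (_ + (_ + _)).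
have tau_in k : (k < N t w)%N -> 0 <= tau k.+1 w <= t.
  move=> kN; rewrite (tau0_ge0 tau1 tauS k.+1 w)/=.
  exact/(NtauP t w (ltn0Sn k)).
have -> : vint 0 t (fun s => A *m expm ((t - s) *: A) *m (L1 s w + cpoisson N xi s w)) =
    vint 0 t (fun s => A *m expm ((t - s) *: A) *m L1 s w) +
    \sum_(0 <= k < N t w) (expm ((t - tau k.+1 w) *: A) *m xi k.+1 w - xi k.+1 w).
  apply/colP => i; rewrite !mxE.
  have m0 : measurable (`[0, t]%classic : set (measurableTypeR R)) by exact: measurable_itv.
  pose h k s := step_integrand A t (xi k.+1 w) (tau k.+1 w) i s.
  have hi k : (@lebesgue_measure R).-integrable `[0, t] (EFin \o h k).
    by apply: step_integrable => //; exact: (tau0_ge0 tau1 tauS k.+1 w).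
  have [hI hE] := Rintegral_sum (index_iota 0 (N t w)) m0 hi.
  transitivity (Rintegral (@lebesgue_measure R) `[0, t]
     (fun s => OU_integrand L1 A t w i s + \sum_(0 <= k < N t w) h k s)).
    apply: eq_Rintegral => s; rewrite inE/= in_itv/= => /andP[s0 st].
    rewrite mulmxDr mxE (cpoisson_step w st) mulmx_sumr summxE.
    by congr (_ + _).
  rewrite RintegralD//; last exact: OU_integrable.
  congr (_ + _); rewrite hE summxE; apply: eq_big_nat => k /andP[_ kN].
  by rewrite integral_step ?tau_in.
rewrite sumrB (_ : cpoisson N xi t w = \sum_(0 <= k < N t w) xi k.+1 w); last first.
  by rewrite /cpoisson big_add1.
by rewrite addrCA; congr (_ + _); rewrite addrC subrK.
Qed.

End OU_decomposition.

(** * The score *)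

Section density.
Variables (R : realType) (d : nat) (rho : 'cV[R]_d -> R) (lam : R).
Variable mu : {measure set (Bd R d) -> \bar R}.
Hypothesis rho_ge0 : forall z, 0 <= rho z.
Hypothesis drho : forall z, differentiable rho z.
Hypothesis lam_gt0 : 0 < lam.
Hypothesis muE : forall B, borelRd B -> mu B = (lam^-1%:E * nu0 rho B)%E.

Let mrho : measurable_fun [set: Bd R d] rho := measurable_differentiable drho.

Let lamV_ge0 : 0 <= lam^-1. Proof. by rewrite invr_ge0 ltW. Qed.

Lemma nu0_leb (B : set (Bd R d)) : measurable B ->
  nu0 rho B = (\int[leb R d]_z (\1_B z * rho z)%:E)%E.
Proof.
move=> mB; rewrite integral_leb//.
  by apply/measurable_EFinP; apply: measurable_funM.
by move=> z; rewrite lee_fin mulr_ge0.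
Qed.

Import HBNNSimple.

Lemma ge0_integral_density (phi : Bd R d -> \bar R) :
  measurable_fun setT phi -> (forall z, (0 <= phi z)%E) ->
  (\int[mu]_z phi z = lam^-1%:E * \int[leb R d]_z (phi z * (rho z)%:E))%E.
Proof.
move=> mphi phi0.
pose phi_ := nnsfun_approx measurableT mphi.
have mer : measurable_fun [set: Bd R d] (fun z => (rho z)%:E) by exact/measurable_EFinP.
have E n : (\int[mu]_z (phi_ n z)%:E =
    lam^-1%:E * \int[leb R d]_z ((phi_ n z)%:E * (rho z)%:E))%E.
  transitivity (\sum_(k \in range (phi_ n)) k%:E * mu (phi_ n @^-1` [set k]))%E.
    by rewrite integralT_nnsfun sintegralE.
  transitivity (lam^-1%:E * \int[leb R d]_z \sum_(k \in range (phi_ n))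
      ((k * \1_(phi_ n @^-1` [set k]) z)%:E * (rho z)%:E))%E; last first.
    congr (_ * _)%E; apply: eq_integral => z _.
    rewrite [in RHS](fimfunE (phi_ n) z) -fsumEFin// ge0_mule_fsuml//.
    by move=> k; rewrite EFinM; exact: nnfun_muleindic_ge0.
  have pos k z : (0 <= (k * \1_(phi_ n @^-1` [set k]) z)%:E * (rho z)%:E)%E.
    by rewrite mule_ge0 ?lee_fin// -lee_fin EFinM; exact: nnfun_muleindic_ge0.
  rewrite ge0_integral_fsum//; last first.
    move=> k; apply: emeasurable_funM => //; apply/measurable_EFinP.
    by apply: measurable_funM => //; exact: measurable_indic.
  rewrite ge0_mule_fsumr; last by move=> k; exact: integral_ge0.
  apply: eq_fsbigr => k /set_mem[z _ kE].
  have k0 : 0 <= k by rewrite -kE.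
  have mk : measurable (phi_ n @^-1` [set k]) by [].
  rewrite (muE mk) nu0_leb// muleCA; congr (_ * _)%E.
  rewrite -ge0_integralZl_EFin//.
  - by apply: eq_integral => y _; rewrite -!EFinM mulrA.
  - by move=> y _; rewrite lee_fin mulr_ge0.
  - by apply/measurable_EFinP; apply: measurable_funM => //; exact: measurable_indic.
have cv z : (phi_ n z)%:E @[n --> \oo] --> phi z.
  by apply: cvg_nnsfun_approx => // ? _; exact: phi0.
transitivity (limn (fun n => \int[mu]_z (phi_ n z)%:E))%E.
  rewrite -monotone_convergence//.
  - by apply: eq_integral => z _; apply/esym/cvg_lim => //; exact: cv.
  - by move=> n; apply/measurable_EFinP.
  - by move=> n z _; rewrite lee_fin.
  - by move=> z _ m n mn; rewrite lee_fin; exact/lefP/nd_nnsfun_approx.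
under eq_fun do rewrite E.
have nd z : {homo (fun n => (phi_ n z)%:E * (rho z)%:E)%E : m n / (m <= n)%N >-> (m <= n)%E}.
  move=> m n mn; rewrite lee_wpmul2r ?lee_fin//; exact/lefP/nd_nnsfun_approx.
have mphin n : measurable_fun [set: Bd R d] (fun z => (phi_ n z)%:E * (rho z)%:E)%E.
  by apply: emeasurable_funM => //; apply/measurable_EFinP.
apply/cvg_lim => //; apply: cvgeZl => //.
rewrite (_ : (\int[leb R d]_z (phi z * (rho z)%:E))%E =
    (\int[leb R d]_z limn (fun n => (phi_ n z)%:E * (rho z)%:E))%E).
  apply: cvg_monotone_convergence => // n z _.
  by rewrite mule_ge0 ?lee_fin.
apply: eq_integral => z _; apply/esym/cvg_lim => //.
by apply: cvgeZr => //; exact: cv.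
Qed.

Lemma integral_density (phi : Bd R d -> R) : measurable_fun setT phi ->
  (leb R d).-integrable setT (fun z => (phi z * rho z)%:E) ->
  (\int[mu]_z (phi z)%:E = lam^-1%:E * \int[leb R d]_z (phi z * rho z)%:E)%E.
Proof.
move=> mphi ip; have mE : measurable_fun setT (fun z => (phi z)%:E) by exact/measurable_EFinP.
rewrite [LHS]integralE [in RHS]integralE.
rewrite !ge0_integral_density//; [|exact: measurable_funeneg|exact: measurable_funepos].
have E1 z : ((fun z => (phi z)%:E)^\+ z * (rho z)%:E)%E = (fun z => (phi z * rho z)%:E)^\+%E z.
  by rewrite !funeposE maxe_pMl ?lee_fin// mul0e EFinM.
have E2 z : ((fun z => (phi z)%:E)^\- z * (rho z)%:E)%E = (fun z => (phi z * rho z)%:E)^\-%E z.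
  by rewrite !funenegE maxe_pMl ?lee_fin// mul0e mulNe -EFinM.
transitivity (lam^-1%:E * \int[leb R d]_z (fun z => (phi z * rho z)%:E)^\+%E z -
    lam^-1%:E * \int[leb R d]_z (fun z => (phi z * rho z)%:E)^\-%E z)%E.
  by congr (_ * _ - _ * _)%E; apply: eq_integral => z _; [exact: E1|exact: E2].
apply/esym; apply: muleBr => //; apply: fin_num_adde_defr.
by apply: integrable_fin_num => //; exact: integrable_funepos.
Qed.

(** A zero of [rho] is a minimum. Moving a short way along [- g] would decrease [rho] below 0 unless
    the length of [g] is at most [e], for every [e > 0]. *)
Lemma grad_eq0 z : rho z = 0 -> grad rho z = 0.
Proof.
move=> z0; apply: eucl_eq0; apply/eqP; rewrite eq_le eucl_ge0 andbT.
apply/ler_addgt0Pr => e e0; rewrite add0r.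
have [del del0 H] := differentiable_estimate drho z e0.
set g := grad rho z in H *.
have g1 : 0 < eucl g + 1 by rewrite ltr_wpDl// eucl_ge0.
pose s := del / 2 / (eucl g + 1).
have s0 : 0 < s by rewrite !divr_gt0.
have := H (- s *: g); rewrite euclZ normrN (gtr0_norm s0) => /(_ _)/wrap[].
  apply: (@le_lt_trans _ _ (del / 2)); last by rewrite ltr_pdivrMr// ltr_pMr// ltr1n.
  by rewrite /s mulrAC ler_pdivrMr// ler_wpM2l ?lerDl// divr_ge0// ltW.
rewrite z0 subr0 innerZr -sqr_eucl mulNr opprK => /(le_trans (ler_norm _)) H1.
have : s * eucl g ^+ 2 <= e * (s * eucl g).
  by apply: le_trans H1; rewrite lerDr.
have [->|gn0] := eqVneq (eucl g) 0; first by move=> _; exact: ltW.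
have gp : 0 < eucl g by rewrite lt_def gn0 eucl_ge0.
by rewrite [leRHS]mulrCA ler_pM2l// expr2 ler_pM2r.
Qed.

(* The gradient of [ln \o rho] where [rho > 0], and [0] elsewhere (as [0^-1 = 0]);
   unlike [grad (ln \o rho)] it is Borel. *)
Definition score z : 'cV[R]_d := (rho z)^-1 *: grad rho z.

Lemma score_rho z : rho z *: score z = grad rho z.
Proof.
rewrite /score scalerA; have [r0|r0] := eqVneq (rho z) 0.
  by rewrite grad_eq0// scaler0.
by rewrite mulfV// scale1r.
Qed.

Lemma measurable_score : measurable_fun [set: Bd R d] (score : _ -> Bd R d).
Proof.
apply: measurable_fun_coordP => i.
rewrite (_ : (fun t => _) = fun z => (rho z)^-1 * grad rho z i ord0).
  apply: measurable_funM; last exact: measurable_grad.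
  (* The power [-1] agrees with the inverse at 0 as well, where both are 0. *)
  rewrite (_ : (fun z => (rho z)^-1) = fun z => rho z `^ (-1)).
    exact: (measurableT_comp (@measurable_powR R (-1)) mrho).
  by apply/funext => z; rewrite powR_inv1.
by apply/funext => z; rewrite !mxE.
Qed.

Lemma grad_ln_rho z : 0 < rho z -> grad (fun z => ln (rho z)) z = score z.
Proof.
move=> r0; have dln : differentiable (@ln R) (rho z).
  by apply/derivable1_diffP; case: (is_derive1_ln r0).
apply: grad_inner; first exact: (differentiable_comp (drho z) dln).
move=> h; rewrite (diff_comp (drho z) dln) /= diff_grad//.
rewrite deriv1E; last by case: (is_derive1_ln r0).
rewrite derive1E; have -> : 'D_1 (@ln R) (rho z) = (rho z)^-1 by case: (is_derive1_ln r0).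
by rewrite /score innerZl mulrC.
Qed.

Hypothesis rho_int : intRd (fun z => (rho z)%:E) = lam%:E.
Variable eps : R.
Hypothesis eps_gt0 : 0 < eps.
Hypothesis supfin : (\int[leb R d]_z gradsup rho eps z < +oo)%E.

Lemma rho_integrable : (leb R d).-integrable setT (fun z => (rho z)%:E).
Proof.
apply/integrableP; split; first exact/measurable_EFinP.
rewrite (eq_integral (fun z : Bd R d => (rho z)%:E)); last by move=> z _ /=; rewrite ger0_norm.
rewrite integral_leb ?rho_int ?ltry//; exact/measurable_EFinP.
Qed.

Lemma grad_integrable : (leb R d).-integrable setT (fun z => (eucl (grad rho z))%:E).
Proof.
apply/integrableP; split; first by apply/measurable_EFinP; exact: measurable_eucl_grad.
apply: le_lt_trans supfin; apply: ge0_le_integral => //.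
- by apply: measurableT_comp => //; apply/measurable_EFinP; exact: measurable_eucl_grad.
- exact: measurable_gradsup.
- move=> z _; rewrite gee0_abs ?lee_fin ?eucl_ge0//.
  by apply: ereal_sup_ubound; exists z => //=; rewrite subrr eucl0.
Qed.

Lemma measurable_eucl_score : measurable_fun [set: Bd R d] (fun z => eucl (score z)).
Proof.
exact: (measurableT_comp (continuous_measurable_Bd (@continuous_eucl R d)) measurable_score).
Qed.

Lemma eucl_score_rho z : eucl (score z) * rho z = eucl (grad rho z).
Proof. by rewrite mulrC -[rho z]ger0_norm// -euclZ score_rho. Qed.

Lemma integral_score : (\int[mu]_z (eucl (score z))%:E =
  lam^-1%:E * intRd (fun z => (eucl (grad rho z))%:E))%E.
Proof.
rewrite ge0_integral_density//; last 2 first.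
- by apply/measurable_EFinP; exact: measurable_eucl_score.
- by move=> z; rewrite lee_fin eucl_ge0.
rewrite -integral_leb; last 2 first.
- by apply/measurable_EFinP; exact: measurable_eucl_grad.
- by move=> z; rewrite lee_fin eucl_ge0.
by congr (_ * _)%E; apply: eq_integral => z _; rewrite -EFinM eucl_score_rho.
Qed.

Lemma integral_score_fin : (\int[mu]_z (eucl (score z))%:E < +oo)%E.
Proof.
rewrite ge0_integral_density//; last 2 first.
- by apply/measurable_EFinP; exact: measurable_eucl_score.
- by move=> z; rewrite lee_fin eucl_ge0.
under eq_integral do rewrite -EFinM eucl_score_rho.
rewrite lte_mul_pinfty ?lee_fin//.
have /integrableP[_] := grad_integrable; apply: le_lt_trans; apply: ge0_le_integral => //.
- by move=> z _; rewrite lee_fin eucl_ge0.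
- by apply/measurable_EFinP; exact: measurable_eucl_grad.
- by apply: measurableT_comp => //; apply/measurable_EFinP; exact: measurable_eucl_grad.
- by move=> z _; rewrite lee_abs.
Qed.

Lemma bounded_mul_integrable (phi psi : Bd R d -> R) (K : R) :
  measurable_fun setT phi -> measurable_fun setT psi -> (forall z, `|phi z| <= K) ->
  (leb R d).-integrable setT (fun z => (psi z)%:E) ->
  (leb R d).-integrable setT (fun z => (phi z * psi z)%:E).
Proof.
move=> mphi mpsi phiK ipsi.
have K0 : 0 <= K := le_trans (normr_ge0 _) (phiK 0).
apply: (le_integrable measurableT _ _ (integrableZl measurableT K (integrable_abse ipsi))).
  by apply/measurable_EFinP; exact: measurable_funM.
move=> z _ /=; rewrite lee_fin normrM normrM normr_id (ger0_norm K0).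
by rewrite ler_wpM2r.
Qed.

(** Integration by parts without differentiating [phi]: translating by [m] in the first term alone
    leaves [phi (z + k)] as a common factor, multiplied by the Taylor remainder of the density. *)
Lemma score_increment (phi : Bd R d -> R) (K : R) (k m : 'cV[R]_d) :
  measurable_fun setT phi -> (forall z, `|phi z| <= K) ->
  (`|\int[mu]_z (phi ((z : 'cV[R]_d) + k + m) - phi ((z : 'cV[R]_d) + k) +
       phi ((z : 'cV[R]_d) + k) * inner (score z) m)%:E| <=
   (lam^-1 * K)%:E * \int[leb R d]_z (taylor_rem rho m z)%:E)%E.
Proof.
move=> mphi phiK.
have K0 : 0 <= K := le_trans (normr_ge0 _) (phiK 0).
have mk : measurable_fun setT (fun z : Bd R d => phi ((z : 'cV[R]_d) + k)).
  exact: (measurableT_comp mphi (measurable_addv k)).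
have mkm : measurable_fun setT (fun z : Bd R d => phi ((z : 'cV[R]_d) + k + m)).
  exact: (measurableT_comp mphi (measurableT_comp (measurable_addv m) (measurable_addv k))).
have mg : measurable_fun setT (fun z : Bd R d => inner (grad rho z) m).
  exact: measurable_inner_grad.
have msc : measurable_fun setT (fun z : Bd R d => inner (score z) m).
  apply: measurable_sum => i; apply: measurable_funM => //.
  exact: (measurableT_comp (@measurable_coord R d i) measurable_score).
have ig : (leb R d).-integrable setT (fun z => (inner (grad rho z) m)%:E).
  apply: (le_integrable measurableT _ _ (integrableZl measurableT (eucl m) grad_integrable)).
    exact/measurable_EFinP.
  move=> z _ /=; rewrite lee_fin (le_trans (inner_le _ _))// normrM mulrC.
  by rewrite !ger0_norm// eucl_ge0.
have ia := bounded_mul_integrable mkm mrho (fun z => phiK _) rho_integrable.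
(* The two terms that stay in place, with the score already multiplied out to the gradient; only the
   other term is translated. *)
pose b (z : Bd R d) := phi ((z : 'cV[R]_d) + k) * (inner (grad rho z) m - rho z).
have ib : (leb R d).-integrable setT (fun z => (b z)%:E).
  apply: (bounded_mul_integrable mk _ (fun z => phiK _)).
    by apply: measurable_funB.
  exact: (integrableB measurableT ig rho_integrable).
rewrite integral_density; last 2 first.
- apply: measurable_funD; first exact: measurable_funB.
  exact: measurable_funM.
- rewrite (_ : (fun z => _) = (fun z : Bd R d => (phi ((z : 'cV[R]_d) + k + m) * rho z)%:E) \+
      (fun z => (b z)%:E))%E; first exact: (integrableD measurableT ia ib).
  apply/funext => z; rewrite /= -EFinD /b -score_rho innerZl; congr EFin; ring.
rewrite (_ : (\int[leb R d]_z _ = \int[leb R d]_z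
     ((phi ((z : 'cV[R]_d) + k + m) * rho z)%:E + (b z)%:E))%E); last first.
  apply: eq_integral => z _; rewrite -EFinD /b -score_rho innerZl; congr EFin; ring.
rewrite (integralD measurableT ia ib).
pose a' (z : Bd R d) := phi ((z : 'cV[R]_d) + k) * rho ((z : 'cV[R]_d) - m).
have mrm : measurable_fun setT (fun z : Bd R d => rho ((z : 'cV[R]_d) - m)).
  exact: (measurableT_comp mrho (measurable_addv (- m))).
have ma' : measurable_fun setT (fun z => (a' z)%:E).
  by apply/measurable_EFinP; apply: measurable_funM.
have a'E : (\int[leb R d]_z (phi ((z : 'cV[R]_d) + k + m) * rho z)%:E =
    \int[leb R d]_z (a' z)%:E)%E.
  rewrite -(integral_leb_shift m ma'); apply: eq_integral => z _.
  by rewrite /a' addrK addrAC.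
have irm : (leb R d).-integrable setT (fun z : Bd R d => (rho ((z : 'cV[R]_d) - m))%:E).
  apply/integrableP; split; first exact/measurable_EFinP.
  have /integrableP[_] := rho_integrable.
  rewrite -(integral_leb_shift (- m)) //.
  by apply: measurableT_comp => //; exact/measurable_EFinP.
have ia' : (leb R d).-integrable setT (fun z => (a' z)%:E).
  exact: (bounded_mul_integrable mk mrm (fun z => phiK _) irm).
rewrite a'E -(integralD measurableT ia' ib) abseM gee0_abs ?lee_fin// EFinM -muleA.
rewrite lee_wpmul2l ?lee_fin//.
apply: (le_trans (le_abse_integral _ measurableT _)).
  exact: (measurable_int _ (integrableD measurableT ia' ib)).
rewrite -ge0_integralZl_EFin//; last 2 first.
- by move=> z _; rewrite lee_fin normr_ge0.
- by apply/measurable_EFinP; exact: measurable_taylor_rem.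
apply: ge0_le_integral => //.
- apply: measurableT_comp => //.
  exact: (measurable_int _ (integrableD measurableT ia' ib)).
- apply/measurable_EFinP; apply: measurable_funM => //; exact: measurable_taylor_rem.
move=> z _; rewrite -EFinD -EFinM lee_fin /a' /b /taylor_rem -mulrDr normrM.
rewrite [inner _ _ - _]addrC addrA.
by rewrite ler_wpM2r.
Qed.

End density.

Lemma eucl_sum (R : realType) d (I : Type) (r : seq I) (F : I -> 'cV[R]_d) :
  eucl (\sum_(i <- r) F i) <= \sum_(i <- r) eucl (F i).
Proof.
elim: r => [|a r IH]; first by rewrite !big_nil eucl0.
by rewrite !big_cons (le_trans (eucl_triangle _ _))// lerD2l.
Qed.

(** * From a bound on each level set of a counting variable to a global bound *)

Section countable_partition.
Context (R : realType) d0 (Omega : measurableType d0) (P : probability Omega R).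
Variables (M : Omega -> nat) (D : Omega -> R) (c : R).
Hypothesis mM : measurable_fun setT M.
Hypothesis intD : P.-integrable setT (EFin \o D).
Hypothesis c0 : 0 <= c.
Hypothesis Dc : forall n, (`|\int[P]_(w in M @^-1` [set n]) (D w)%:E| <=
  c%:E * P (M @^-1` [set n]))%E.

Let mpre (B : set nat) : measurable (M @^-1` B).
Proof. by rewrite -[M @^-1` B]setTI; apply: (mM measurableT (Y := B)). Qed.

Let lower m : set Omega := M @^-1` [set n | (n < m)%N].

Let lowerS m : lower m.+1 = lower m `|` M @^-1` [set m].
Proof.
apply/seteqP; split => w; rewrite /lower/= ltnS.
  by rewrite leq_eqVlt => /orP[/eqP|]; [right|left].
by case=> [/ltnW|->].
Qed.

Let lower_disj m : [disjoint lower m & M @^-1` [set m]]%classic.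
Proof.
apply/disj_set2P/seteqP; split => // w [/= + Mw].
by rewrite /lower/= Mw ltnn.
Qed.

Let lower_bound m : (`|\int[P]_(w in lower m) (D w)%:E| <= c%:E * P (lower m))%E.
Proof.
elim: m => [|m IH].
  rewrite (_ : lower 0 = set0); last by apply/seteqP; split.
  by rewrite integral_set0 measure0 mule0 abse0.
have mlow := mpre [set n | (n < m)%N]; have mM1 := mpre [set m].
rewrite lowerS integral_setU//; last first.
  by apply: measurable_funTS; exact: measurable_int intD.
rewrite measureU//; last by apply/disj_set2P.
rewrite ge0_muleDr//; apply: (le_trans (lee_abs_add _ _)).
by apply: leeD.
Qed.

(** Finite unions of level sets satisfy the bound by the triangle inequality; the limit is taken by
    dominated convergence because [D] has no sign. *)
Lemma integral_partition_bound : (`|\int[P]_w (D w)%:E| <= c%:E)%E.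
Proof.
have mD : measurable_fun setT (EFin \o D) := measurable_int _ intD.
pose D_ m w := ((EFin \o D) \_ (lower m)) w.
have cvgD w : D_ ^~ w @ \oo --> (EFin \o D) w.
  apply: cvg_near_cst; near=> m; rewrite /D_ patchE mem_set//.
  by rewrite /lower/=; near: m; exact: nbhs_infty_gt.
have mD_ m : measurable_fun setT (D_ m).
  by apply/(measurable_restrictT _ (mpre _)); exact: measurable_funTS.
have lim_int : (fun n => \int[P]_w D_ n w)%E @ \oo --> (\int[P]_w (D w)%:E)%E.
  have [] // := dominated_convergence measurableT mD_ mD _ (integrable_abse intD).
  - by apply/nearW => w _; exact: cvgD.
  - apply/nearW => w m _; rewrite /D_ patchE /=; case: ifPn => // _.
    by rewrite abse0.
have bnd m : (`|\int[P]_w D_ m w| <= c%:E)%E.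
  rewrite /D_ -integral_mkcond (le_trans (lower_bound m))//.
  by rewrite -[leRHS]mule1 lee_wpmul2l ?lee_fin// probability_le1//; exact: mpre.
have lim_abs := cvg_abse lim_int (FF := eventually_filter).
by rewrite -(cvg_lim _ lim_abs)//; apply: lime_le; [apply/cvg_ex; eexists; exact: lim_abs|exact: nearW].
Unshelve. all: by end_near. Qed.
End countable_partition.

(** * Perturbing the initial point *)

Lemma measurable_mulmxv d1 (T : measurableType d1) (R : realType) (d : nat)
    (F : T -> 'M[R]_d) (v : T -> 'cV[R]_d) :
  (forall a b, measurable_fun setT (fun t => F t a b)) ->
  measurable_fun setT (v : T -> Bd R d) ->
  measurable_fun setT (fun t => F t *m v t : Bd R d).
Proof.
move=> mF mv; apply: measurable_fun_coordP => i.
rewrite (_ : (fun t => _) = fun t => \sum_j F t i j * v t j ord0).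
  apply: measurable_sum => j; apply: measurable_funM => //.
  exact: (measurableT_comp (@measurable_coord R d j) mv).
by apply/funext => t; rewrite mxE.
Qed.

Lemma measurable_addv2 d1 (T : measurableType d1) (R : realType) (d : nat)
    (u v : T -> 'cV[R]_d) :
  measurable_fun setT (u : T -> Bd R d) -> measurable_fun setT (v : T -> Bd R d) ->
  measurable_fun setT (fun t => u t + v t : Bd R d).
Proof.
move=> mu mv; apply: measurable_fun_coordP => i.
rewrite (_ : (fun t => _) = fun t => u t i ord0 + v t i ord0).
  by apply: measurable_funD; [exact: (measurableT_comp (@measurable_coord R d i) mu)
    |exact: (measurableT_comp (@measurable_coord R d i) mv)].
by apply/funext => t; rewrite !mxE.
Qed.

Lemma measurable_expm_comp d1 (T : measurableType d1) (R : realType) (d : nat)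
    (A : 'M[R]_d) (u : T -> R) a b : measurable_fun setT u ->
  measurable_fun setT (fun t => expm (u t *: A) a b).
Proof.
move=> mu; have mE : measurable_fun [set: R] (fun s : R => expm (s *: A) a b).
  by apply: continuous_measurable_fun; exact: continuous_expm.
exact: (measurableT_comp mE mu).
Qed.

Lemma inner_trmx (R : realType) d (M : 'M[R]_d) u v : inner (M^T *m u) v = inner u (M *m v).
Proof.
rewrite /inner; under eq_bigr do rewrite mxE mulr_suml.
rewrite exchange_big/=; apply: eq_bigr => j _; rewrite mxE mulr_sumr.
by apply: eq_bigr => i _; rewrite mxE; ring.
Qed.

Section main_estimate.
Context (R : realType) (d : nat) (d0 : measure_display) (Omega : measurableType d0).
Variables (P : probability Omega R) (A : 'M[R]_d) (rho : 'cV[R]_d -> R) (lam eps : R).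
Variables (N : R -> Omega -> nat) (tau : nat -> Omega -> R).
Variables (xi : nat -> Omega -> 'cV[R]_d) (L1 : R -> Omega -> 'cV[R]_d).
Hypothesis rho_ge0 : forall z, 0 <= rho z.
Hypothesis drho : forall z, differentiable rho z.
Hypothesis rho_int : intRd (fun z => (rho z)%:E) = lam%:E.
Hypothesis lam_gt0 : 0 < lam.
Hypothesis eps_gt0 : 0 < eps.
Hypothesis supfin : (\int[leb R d]_z gradsup rho eps z < +oo)%E.
Hypothesis tau1 : forall w, 0 < tau 1 w.
Hypothesis tauS : forall w k, (0 < k)%N -> tau k w < tau k.+1 w.
Hypothesis NtauP : forall t w k, (0 < k)%N -> ((k <= N t w)%N <-> tau k w <= t).
Hypothesis mxi : forall i, rvec_meas (xi i.+1).
Hypothesis lawxi : forall i B, borelRd B ->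
  P (xi i.+1 @^-1` B) = ((lam^-1)%:E * nu0 rho B)%E.
Hypothesis Lr : forall w t, 0 <= t -> (fun s => L1 s w) @ at_right t --> L1 t w.
Hypothesis Ll : forall w t, 0 < t -> cvg ((fun s => L1 s w) @ at_left t).
Hypothesis Pi_sub : forall n i, <<s indepPi N xi L1 n i >> `<=` (@measurable _ Omega).
Hypothesis Pi_indep : forall n i E D, (i < n)%N -> <<s indepPi N xi L1 n i >> E -> borelRd D ->
  P (E `&` xi i.+1 @^-1` D) = (P E * P (xi i.+1 @^-1` D))%E.

(** * One jump index on the event [N_t = n] *)

Section fixed_jump.
Variables (n i : nat).
Hypothesis ilt : (i < n)%N.
Let OG := g_sigma_algebraType (indepPi N xi L1 n i).

Let other_setT : other_jumps xi n i (fun=> setT) = setT.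
Proof. by apply/seteqP; split. Qed.

Let sL1T : sig_proc L1 setT.
Proof. exact: (@measurableT _ (g_sigma_algebraType (\bigcup_(t in [set t : R | 0 <= t]) sig_rv (L1 t)))). Qed.

Let sNT : <<s \bigcup_(t in [set t : R | 0 <= t]) sig_nat (N t) >> setT.
Proof. exact: (@measurableT _ (g_sigma_algebraType (\bigcup_(t in [set t : R | 0 <= t]) sig_nat (N t)))). Qed.

Lemma sub_Pi_L1 E : sig_proc L1 E -> indepPi N xi L1 n i E.
Proof.
move=> sE; exists E, setT, (fun=> setT); split => //.
  by move=> j; exact: (@measurableT _ (Bd R d)).
by rewrite other_setT !setIT.
Qed.

Lemma sub_Pi_N E : <<s \bigcup_(t in [set t : R | 0 <= t]) sig_nat (N t) >> E ->
  indepPi N xi L1 n i E.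
Proof.
move=> sE; exists setT, E, (fun=> setT); split => //.
  by move=> j; exact: (@measurableT _ (Bd R d)).
by rewrite other_setT setTI setIT.
Qed.

Lemma Pi_measurable_N t : 0 <= t -> measurable_fun [set: OG] (N t).
Proof.
move=> t0 _ B mB; rewrite setTI; apply: sub_sigma_algebra; apply: sub_Pi_N.
by apply: sub_sigma_algebra; exists t => //; exists B.
Qed.

(** Jump times are functions of the counts: [tau k.+1] exceeds [s] exactly when [N s] is at most
    [k]. *)
Lemma Pi_measurable_tau k : measurable_fun [set: OG] (tau k.+1).
Proof.
apply: (measurability _ (RGenOInfty.measurableE R)) => //.
move=> _ [_ [s ->] <-]; rewrite setTI.
have [s0|s0] := leP 0 s.
  rewrite (_ : _ @^-1` _ = N s @^-1` [set m | (m < k.+1)%N]).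
    by rewrite -[X in measurable X]setTI; exact: (Pi_measurable_N s0).
  by apply/seteqP; split => w /=; rewrite in_itv/= andbT (N_lt NtauP).
rewrite (_ : _ @^-1` _ = setT)//; apply/seteqP; split => // w _ /=.
rewrite in_itv/= andbT (lt_le_trans s0)//.
exact: (tau0_ge0 tau1 tauS k.+1 w).
Qed.

Lemma Pi_measurable_xi j : (j < n)%N -> j != i ->
  measurable_fun [set: OG] (xi j.+1 : _ -> Bd R d).
Proof.
move=> jn ji _ B mB; rewrite setTI; apply: sub_sigma_algebra.
exists setT, setT, (fun k => if k == j then B else setT); split => //.
  by move=> k; case: ifP => // _; exact: (@measurableT _ (Bd R d)).
rewrite setTI setTI; apply/seteqP; split => [w Bw k kn ki|w H].
  by case: eqP => // ->.
by have := H j jn ji; rewrite eqxx.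
Qed.

Variables (t : R) (f : 'cV[R]_d -> R) (K : R).
Hypothesis t_gt0 : 0 < t.
Hypothesis mf : measurable_fun [set: Bd R d] f.
Hypothesis fK : forall x, `|f x| <= K.
Let t0 : 0 <= t := ltW t_gt0.

Definition other_part (w : Omega) : 'cV[R]_d := levy_part L1 A t w +
  \sum_(0 <= j < n | j != i) expm ((t - tau j.+1 w) *: A) *m xi j.+1 w.

Lemma Pi_measurable_other_part : measurable_fun [set: OG] (other_part : _ -> Bd R d).
Proof.
apply: measurable_addv2.
  move=> _ B mB; rewrite setTI; apply: sub_sigma_algebra; apply: sub_Pi_L1.
  have := measurable_levy_part Lr A t0.
  by move=> /(_ measurableT B mB); rewrite setTI.
pose v j w : 'cV[R]_d := if ((j < n)%N && (j != i)) then expm ((t - tau j.+1 w) *: A) *m xi j.+1 w else 0.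
rewrite (_ : (fun w => _) = fun w => \sum_(0 <= j < n) v j w).
  apply: measurable_sumv => j; rewrite /v; case: (boolP ((j < n)%N && (j != i))) => [/andP[jn ji]|_].
    apply: measurable_mulmxv; last exact: Pi_measurable_xi.
    move=> a b; apply: measurable_expm_comp; apply: measurable_funB => //.
    exact: Pi_measurable_tau.
  by apply: measurable_fun_coordP => k; exact: measurable_cst.
apply/funext => w; rewrite big_mkcond; apply: eq_big_nat => j /andP[_ jn].
by rewrite /v jn.
Qed.

(** The semigroup law at time [tau i.+1] carries the initial point to the moment of the jump, where
    it is added to the jump. *)
Lemma OU_jump x w : N t w = n ->
  OU A (fun t w => L1 t w + cpoisson N xi t w) t x w =
  other_part w + expm ((t - tau i.+1 w) *: A) *m
    (xi i.+1 w + expm (tau i.+1 w *: A) *m x).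
Proof.
move=> Nn; rewrite (OU_decomp xi tau1 tauS NtauP Lr Ll) Nn /other_part.
rewrite mulmxDr mulmxA expmBM (bigD1_seq i) ?mem_index_iota ?iota_uniq//=.
move: (levy_part L1 A t w) (bigop _ _ _) (expm (t *: A) *m x) (_ *m xi i.+1 w).
by move=> Z S e T; rewrite addrACA addrC [e + T]addrC.
Qed.

Let mu := pushforward P (xi i.+1 : Omega -> Bd R d).
Let mx : measurable_fun setT (xi i.+1 : _ -> Bd R d) := rvec_measP (mxi i).
Let C := expR (mxsum A * t).
Let Nn : set Omega := [set w | N t w = n].
Let g := score rho.

Let integrand (x h : 'cV[R]_d) (w : OG) (z : 'cV[R]_d) : R :=
  let F y := f (other_part w + expm ((t - tau i.+1 w) *: A) *m
               (z + expm (tau i.+1 w *: A) *m y)) in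
  F (x + h) - F x + F x * inner (g z) (expm (tau i.+1 w *: A) *m h).

(** The variable [z] stands where [xi i.+1] will be inserted. The indicator is part of the function
    because only on that event does [other_part] complete the solution and is [tau i.+1] known to be
    at most [t]. *)
Definition jump_increment (x h : 'cV[R]_d) (p : OG * Bd R d) : R :=
  \1_Nn p.1 * integrand x h p.1 p.2.

Let sNn : <<s indepPi N xi L1 n i >> Nn.
Proof.
apply: sub_sigma_algebra; apply: sub_Pi_N; apply: sub_sigma_algebra.
by exists t => //; exists [set n].
Qed.

Let mM a b : measurable_fun [set: (OG * Bd R d)%type] (fun p => expm (tau i.+1 p.1 *: A) a b).
Proof.
apply: measurable_expm_comp.
exact: (measurableT_comp (Pi_measurable_tau i) measurable_fst).
Qed.

Let mF y : measurable_fun [set: (OG * Bd R d)%type] (fun p =>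
  f (other_part p.1 + expm ((t - tau i.+1 p.1) *: A) *m
               ((p.2 : 'cV[R]_d) + expm (tau i.+1 p.1 *: A) *m y))).
Proof.
apply: (measurableT_comp mf); apply: measurable_addv2.
  exact: (measurableT_comp Pi_measurable_other_part measurable_fst).
apply: measurable_mulmxv.
  move=> a b; apply: measurable_expm_comp; apply: measurable_funB => //.
  exact: (measurableT_comp (Pi_measurable_tau i) measurable_fst).
apply: measurable_addv2; first exact: measurable_snd.
by apply: measurable_mulmxv => //; exact: measurable_cst.
Qed.

Lemma measurable_jump_increment x h : measurable_fun setT (jump_increment x h).
Proof.
have mg : measurable_fun [set: (OG * Bd R d)%type] (fun p => g p.2 : Bd R d).
  exact: (measurableT_comp (measurable_score rho_ge0 drho) measurable_snd).
apply: measurable_funM.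
  have mN : (measurable : set (set OG)) Nn by exact: sNn.
  exact: (measurableT_comp (measurable_indic mN) measurable_fst).
apply: measurable_funD; first by apply: measurable_funB; exact: mF.
apply: measurable_funM; first exact: mF.
apply: measurable_sum => k; apply: measurable_funM.
  exact: (measurableT_comp (@measurable_coord R d k) mg).
apply: (measurableT_comp (@measurable_coord R d k)).
by apply: measurable_mulmxv => //; exact: measurable_cst.
Qed.

Lemma tau_bound w : N t w = n -> 0 <= tau i.+1 w <= t.
Proof.
move=> Nw; rewrite (tau0_ge0 tau1 tauS i.+1 w)/=.
by apply/(NtauP t w (ltn0Sn i)); rewrite Nw.
Qed.

Lemma expm_tau_le w v : N t w = n -> eucl (expm (tau i.+1 w *: A) *m v) <= C * eucl v.
Proof.
move=> /tau_bound/andP[tau_ge tau_le]; apply: (le_trans (expm_le _ _ tau_ge)).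
by rewrite ler_wpM2r ?eucl_ge0// ler_expR ler_wpM2l ?mxsum_ge0.
Qed.

Let K0 : 0 <= K := le_trans (normr_ge0 _) (fK 0).

(** The dominating function must not depend on [w]; it is integrable because the score has mean
    [lam^-1] times the integral of [eucl (grad rho)]. *)
Definition increment_bound (h z : 'cV[R]_d) : R :=
  2 * K + K * (C * eucl h) * eucl (g z).

Lemma jump_increment_le x h (w : OG) z :
  `|jump_increment x h (w, z)| <= increment_bound h z.
Proof.
rewrite /jump_increment/= indicE; have [|_] := boolP (w \in Nn); last first.
  rewrite mul0r normr0 /increment_bound addr_ge0 ?mulr_ge0 ?expR_ge0 ?eucl_ge0//.
rewrite inE => Nw; rewrite mul1r (le_trans (ler_normD _ _))// lerD//.
  by rewrite (le_trans (ler_normB _ _))// mulr_natl mulr2n lerD.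
rewrite normrM -mulrA ler_pM// (le_trans (inner_le _ _))// mulrC.
by rewrite ler_wpM2r ?eucl_ge0// expm_tau_le.
Qed.

Let muE B : borelRd B -> mu B = ((lam^-1)%:E * nu0 rho B)%E.
Proof. exact: lawxi. Qed.

Let mu' : {measure set (Bd R d) -> \bar R} :=
  measure_function_pushforward__canonical__measure_function_Measure P mx.

Lemma measurable_increment_bound h : measurable_fun [set: Bd R d] (increment_bound h).
Proof.
apply: measurable_funD => //; apply: measurable_funM => //.
exact: (measurable_eucl_score rho_ge0 drho).
Qed.

Lemma increment_bound_fin h : (\int[mu]_z (increment_bound h z)%:E < +oo)%E.
Proof.
have sfin := @integral_score_fin R d rho lam mu' rho_ge0 drho lam_gt0 muE eps eps_gt0 supfin.
have c0 : 0 <= K * (C * eucl h) by rewrite !mulr_ge0 ?expR_ge0 ?eucl_ge0.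
have mes := measurable_eucl_score rho_ge0 drho.
rewrite -[mu]/(mu' : set _ -> _).
under eq_integral do rewrite EFinD.
rewrite ge0_integralD//; last 3 first.
- by move=> z _; rewrite lee_fin mulr_ge0.
- by move=> z _; rewrite lee_fin mulr_ge0 ?eucl_ge0.
- by apply/measurable_EFinP; apply: measurable_funM.
under [X in (_ + X < _)%E]eq_integral do rewrite EFinM.
rewrite ge0_integralZl_EFin//; last 2 first.
- by move=> z _; rewrite lee_fin eucl_ge0.
- exact/measurable_EFinP.
rewrite lte_add_pinfty//; last by rewrite lte_mul_pinfty.
rewrite integral_cst// lte_mul_pinfty ?lee_fin ?mulr_ge0//.
by rewrite /= /pushforward preimage_setT probability_setT ltry.
Qed.

Lemma jump_increment_integrable x h :
  P.-integrable setT (fun w => (jump_increment x h (w, xi i.+1 w))%:E).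
Proof.
apply: (indep_integrable mx (Pi_sub (i := i)) (measurable_jump_increment x h)
  (measurable_increment_bound h) (jump_increment_le x h) (increment_bound_fin h)).
Qed.

Lemma jump_increment_bound x h (e del : R) : 0 < e ->
  (forall k, eucl k < del -> (\int[leb R d]_z (taylor_rem rho k z)%:E <= (e * eucl k)%:E)%E) ->
  C * eucl h < del ->
  (`|\int[P]_w (jump_increment x h (w, xi i.+1 w))%:E| <=
   (lam^-1 * K * (e * (C * eucl h)))%:E * P Nn)%E.
Proof.
move=> e0 Hrem hdel.
have C0 : 0 <= C by exact: expR_ge0.
have indep E B : <<s indepPi N xi L1 n i >> E -> (measurable : set (set (Bd R d))) B ->
  P (E `&` xi i.+1 @^-1` B) = (P E * P (xi i.+1 @^-1` B))%E.
  by move=> sE mB; exact: (Pi_indep ilt sE mB).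
apply: (indep_bound mx (Pi_sub (i := i)) indep (measurable_jump_increment x h)
  (measurable_increment_bound h) (jump_increment_le x h) (increment_bound_fin h) sNn).
  by rewrite !mulr_ge0 ?eucl_ge0 ?invr_ge0 ?(ltW e0) ?(ltW lam_gt0).
move=> w; rewrite /jump_increment/= indicE.
have [|_] := boolP (w \in Nn); last first.
  rewrite mulr0 [X in (`|X| <= _)%E](_ : _ = 0%E) ?abse0//.
  by apply: (@integral0_eq _ _ R mu') => z _; rewrite mul0r.
rewrite inE => Nw; rewrite mulr1.
set T := tau i.+1 w.
pose phi (z : Bd R d) := f (other_part w + expm ((t - T) *: A) *m (z : 'cV[R]_d)).
have mphi : measurable_fun setT phi.
  apply: (measurableT_comp mf); apply: measurable_addv2; first exact: measurable_cst.
  by apply: measurable_mulmxv; [move=> a b; exact: measurable_cst|exact: measurable_id].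
(* For frozen [w] the initial displacement [h] becomes the translation [m] of the jump, of length at
   most [C * eucl h]. *)
pose k := expm (T *: A) *m x; pose m := expm (T *: A) *m h.
have mdel : eucl m <= C * eucl h := expm_tau_le h Nw.
have H := @score_increment R d rho lam mu' rho_ge0 drho lam_gt0 muE rho_int eps eps_gt0 supfin
  phi K k m mphi (fun z => fK _).
rewrite [X in (`|X| <= _)%E](_ : _ = \int[mu']_z (phi ((z : 'cV[R]_d) + k + m) - phi ((z : 'cV[R]_d) + k) +
       phi ((z : 'cV[R]_d) + k) * inner (score rho z) m)%:E)%E; last first.
  apply: (@eq_integral _ _ R mu') => z _; rewrite mul1r; congr EFin.
  by rewrite /integrand -/T (mulmxDr (expm (T *: A)) x h) -/k -/m (addrA (z : 'cV[R]_d)).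
apply: (le_trans H).
apply: (@le_trans _ _ ((lam^-1 * K)%:E * (e * eucl m)%:E)%E).
  rewrite lee_wpmul2l ?lee_fin ?mulr_ge0 ?invr_ge0 ?(ltW lam_gt0)//.
  by apply: Hrem; exact: (le_lt_trans mdel hdel).
rewrite -EFinM lee_fin ler_wpM2l ?mulr_ge0 ?invr_ge0 ?(ltW lam_gt0)//.
by rewrite ler_wpM2l// ltW.
Qed.

End fixed_jump.
Lemma Pi_sub_measurable d1 (U : measurableType d1) (F : Omega -> U) n i :
  measurable_fun [set: g_sigma_algebraType (indepPi N xi L1 n i)] F ->
  measurable_fun [set: Omega] F.
Proof. by move=> mF _ B mB; apply: (Pi_sub (mF measurableT B mB)). Qed.

(** * Summing over the jumps and over the values of [N_t] *)

Section fixed_time.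
Variables (t : R) (f : 'cV[R]_d -> R) (K : R).
Hypothesis t_gt0 : 0 < t.
Hypothesis mf : measurable_fun [set: Bd R d] f.
Hypothesis fK : forall x, `|f x| <= K.
Let t0 : 0 <= t := ltW t_gt0.
Let K0 : 0 <= K := le_trans (normr_ge0 _) (fK 0).
Let X x w := OU A (fun t w => L1 t w + cpoisson N xi t w) t x w.
Let Nn n : set Omega := [set w | N t w = n].
Let g := score rho.

Let mN : measurable_fun [set: Omega] (N t).
Proof. exact: (Pi_sub_measurable (@Pi_measurable_N 1 0 t t0)). Qed.

Let mtau k : measurable_fun [set: Omega] (tau k.+1).
Proof. exact: (Pi_sub_measurable (@Pi_measurable_tau 1 0 k)). Qed.

Let mxi' k : measurable_fun [set: Omega] (xi k.+1 : _ -> Bd R d) := rvec_measP (mxi k).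

Let mlevy : measurable_fun [set: Omega] (levy_part L1 A t : _ -> Bd R d).
Proof.
move=> _ B mB; rewrite setTI; apply: (@Pi_sub 1%N 0%N).
apply: sub_sigma_algebra; apply: sub_Pi_L1.
by have := measurable_levy_part Lr A t0 => /(_ measurableT B mB); rewrite setTI.
Qed.

Lemma measurable_OU x : measurable_fun [set: Omega] (X x : _ -> Bd R d).
Proof.
rewrite (_ : X x = fun w => expm (t *: A) *m x + levy_part L1 A t w +
  \sum_(0 <= k < N t w) expm ((t - tau k.+1 w) *: A) *m xi k.+1 w); last first.
  by apply/funext => w; rewrite /X (OU_decomp xi tau1 tauS NtauP Lr Ll).
apply: (@measurable_fun_nat_index _ _ _ (Bd R d) (fun n w =>
  expm (t *: A) *m x + levy_part L1 A t w +
  \sum_(0 <= k < n) expm ((t - tau k.+1 w) *: A) *m xi k.+1 w)) => // n.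
apply: measurable_addv2.
  by apply: measurable_addv2 => //; exact: measurable_cst.
apply: measurable_sumv => k; apply: measurable_mulmxv => // a b.
by apply: measurable_expm_comp; exact: measurable_funB.
Qed.

(** The mean length of the scores, which dominates [score_sum] up to a constant; it is 0 when there
    is no jump, the sum being empty. *)
Definition weight w : R := \sum_(0 <= i < N t w) eucl (g (xi i.+1 w)) / (N t w)%:R.

Let mes i : measurable_fun [set: Omega] (fun w => eucl (g (xi i.+1 w))).
Proof. have mes0 : measurable_fun [set: Bd R d] (fun z => eucl (g z)).
  exact: (measurable_eucl_score rho_ge0 drho).
exact: (measurableT_comp mes0 (mxi' i)). Qed.

Lemma weight_ge0 w : 0 <= weight w.
Proof. by apply: sumr_ge0 => i _; rewrite divr_ge0 ?eucl_ge0. Qed.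

Lemma measurable_weight : measurable_fun [set: Omega] weight.
Proof.
apply: (@measurable_fun_nat_index _ _ _ R (fun n w =>
  \sum_(0 <= i < n) eucl (g (xi i.+1 w)) / n%:R)) => // n.
by apply: measurable_sum => i; apply: measurable_funM.
Qed.

Let meanscore : \bar R := (lam^-1%:E * intRd (fun z => (eucl (grad rho z))%:E))%E.

Let meanscore_ge0 : (0 <= meanscore)%E.
Proof.
rewrite mule_ge0 ?lee_fin ?invr_ge0 ?(ltW lam_gt0)// intRd_ge0// => z.
by rewrite lee_fin eucl_ge0.
Qed.

Let mNn n : measurable (Nn n).
Proof. by rewrite -[Nn n]setTI; apply: (mN measurableT (Y := [set n])). Qed.

Lemma integral_score_jump n i : (i < n)%N ->
  (\int[P]_(w in Nn n) (eucl (g (xi i.+1 w)))%:E = P (Nn n) * meanscore)%E.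
Proof.
move=> ilt; set OG := g_sigma_algebraType (indepPi N xi L1 n i).
have sN : <<s indepPi N xi L1 n i >> (Nn n).
  apply: sub_sigma_algebra; apply: sub_Pi_N; apply: sub_sigma_algebra.
  by exists t => //; exists [set n].
have mNG : (measurable : set (set OG)) (Nn n) by exact: sN.
pose Phi (p : OG * Bd R d) : \bar R := (\1_(Nn n) p.1 * eucl (g p.2))%:E.
have mPhi : measurable_fun setT Phi.
  apply/measurable_EFinP; apply: measurable_funM.
    exact: (measurableT_comp (measurable_indic mNG) measurable_fst).
  have mes0 : measurable_fun [set: Bd R d] (fun z => eucl (g z)).
    exact: (measurable_eucl_score rho_ge0 drho).
  exact: (measurableT_comp mes0 measurable_snd).
have indep E B : <<s indepPi N xi L1 n i >> E -> (measurable : set (set (Bd R d))) B ->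
  P (E `&` xi i.+1 @^-1` B) = (P E * P (xi i.+1 @^-1` B))%E.
  by move=> sE mB; exact: (Pi_indep ilt sE mB).
have Phi0 p : (0 <= Phi p)%E by rewrite lee_fin mulr_ge0 ?eucl_ge0.
have := indep_tonelli (mxi' i) (Pi_sub (i := i)) indep mPhi Phi0.
have -> : (\int[P]_w Phi (w, xi i.+1 w) = \int[P]_(w in Nn n) (eucl (g (xi i.+1 w)))%:E)%E.
  rewrite [RHS]integral_mkcond; apply: eq_integral => w _.
  by rewrite /Phi patchE/= indicE; case: ifPn => _; rewrite ?mul1r ?mul0r.
move=> ->.
pose mu' : {measure set (Bd R d) -> \bar R} :=
  measure_function_pushforward__canonical__measure_function_Measure P (mxi' i).
have mu'E : (\int[mu']_z (eucl (g z))%:E = meanscore)%E.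
  by apply: integral_score => // B mB; exact: lawxi.
transitivity (\int[P]_w (meanscore * (\1_(Nn n) w)%:E))%E.
  apply: eq_integral => w _; rewrite -mu'E muleC.
  rewrite -ge0_integralZl_EFin//.
  - by move=> z _; rewrite lee_fin eucl_ge0.
  - by apply/measurable_EFinP; exact: measurable_eucl_score.
rewrite ge0_integralZl//; last by apply/measurable_EFinP.
by rewrite integral_indic// setIT muleC.
Qed.

Let mu' : {measure set (Bd R d) -> \bar R} :=
  measure_function_pushforward__canonical__measure_function_Measure P (mxi' 0).

Let meanscore_fin : meanscore \is a fin_num.
Proof.
have mu'E B : borelRd B -> mu' B = ((lam^-1)%:E * nu0 rho B)%E by exact: lawxi.
rewrite ge0_fin_numE// /meanscore -(integral_score rho_ge0 drho mu'E).
exact: (integral_score_fin rho_ge0 drho lam_gt0 mu'E eps_gt0).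
Qed.

Let m1 : measurable [set w | (1 <= N t w)%N].
Proof.
rewrite (_ : [set w | _] = N t @^-1` [set n | (1 <= n)%N]) //.
by rewrite -[X in measurable X]setTI; exact: mN.
Qed.

Lemma integral_weight_Nn n : (\int[P]_(w in Nn n) (weight w)%:E <=
  \int[P]_(w in Nn n) (meanscore * (\1_[set w | (1 <= N t w)%N] w)%:E))%E.
Proof.
case: n => [|n].
  rewrite integral0_eq; last first.
    by move=> w Nw; rewrite /weight Nw big_geq.
  by apply: integral_ge0 => w _; rewrite mule_ge0// lee_fin.
have -> : (\int[P]_(w in Nn n.+1) (weight w)%:E = \int[P]_(w in Nn n.+1)
    \sum_(0 <= i < n.+1) ((n.+1%:R^-1)%:E * (eucl (g (xi i.+1 w)))%:E))%E.
  apply: eq_integral => w; rewrite inE => Nw; rewrite /weight Nw -sumEFin.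
  by apply: eq_bigr => i _; rewrite -EFinM mulrC.
rewrite ge0_integral_sum//; last 2 first.
- move=> i; apply: measurable_funTS; apply/measurable_EFinP.
  by apply: measurable_funM.
- by move=> i w _; rewrite -EFinM lee_fin mulr_ge0 ?eucl_ge0.
have -> : (\int[P]_(w in Nn n.+1) (meanscore * (\1_[set w | (1 <= N t w)%N] w)%:E) =
  \int[P]_(w in Nn n.+1) meanscore)%E.
  apply: eq_integral => w; rewrite inE => Nw.
  by rewrite indicE mem_set ?mule1//= Nw.
have -> : (\int[P]_(w in Nn n.+1) meanscore = meanscore * P (Nn n.+1))%E by exact: integral_cst.
rewrite (_ : (\sum_(0 <= i < n.+1) _)%E =
  (\sum_(0 <= i < n.+1) ((n.+1%:R^-1)%:E * (P (Nn n.+1) * meanscore))))%E.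
  rewrite -(fineK meanscore_fin) -(fineK (fin_num_measure P _ (mNn n.+1))) -!EFinM sumEFin. rewrite lee_fin.
  rewrite big_const_nat subn0 iter_addr_0 -mulrnAl -mulr_natr mulVf ?mul1r ?pnatr_eq0//.
  by rewrite mulrC.
apply: eq_big_nat => i /andP[_ ilt].
rewrite ge0_integralZl_EFin//; last 2 first.
- by move=> w _; rewrite lee_fin eucl_ge0.
- by apply: measurable_funTS; exact/measurable_EFinP.
by rewrite integral_score_jump.
Qed.

(** On each event [N_t = n] with [n >= 1] an average of [n] equal means appears, so no factor [n]
    survives and only the probability of having a jump remains. *)
Lemma integral_weight : (\int[P]_w (weight w)%:E <=
  P [set w | (1 <= N t w)%N] * meanscore)%E.
Proof.
have UN : \bigcup_n Nn n = setT by apply/seteqP; split => // w _; exists (N t w).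
have tN : trivIset setT Nn by move=> i j _ _ [w [/= <- <-]].
have -> : (P [set w | (1 <= N t w)%N] * meanscore =
  \int[P]_w (meanscore * (\1_[set w | (1 <= N t w)%N] w)%:E))%E.
  rewrite ge0_integralZl//; last by apply/measurable_EFinP.
  by rewrite integral_indic// setIT muleC.
rewrite -UN !ge0_integral_bigcup//.
- by apply: lee_nneseries => n _ *; [apply: integral_ge0 => w _; rewrite lee_fin weight_ge0|
    exact: integral_weight_Nn].
- by apply: measurable_funTS; apply: emeasurable_funM => //; apply/measurable_EFinP.
- by move=> w _; rewrite mule_ge0// lee_fin.
- by apply: measurable_funTS; apply/measurable_EFinP; exact: measurable_weight.
- by move=> w _; rewrite lee_fin weight_ge0.
Qed.

Definition score_sum x w : 'cV[R]_d :=
  (f (X x w) * ((1 <= N t w)%N)%:R * ((N t w)%:R)^-1) *: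
    \sum_(1 <= i < (N t w).+1) (expm (tau i w *: A^T) *m g (xi i w)).

Let mg k : measurable_fun [set: Omega] (fun w => g (xi k.+1 w) : Bd R d).
Proof. exact: (measurableT_comp (measurable_score rho_ge0 drho) (mxi' k)). Qed.

Let mfX x : measurable_fun setT (fun w => f (X x w)).
Proof. exact: (measurableT_comp mf (measurable_OU x)). Qed.

Lemma measurable_score_sum x i : measurable_fun setT (fun w => score_sum x w i ord0).
Proof.
rewrite (_ : (fun w => _) = fun w => (f (X x w) * ((1 <= N t w)%N)%:R * ((N t w)%:R)^-1) *
   (\sum_(1 <= k < (N t w).+1) (expm (tau k w *: A^T) *m g (xi k w))) i ord0); last first.
  by apply/funext => w; rewrite mxE.
apply: (@measurable_fun_nat_index _ _ _ R (fun n w => (f (X x w) * ((1 <= n)%N)%:R * (n%:R)^-1) *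
   (\sum_(1 <= k < n.+1) (expm (tau k w *: A^T) *m g (xi k w))) i ord0)) => // n.
apply: measurable_funM; first by apply: measurable_funM => //; apply: measurable_funM.
pose S w : 'cV[R]_d := \sum_(0 <= k < n) (expm (tau k.+1 w *: A^T) *m g (xi k.+1 w)).
have mS : measurable_fun setT (S : _ -> Bd R d).
  by apply: measurable_sumv => k; apply: measurable_mulmxv => // a b; exact: measurable_expm_comp.
rewrite (_ : (fun w => _) = fun w => S w i ord0).
  exact: (measurableT_comp (@measurable_coord R d i) mS).
by apply/funext => w; rewrite big_add1.
Qed.

Lemma eucl_score_sum_le c x w : 0 <= c ->
  (forall s v, 0 <= s <= t -> eucl (expm (s *: A^T) *m v) <= c * eucl v) ->
  eucl (score_sum x w) <= K * c * weight w.
Proof.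
move=> c0 Hc; rewrite /score_sum big_add1/= euclZ !normrM -!mulrA.
apply: ler_pM => //; first by rewrite !mulr_ge0 ?eucl_ge0.
rewrite -[leRHS]mul1r; apply: ler_pM; rewrite ?mulr_ge0 ?eucl_ge0//.
  by case: leq; rewrite ?normr1 ?normr0.
rewrite ger0_norm ?invr_ge0// /weight -mulr_suml mulrA mulrC ler_wpM2r ?invr_ge0//.
rewrite (le_trans (eucl_sum _ _))// mulr_sumr big_nat_cond [leRHS]big_nat_cond ler_sum//.
by move=> k /andP[/andP[_ kN] _]; exact: Hc (tau_bound kN erefl).
Qed.

Definition increment x h w : R := f (X (x + h) w) * ((1 <= N t w)%N)%:R
  - f (X x w) * ((1 <= N t w)%N)%:R + inner (score_sum x w) h.

Let fX_integrable x :
  P.-integrable setT (EFin \o (fun w => f (X x w) * ((1 <= N t w)%N)%:R)).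
Proof.
have -> : (fun w => f (X x w) * ((1 <= N t w)%N)%:R) =
  (fun w => f (X x w) * \1_[set w | (1 <= N t w)%N] w).
  by apply/funext => w; rewrite indicE mem_setE.
apply: (@le_integrable _ _ _ P setT _ _ (cst K%:E)) => //.
- by apply/measurable_EFinP; apply: measurable_funM.
- move=> w _ /=; rewrite lee_fin normrM [leRHS]ger0_norm// -[leRHS]mulr1.
  by apply: ler_pM => //; rewrite indicE; case: (_ \in _); rewrite ?normr1 ?normr0.
- exact: finite_measure_integrable_cst.
Qed.

Let cT := expR (mxsum A^T * t).

Let expmT_le s (v : 'cV[R]_d) : 0 <= s <= t -> eucl (expm (s *: A^T) *m v) <= cT * eucl v.
Proof.
move=> /andP[s0 st]; rewrite (le_trans (expm_le _ _ s0))//.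
by rewrite ler_wpM2r ?eucl_ge0// ler_expR ler_wpM2l ?mxsum_ge0.
Qed.

Let weight_integrable : P.-integrable setT (EFin \o weight).
Proof.
apply/integrableP; split; first by apply/measurable_EFinP; exact: measurable_weight.
under eq_integral do rewrite /= ger0_norm ?weight_ge0//.
rewrite (le_lt_trans integral_weight)// -(fineK meanscore_fin).
by rewrite muleC lte_mul_pinfty ?lee_fin ?fine_ge0 ?(le_lt_trans (probability_le1 P m1)) ?ltry.
Qed.

Lemma score_sum_integrable x i : P.-integrable setT (fun w => (score_sum x w i ord0)%:E).
Proof.
apply: (@le_integrable _ _ _ P setT _ _ (fun w => (K * cT)%:E * (weight w)%:E)%E) => //.
- by apply/measurable_EFinP; exact: measurable_score_sum.
- move=> w _; rewrite -EFinM lee_fin/= [leRHS]ger0_norm ?mulr_ge0 ?expR_ge0 ?weight_ge0//.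
  rewrite (le_trans (coord_le_eucl _ _))//; apply: eucl_score_sum_le => //; exact: expR_ge0.
- exact: integrableZl.
Qed.

Let inner_score_integrable x h : P.-integrable setT (fun w => (inner (score_sum x w) h)%:E).
Proof.
have -> : (fun w => (inner (score_sum x w) h)%:E) =
  (fun w => (\sum_(i < d) (h i ord0)%:E * (score_sum x w i ord0)%:E)%E).
  apply/funext => w; rewrite /inner -sumEFin; apply: eq_bigr => i _.
  by rewrite -EFinM mulrC.
apply: integrable_sum => // i _; apply: integrableZl => //; exact: score_sum_integrable.
Qed.

Lemma increment_integrable x h : P.-integrable setT (EFin \o increment x h).
Proof.
have -> : EFin \o increment x h = (fun w => (f (X (x + h) w) * ((1 <= N t w)%N)%:R)%:E
   - (f (X x w) * ((1 <= N t w)%N)%:R)%:E + (inner (score_sum x w) h)%:E)%E.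
  by apply/funext => w.
apply: integrableD => //; apply: integrableB => //; exact: fX_integrable.
Qed.

(** The difference of the two values of [f] is the same for every jump index, so averaging returns
    it unchanged, while the linear terms add up to [score_sum] once the exponentials are
    transposed. *)
Lemma incrementE x h n w : N t w = n.+1 -> increment x h w =
  n.+1%:R^-1 * \sum_(i < n.+1) jump_increment (n := n.+1) (i := i) t f x h (w, xi i.+1 w).
Proof.
move=> Nw; have -> : \sum_(i < n.+1) jump_increment (n := n.+1) (i := i) t f x h (w, xi i.+1 w) =
  \sum_(i < n.+1) (f (X (x + h) w) - f (X x w) +
     f (X x w) * inner (g (xi i.+1 w)) (expm (tau i.+1 w *: A) *m h)).
  apply: eq_bigr => i _; rewrite /jump_increment/= indicE mem_set// mul1r.
  by rewrite /X !(OU_jump (ltn_ord i) _ Nw).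
rewrite big_split/= sumr_const card_ord mulrDr -[(_ - _) *+ _]mulr_natl mulrA mulVf ?pnatr_eq0//.
rewrite mul1r /increment Nw !mulr1; congr (_ + _).
rewrite /score_sum Nw/= mulr1 innerZl big_add1/= big_mkord -mulr_sumr [RHS]mulrCA -[LHS]mulrA.
congr (_ * (_ * _)); rewrite innerC (linear_sum (inner h))/=; apply: eq_bigr => i _.
by rewrite innerC expm_tr inner_trmx.
Qed.

Lemma increment0 x h w : N t w = 0%N -> increment x h w = 0.
Proof.
by move=> Nw; rewrite /increment /score_sum Nw/= !mulr0 big_geq// scaler0 innerC inner0r subrr addr0.
Qed.

Lemma integral_increment_Nn x h (e del : R) n : 0 < e ->
  (forall k, eucl k < del -> (\int[leb R d]_z (taylor_rem rho k z)%:E <= (e * eucl k)%:E)%E) ->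
  expR (mxsum A * t) * eucl h < del ->
  (`|\int[P]_(w in Nn n) (increment x h w)%:E| <=
   (lam^-1 * K * (e * (expR (mxsum A * t) * eucl h)))%:E * P (Nn n))%E.
Proof.
move=> e0 Hrem hdel; set c := _ * _ * _.
have c0 : 0 <= c by rewrite !mulr_ge0 ?eucl_ge0 ?invr_ge0 ?expR_ge0 ?(ltW e0) ?(ltW lam_gt0).
case: n => [|n].
  rewrite integral0_eq ?abse0 ?mule_ge0//.
  by move=> w Nw; rewrite increment0.
have -> : (\int[P]_(w in Nn n.+1) (increment x h w)%:E = \int[P]_w (n.+1%:R^-1%:E *
  \sum_(i < n.+1) (jump_increment (n := n.+1) (i := i) t f x h (w, xi i.+1 w))%:E))%E.
  rewrite integral_mkcond; apply: eq_integral => w _; rewrite patchE.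
  case: ifPn => [|Nw]; first by rewrite inE => Nw; rewrite (incrementE _ _ Nw) sumEFin EFinM.
  rewrite big1 ?mule0// => i _.
  by rewrite /jump_increment indicE (negbTE Nw) mul0r.
have ji (i : 'I_n.+1) : P.-integrable setT
    (fun w => (jump_increment (n := n.+1) (i := i) t f x h (w, xi i.+1 w))%:E).
  by have := @jump_increment_integrable n.+1 i (ltn_ord i) t f K t_gt0 mf fK x h.
rewrite integralZl//; last by apply: integrable_sum => // i _; exact: ji.
rewrite integral_sum// abseM gee0_abs ?lee_fin ?invr_ge0//.
apply: (@le_trans _ _ (n.+1%:R^-1%:E * \sum_(i < n.+1) (c%:E * P (Nn n.+1)))%E).
  rewrite lee_wpmul2l ?lee_fin ?invr_ge0// (le_trans (lee_abs_sum _ _ _))// lee_sum// => i _.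
  by have := @jump_increment_bound n.+1 i (ltn_ord i) t f K t_gt0 mf fK x h e del e0 Hrem hdel.
rewrite -(fineK (fin_num_measure P _ (mNn n.+1))) -!EFinM sumEFin -EFinM lee_fin.
by rewrite sumr_const card_ord -[X in _ * X]mulr_natl mulrA mulVf ?mul1r ?pnatr_eq0.
Qed.

Lemma integral_increment x h (e del : R) : 0 < e ->
  (forall k, eucl k < del -> (\int[leb R d]_z (taylor_rem rho k z)%:E <= (e * eucl k)%:E)%E) ->
  expR (mxsum A * t) * eucl h < del ->
  (`|\int[P]_w (increment x h w)%:E| <=
   (lam^-1 * K * (e * (expR (mxsum A * t) * eucl h)))%:E)%E.
Proof.
move=> e0 Hrem hdel; apply: (integral_partition_bound mN (increment_integrable x h)).
  by rewrite !mulr_ge0 ?eucl_ge0 ?invr_ge0 ?expR_ge0 ?(ltW e0) ?(ltW lam_gt0).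
move=> n; exact: integral_increment_Nn e0 Hrem hdel.
Qed.

Let P1 x := Rintegral P [set: Omega] (fun w => f (X x w) * ((1 <= N t w)%N)%:R).

Lemma int_inner_score x h :
  Rintegral P setT (fun w => inner (score_sum x w) h) = inner (Evec P (score_sum x)) h.
Proof.
have ii i : P.-integrable setT (EFin \o (fun w => score_sum x w i ord0 * h i ord0)).
  have -> : EFin \o (fun w => score_sum x w i ord0 * h i ord0) =
    (fun w => (h i ord0)%:E * (score_sum x w i ord0)%:E)%E.
    by apply/funext => w; rewrite -EFinM mulrC.
  by apply: integrableZl => //; exact: score_sum_integrable.
rewrite /inner (Rintegral_sum _ measurableT ii).2; apply: eq_bigr => i _; rewrite mxE.
by rewrite RintegralZr//; exact: score_sum_integrable.
Qed.

Lemma Rintegral_increment x h : Rintegral P setT (increment x h) =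
  P1 (x + h) - P1 x + inner (Evec P (score_sum x)) h.
Proof.
have iB : P.-integrable setT (EFin \o (fun w => f (X (x + h) w) * ((1 <= N t w)%N)%:R
  - f (X x w) * ((1 <= N t w)%N)%:R)) by apply: (integrableB measurableT (fX_integrable _) (fX_integrable _)).
rewrite -int_inner_score /P1 -(RintegralB measurableT (fX_integrable _) (fX_integrable _)).
by rewrite -(RintegralD measurableT iB (inner_score_integrable x h)).
Qed.

Lemma killed_semigroup_grad x : differentiable P1 x /\ grad P1 x = - Evec P (score_sum x).
Proof.
apply: differentiable_inner => e e0.
pose C := expR (mxsum A * t).
have C0 : 0 < C by exact: expR_gt0.
(* [e] will be divided by the constant of the increment estimate; the extra 1 keeps the divisor
   positive when [K = 0]. *)
have b0 : 0 < lam^-1 * K * C + 1 by rewrite ltr_wpDl// !mulr_ge0 ?invr_ge0 ?(ltW lam_gt0) ?(ltW C0).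
have [del del0 Hdel] := taylor_rem_little_o drho eps_gt0 supfin (divr_gt0 e0 b0).
exists (del / C); first exact: divr_gt0.
move=> h hdel; rewrite (innerC (- _)) innerNr opprK (innerC h) -Rintegral_increment.
have hC : C * eucl h < del by rewrite mulrC -ltr_pdivlMr.
have := integral_increment x (divr_gt0 e0 b0) Hdel hC.
rewrite /Rintegral -[X in (`|X| <= _)%E]fineK; last first.
  by apply: integrable_fin_num => //; exact: increment_integrable.
rewrite lee_fin => /le_trans; apply.
have -> : lam^-1 * K * (e / (lam^-1 * K * C + 1) * (C * eucl h)) =
  (lam^-1 * K * C / (lam^-1 * K * C + 1)) * (e * eucl h).
  by rewrite -/C; move: (lam^-1) (_^-1) => a b; ring.
rewrite ler_piMl ?mulr_ge0 ?eucl_ge0 ?(ltW e0)//.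
by rewrite ler_pdivrMr// mul1r lerDl.
Qed.

(** The norm of a vector mean is bounded by testing it against itself: [eucl u ^+ 2] is the mean of
    the inner product of [score_sum] with [u], at most [eucl u] times the mean of its length. *)
Lemma eucl_grad_le c x : 0 <= c ->
  (forall s v, 0 <= s <= t -> eucl (expm (s *: A^T) *m v) <= c * eucl v) ->
  ((eucl (Evec P (score_sum x)))%:E <=
    (K * c)%:E * (P [set w | (1 <= N t w)%N] * meanscore))%E.
Proof.
move=> c0 Hc; set u := Evec P _.
have Kc0 : 0 <= K * c by rewrite mulr_ge0.
have [u0|u0] := eqVneq (eucl u) 0; first by rewrite u0 mule_ge0// mule_ge0.
have u_gt0 : 0 < eucl u by rewrite lt_neqAle eq_sym u0 eucl_ge0.
have Kw : (\int[P]_w (K * c * weight w)%:E <=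
    (K * c)%:E * (P [set w | (1 <= N t w)%N] * meanscore))%E.
  under eq_integral do rewrite EFinM.
  rewrite ge0_integralZl_EFin//; last 2 first.
  - by move=> w _; rewrite lee_fin weight_ge0.
  - by apply/measurable_EFinP; exact: measurable_weight.
  by rewrite lee_wpmul2l ?lee_fin// integral_weight.
apply: le_trans Kw.
have iKw : P.-integrable setT (EFin \o (fun w => K * c * weight w)).
  have -> : EFin \o (fun w => K * c * weight w) = (fun w => (K * c)%:E * (weight w)%:E)%E.
    by apply/funext => w; rewrite /= EFinM.
  exact: integrableZl.
rewrite -[leRHS]fineK; last exact: integrable_fin_num.
rewrite lee_fin -(ler_pM2r u_gt0) -expr2 sqr_eucl.
rewrite -[X in X * _]/(Rintegral P setT (fun w => K * c * weight w)) -RintegralZr//.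
rewrite {1}/u -int_inner_score; apply: le_Rintegral => //.
- exact: inner_score_integrable.
- have -> : EFin \o (fun w => K * c * weight w * eucl u) =
    (fun w => (eucl u)%:E * (K * c * weight w)%:E)%E.
    by apply/funext => w; rewrite /= -EFinM mulrC.
  exact: integrableZl.
move=> w _; rewrite (le_trans (ler_norm _))// (le_trans (inner_le _ _))//.
by rewrite ler_wpM2r ?eucl_ge0//; exact: eucl_score_sum_le.
Qed.

End fixed_time.
End main_estimate.

(** * The gradient formula *)

Section integral_full_set.
Import HBNNSimple.
Context d0 (T : measurableType d0) (R : realType) (mu : {measure set T -> \bar R}).

(** Only [E] is measurable. A simple function below [f], cut off outside [E], lies below [g] and
    keeps its integral. *)
Lemma ge0_le_integral_full (E : set T) (f g : T -> \bar R) :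
  measurable E -> mu (~` E) = 0%E -> (forall x, (0 <= f x)%E) -> (forall x, (0 <= g x)%E) ->
  (forall x, E x -> (f x <= g x)%E) -> (\int[mu]_x f x <= \int[mu]_x g x)%E.
Proof.
move=> mE E0 f0 g0 fg; rewrite [leLHS]ge0_integralTE//; apply: ge_ereal_sup => _ /= [h hf <-].
rewrite -integralT_nnsfun /=.
have mh : measurable_fun setT (fun x => (h x)%:E) by exact/measurable_EFinP.
have -> : (\int[mu]_x (h x)%:E = \int[mu]_x ((fun x => (h x)%:E) \_ E) x)%E.
  apply: ae_eq_integral => //.
    by apply/(measurable_restrictT _ mE); exact: measurable_funTS.
  exists (~` E); split => //; first exact: measurableC.
  by move=> x /= H Ex; apply: H => _; rewrite patchE mem_set.
apply: ge0_le_integralT => x; rewrite patchE; case: ifPn => //.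
  by move=> _; rewrite lee_fin.
by rewrite inE => Ex; exact: le_trans (hf x) (fg x Ex).
Qed.

(* Applied with [f] containing [grad (ln \o rho)], whose junk values where [rho]
   vanishes need not depend measurably on the point. *)
Lemma Rintegral_full (E : set T) (f g : T -> R) :
  measurable E -> mu (~` E) = 0%E -> (forall x, E x -> f x = g x) ->
  Rintegral mu setT f = Rintegral mu setT g.
Proof.
move=> mE E0 fg; rewrite /Rintegral [X in fine X = _]integralE [X in _ = fine X]integralE; congr (fine (_ - _)).
  by apply/eqP; rewrite eq_le; apply/andP; split; apply: (ge0_le_integral_full mE E0) => // x Ex;
    rewrite !funeposE fg.
by apply/eqP; rewrite eq_le; apply/andP; split; apply: (ge0_le_integral_full mE E0) => // x Ex;
  rewrite !funenegE fg.
Qed.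
End integral_full_set.

Section density_facts.
Variables (R : realType) (d : nat) (rho : 'cV[R]_d -> R).
Hypothesis rho_ge0 : forall z, 0 <= rho z.

Lemma nu0_null (B : set 'cV[R]_d) : (forall z, B z -> rho z = 0) -> nu0 rho B = 0%E.
Proof.
move=> B0; rewrite /nu0 (_ : (fun z => _) = cst 0%E).
  by elim: (d) => [//|n IH] /=; apply: integral0_eq => x _.
apply/funext => z; rewrite indicE; have [/[!inE]/B0->|_] := boolP (z \in B).
  by rewrite mulr0.
by rewrite mul0r.
Qed.

(** Transfers the hypothesis from closed to open balls; monotonicity is used at the level of
    [intRd], where the closed-ball supremum need not be measurable. *)
Lemma gradsup_closed_ball (eps : R) : 0 < eps ->
  (intRd (fun z => ereal_sup [set (eucl (grad rho x))%:E
                             | x in [set x | (eucl (x - z) <= eps)%R]]) < +oo)%E ->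
  (\int[leb R d]_z gradsup rho eps z < +oo)%E.
Proof.
move=> eps0; apply: le_lt_trans; rewrite integral_leb; last 2 first.
- exact: measurable_gradsup.
- by move=> z; exact: gradsup_ge0.
apply: le_intRd => z; first exact: gradsup_ge0.
by apply: le_ereal_sup => _ /= [x xz <-]; exists x => //; exact: ltW.
Qed.
End density_facts.

(** The outermost integrand vanishes except at the point 0 of the line, which is Lebesgue-null; this
    is where positive dimension enters. *)
Lemma nu0_set0 (R : realType) (d : nat) (rho : 'cV[R]_d.+1 -> R) :
  (forall z, 0 <= rho z) -> nu0 rho [set 0] = 0%E.
Proof.
move=> rho_ge0; rewrite /nu0/=; set F := (fun x => _).
have F0 x : x != 0 -> F x = 0%E.
  move=> x0; rewrite /F (_ : (fun y => _) = cst 0%E).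
    by elim: (d) => [//|n IH] /=; apply: integral0_eq => y _.
  apply/funext => y; rewrite indicE memNset ?mul0r//= => /matrixP/(_ ord0 ord0).
  by rewrite !mxE unlift_none => /eqP; apply/negP.
have -> : (\int[lebesgue_measure]_(x in [set: R]) F x)%E =
  (\int[lebesgue_measure]_(x in [set: R]) (F \_ [set 0%R]) x)%E.
  apply: eq_integral => x _; rewrite patchE; case: ifPn => //.
  by rewrite notin_setE => /eqP/F0.
rewrite -integral_mkcond.
by rewrite integral_set1.
Qed.

(** A jump has occurred by time [t] exactly when [tau 1], which is the zeroth gap, is at most
    [t]. *)
Lemma poisson_prob_ge1 d0 (Omega : measurableType d0) (R : realType) (P : probability Omega R)
    (lam : R) (N : R -> Omega -> nat) (tau : nat -> Omega -> R) (t : R) : 0 <= t ->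
  poisson_jumps P lam N tau ->
  P [set w | (1 <= N t w)%N] = (1 - expR (- (lam * t)))%:E.
Proof.
move=> t0 [_ _ NtauP _ /(_ 0%N t)]; rewrite t0 => <-; congr (P _).
by apply/seteqP; split => w /=; rewrite /gap subr0 => /(NtauP t w 1%N erefl).
Qed.

Section ornstein_uhlenbeck.
Variables (R : realType) (d : nat) (d0 : measure_display) (Omega : measurableType d0).
Variables (P : probability Omega R) (A : 'M[R]_d) (rho0 : 'cV[R]_d -> R) (lam0 eps : R).
Variables (N : R -> Omega -> nat) (tau : nat -> Omega -> R).
Variables (xi : nat -> Omega -> 'cV[R]_d) (L1 : R -> Omega -> 'cV[R]_d).
Hypothesis rho_ge0 : forall z, 0 <= rho0 z.
Hypothesis drho : forall z, differentiable rho0 z.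
Hypothesis rho_int : intRd (fun z => (rho0 z)%:E) = lam0%:E.
Hypothesis lam_gt0 : 0 < lam0.
Hypothesis eps_gt0 : 0 < eps.
Hypothesis supfin : (intRd (fun z => ereal_sup [set (eucl (grad rho0 x))%:E
                             | x in [set x | (eucl (x - z) <= eps)%R]]) < +oo)%E.
Hypothesis pois : poisson_jumps P lam0 N tau.
Hypothesis mxi : forall i, rvec_meas (xi i.+1).
Hypothesis indxi : indep_fam P (fun i : nat => sig_rv (xi i.+1)).
Hypothesis lawxi : forall i B, borelRd B ->
  P (xi i.+1 @^-1` B) = ((lam0^-1)%:E * nu0 rho0 B)%E.
Hypothesis indN : indep2 P (<<s \bigcup_(i in [set: nat]) sig_rv (xi i.+1) >>)
           (<<s \bigcup_(t in [set t : R | 0 <= t]) sig_nat (N t) >>).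
Hypothesis levyL1 : levy_process P L1.
Hypothesis indL : indep2 P (sig_proc L1) (sig_proc (cpoisson N xi)).
Hypothesis dim_gt0 : (0 < d)%N.

Let tau1 : forall w, 0 < tau 1 w.
Proof. by case: pois => -[]. Qed.

Let mtau : forall k, measurable_fun setT (tau k.+1).
Proof. by case: pois => -[]. Qed.

Let tauS : forall w k, (0 < k)%N -> tau k w < tau k.+1 w.
Proof. by case: pois. Qed.

Let NtauP : forall t w k, (0 < k)%N -> ((k <= N t w)%N <-> tau k w <= t).
Proof. by case: pois. Qed.

Let xi_neq0 i : P (xi i.+1 @^-1` [set 0]) = 0%E.
Proof.
have m0 : borelRd [set (0 : 'cV[R]_d)] := @measurable_set0v R d.
rewrite lawxi//; case: (d) dim_gt0 (rho0) rho_ge0 => // n _ r r0.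
by rewrite nu0_set0// mule0.
Qed.

Let mL1 t : 0 <= t -> rvec_meas (L1 t).
Proof. by case: levyL1 => -[_ H] _ _ _ _; exact: H. Qed.

Let Lr w t : 0 <= t -> (fun s => L1 s w) @ at_right t --> L1 t w.
Proof. by case: levyL1 => _ H _ _ _; exact: H. Qed.

Let Ll w t : 0 < t -> cvg ((fun s => L1 s w) @ at_left t).
Proof. by case: levyL1 => _ _ H _ _; exact: H. Qed.

Let Pi_sub n i : <<s indepPi N xi L1 n i >> `<=` (@measurable _ Omega).
Proof.
apply: smallest_sub; first exact: sigma_algebra_measurable.
exact: (indepPi_sub tau1 tauS NtauP mtau mxi mL1).
Qed.

Let Pi_indep n i E D : (i < n)%N -> <<s indepPi N xi L1 n i >> E -> borelRd D ->
  P (E `&` xi i.+1 @^-1` D) = (P E * P (xi i.+1 @^-1` D))%E.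
Proof. exact: (indepPi_indep tau1 tauS NtauP mtau mxi xi_neq0 mL1 indL indN indxi). Qed.

Let gradsup_fin := gradsup_closed_ball eps_gt0 supfin.

(** The almost sure event on which the gradient of [ln] of the density at every jump is the
    score. *)
Let support : set Omega := \bigcap_i (xi i.+1 @^-1` [set z | 0 < rho0 z]).

Let mpos : measurable ([set z | 0 < rho0 z] : set (Bd R d)).
Proof.
have := measurable_differentiable drho measurableT (Y := `]0, +oo[%classic).
rewrite setTI => /(_ (measurable_itv _)); congr measurable.
by apply/seteqP; split => z /=; rewrite in_itv/= andbT.
Qed.

Let msupport : measurable support.
Proof. by apply: bigcapT_measurable => i; exact: mxi. Qed.

Let support_full : P (~` support) = 0%E.
Proof.
have mC i : measurable (~` (xi i.+1 @^-1` [set z | 0 < rho0 z])).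
  by apply: measurableC; exact: mxi.
apply/negligibleP; first exact: measurableC.
rewrite setC_bigcap; apply: negligible_bigcup => i; apply/negligibleP; first exact: mC.
rewrite preimage_setC; transitivity (lam0^-1%:E * nu0 rho0 (~` [set z | (0 < rho0 z)%R]))%E.
  by apply: lawxi; exact: (@measurableC _ (Bd R d)).
rewrite nu0_null ?mule0// => z /= /negP; rewrite -leNgt => z0.
by apply/eqP; rewrite eq_le z0 rho_ge0.
Qed.

Let Evec_score t f x : Evec P (score_sum A rho0 N tau xi L1 t f x) =
  Evec P (fun w => (f (OU A (fun t w => L1 t w + cpoisson N xi t w) t x w)
     * ((1 <= N t w)%N)%:R * ((N t w)%:R)^-1) *:
              \sum_(1 <= i < (N t w).+1)
                 (expm (tau i w *: A^T) *m grad (fun z => ln (rho0 z)) (xi i w))).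
Proof.
apply/matrixP => i j; rewrite mxE [RHS]mxE; apply: (Rintegral_full msupport support_full) => w Ew.
rewrite /score_sum; congr (fun_of_matrix (_ *: _) i ord0); apply: eq_big_nat => -[//|k] _.
by rewrite grad_ln_rho//; exact: Ew.
Qed.

Let P1 t (f : 'cV[R]_d -> R) y := Rintegral P setT (fun w =>
    f (OU A (fun t w => L1 t w + cpoisson N xi t w) t y w) * ((1 <= N t w)%N)%:R).

Let score_grad t (f : 'cV[R]_d -> R) x : 0 < t -> bounded_measurable f ->
  differentiable (P1 t f) x /\
  grad (P1 t f) x = - Evec P (score_sum A rho0 N tau xi L1 t f x).
Proof.
move=> t0 [mf [K fK]].
apply: (killed_semigroup_grad A rho_ge0 drho rho_int lam_gt0 eps_gt0 gradsup_fin
  tau1 tauS NtauP mxi lawxi Lr Ll Pi_sub Pi_indep t0 _ fK).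
by move=> _ B mB; rewrite setTI; exact: mf.
Qed.

Lemma killed_grad t (f : 'cV[R]_d -> R) x : 0 < t -> bounded_measurable f ->
  differentiable (P1 t f) x /\
  grad (P1 t f) x = - Evec P (fun w => (f (OU A (fun t w => L1 t w + cpoisson N xi t w) t x w)
     * ((1 <= N t w)%N)%:R * ((N t w)%:R)^-1) *:
              \sum_(1 <= i < (N t w).+1)
                 (expm (tau i w *: A^T) *m grad (fun z => ln (rho0 z)) (xi i w))).
Proof. by move=> t0 fb; rewrite -Evec_score; exact: score_grad. Qed.

Lemma killed_grad_le (theta t : R) (f : 'cV[R]_d -> R) x :
  (forall y : 'cV[R]_d, inner y (A *m y) <= - theta * eucl y ^+ 2) ->
  0 < t -> bounded_measurable f ->
  ((eucl (grad (P1 t f) x))%:E <=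
       (supnorm f * expR (Num.max (- theta) 0 * t) * (1 - expR (- (lam0 * t))) / lam0)%:E
       * intRd (fun z => (eucl (grad rho0 z))%:E))%E.
Proof.
move=> HA t0 fb; have [mf [K fK]] := fb.
rewrite (score_grad x t0 fb).2 euclN.
have fsup y : `|f y| <= supnorm f.
  apply: sup_ubound; last by exists y.
  by exists K => _ [z _ <-].
have mf' : measurable_fun [set: Bd R d] f by move=> _ B mB; rewrite setTI; exact: mf.
have c0 : 0 <= expR (Num.max (- theta) 0 * t) by exact: expR_ge0.
(* A matrix and its transpose have the same quadratic form, so the dissipativity of [A] controls the
   exponentials of [A^T] in the formula. *)
have HAT (y : 'cV[R]_d) : inner y (A^T *m y) <= - theta * eucl y ^+ 2.
  by rewrite innerC inner_trmx.
have Hc s (v : 'cV[R]_d) : 0 <= s <= t ->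
    eucl (expm (s *: A^T) *m v) <= expR (Num.max (- theta) 0 * t) * eucl v.
  move=> /andP[s0 st]; rewrite (le_trans (expm_dissipative HAT v s0))//.
  rewrite ler_wpM2r ?eucl_ge0// ler_expR.
  apply: (@le_trans _ _ (Num.max (- theta) 0 * s)).
    by rewrite ler_wpM2r// le_max lexx.
  by rewrite ler_wpM2l// le_max lexx orbT.
have := eucl_grad_le rho_ge0 drho lam_gt0 eps_gt0 gradsup_fin
  tau1 tauS NtauP mxi lawxi Lr Ll Pi_sub Pi_indep t0 mf' fsup x c0 Hc.
by move=> /le_trans; apply; rewrite (poisson_prob_ge1 (ltW t0) pois) !muleA -!EFinM.
Qed.

End ornstein_uhlenbeck.

Unset Implicit Arguments.

Theorem theorem3p1
  (R : realType) (d : nat) (d0 : measure_display) (Omega : measurableType d0)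
  (P : probability Omega R)
  (A : 'M[R]_d) (nu : set 'cV[R]_d -> \bar R) (rho0 : 'cV[R]_d -> R)
  (lam0 eps : R)
  (N : R -> Omega -> nat) (tau : nat -> Omega -> R)
  (xi : nat -> Omega -> 'cV[R]_d) (L1 : R -> Omega -> 'cV[R]_d) :
  (* rho0 : non-negative, differentiable, nu >= nu0 := rho0(z) dz *)
  (forall z, 0 <= rho0 z) ->
  (forall z, differentiable rho0 z) ->
  (forall B, borelRd B -> (nu0 rho0 B <= nu B)%E) ->
  (* lambda0 = int rho0 in (0, oo) *)
  intRd (fun z => (rho0 z)%:E) = lam0%:E -> 0 < lam0 ->
  (* int sup_{|x-z|<=eps} |grad rho0|(x) dz < oo for some eps > 0 *)
  0 < eps ->
  (intRd (fun z => ereal_sup [set (eucl (grad rho0 x))%:E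
                             | x in [set x | (eucl (x - z) <= eps)%R]]) < +oo)%E ->
  (* N: Poisson process of rate lam0 with jump times tau_1 < tau_2 < ... *)
  poisson_jumps P lam0 N tau ->
  (* xi_1, xi_2, ... i.i.d. with law nu0 / lam0, independent of N *)
  (forall i, rvec_meas (xi i.+1)) ->
  indep_fam P (fun i : nat => sig_rv (xi i.+1)) ->
  (forall i B, borelRd B -> P (xi i.+1 @^-1` B) = ((lam0^-1)%:E * nu0 rho0 B)%E) ->
  indep2 P (<<s \bigcup_(i in [set: nat]) sig_rv (xi i.+1) >>)
           (<<s \bigcup_(t in [set t : R | 0 <= t]) sig_nat (N t) >>) ->
  (* L1: Levy process with Levy measure nu - nu0, independent of L0 *)
  levy_process P L1 ->
  (forall B, borelRd B -> levy_measure P L1 B = (nu B - nu0 rho0 B)%E) ->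
  indep2 P (sig_proc L1) (sig_proc (cpoisson N xi)) ->
  let L := fun t w => L1 t w + cpoisson N xi t w in
  let X := fun t x w => OU A L t x w in
  let P1 := fun t (f : 'cV[R]_d -> R) x =>
     Rintegral P [set: Omega] (fun w => f (X t x w) * ((1 <= N t w)%N)%:R) in
  (forall t (f : 'cV[R]_d -> R), 0 < t -> bounded_measurable f ->
     forall x, differentiable (P1 t f) x /\
       grad (P1 t f) x =
       - Evec P (fun w => (f (X t x w) * ((1 <= N t w)%N)%:R * ((N t w)%:R)^-1) *:
              \sum_(1 <= i < (N t w).+1)
                 (expm (tau i w *: A^T) *m grad (fun z => ln (rho0 z)) (xi i w))))
  /\
  (forall theta : R, (forall y : 'cV[R]_d, inner y (A *m y) <= - theta * eucl y ^+ 2) ->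
   forall t (f : 'cV[R]_d -> R), 0 < t -> bounded_measurable f ->
     forall x, ((eucl (grad (P1 t f) x))%:E <=
       (supnorm f * expR (Num.max (- theta) 0 * t) * (1 - expR (- (lam0 * t))) / lam0)%:E
       * intRd (fun z => (eucl (grad rho0 z))%:E))%E).
Proof.
move=> rho_ge0 drho _ rho_int lam_gt0 eps_gt0 supfin pois mxi indxi lawxi indN levyL1 _ indL L X P1.
(* When [d = 0] all jumps are zero and [N] cannot be read off the path, but there is only one
   vector: functions are constant, gradients are 0, and the right side of the bound is
   non-negative. *)
have [d_eq0|d_gt0] := posnP d; last first.
  split=> [t f t0 fb x|theta HA t f t0 fb x].
    exact: (killed_grad A rho_ge0 drho rho_int lam_gt0 eps_gt0 supfin pois mxi indxi lawxi indN
      levyL1 indL d_gt0 x t0 fb).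
  exact: (killed_grad_le rho_ge0 drho rho_int lam_gt0 eps_gt0 supfin pois mxi indxi lawxi indN
      levyL1 indL d_gt0 x HA t0 fb).
have eq0 (y : 'cV[R]_d) : y = 0.
  by apply/matrixP => i; have := ltn_ord i; rewrite [X in (_ < X)%N]d_eq0.
split=> [t f t0 fb x|theta HA t f t0 fb x].
  split; last by rewrite [LHS]eq0 [RHS]eq0.
  rewrite (_ : P1 t f = cst (P1 t f 0)); first exact: differentiable_cst.
  by apply/funext => y; rewrite [y]eq0.
have [_ [K fK]] := fb.
rewrite [grad _ _]eq0 eucl0 mule_ge0 ?intRd_ge0//; last first.
  by move=> z; rewrite lee_fin eucl_ge0.
rewrite lee_fin divr_ge0 ?(ltW lam_gt0)// mulr_ge0 ?mulr_ge0 ?expR_ge0//; last first.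
  by rewrite subr_ge0 expR_le1 oppr_le0 mulr_ge0 ?ltW.
apply: (le_trans (normr_ge0 (f 0))); apply: sup_ubound; last by exists 0.
by exists K => _ [z _ <-].
Qed.
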